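(* (Chaos decomposition.) Let $A\in L(\ell^2(\mathcal H))$ be self-adjoint and positive definite, and let $F\in L^2(\mu_A)$. Then for each $n\in\mathbb N_0$ there exists a unique $f^{(n)}\in\ell_A^2(\mathcal H)^{\widehat\otimes n}$ such that $$F=\sum_{n=0}^\infty\big\langle f^{(n)},\colon\cdot^{\otimes n}\colon\big\rangle$$ in the $L^2(\mu_A)$ sense. We then have $\|F\|_{L^2(\mu_A)}^2=\sum_{n=0}^\infty n!\,\|f^{(n)}\|_A^2$.
   Context: Setting. $\mathcal H$ is a real separable infinite-dimensional Hilbert space and $\mathcal N\subset\mathcal H\subset\mathcal N'$ a Gel'fand triple, i.e. $\mathcal N$ is a real topological vector space whose topology is given by increasing, compatible Hilbert norms $\|\cdot\|_p$, $p\in\mathbb N_0$ (compatible: a sequence $\|\cdot\|_p$-converging to $0$ and $\|\cdot\|_q$-Cauchy also $\|\cdot\|_q$-converges to $0$), $\mathcal N$ is complete as a metrizable space, its completions $\mathcal N_p$ with respect to $\|\cdot\|_p$ satisfy $\mathcal N_0=\mathcal H$, and the inclusions $\mathcal N_{p+1}\hookrightarrow\mathcal N_p$ are Hilbert–Schmidt. $\ell^2(\mathcal H)$ is the Hilbert space of square summable sequences in $\mathcal H$; $\ell^2_p(\mathcal N_p)=\{f\in\mathcal N_p^{\mathbb N}:\sum_k k^{2p}\|f_k\|_p^2<\infty\}$; $s(\mathcal N):=\bigcap_{p\in\mathbb N_0}\ell_p^2(\mathcal N_p)$ with the topology given by these norms; $s'(\mathcal N)$ is its topological dual with dual pairing $\langle\phi,\omega\rangle=\omega(\phi)$,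 equipped with the $\sigma$-algebra generated by the maps $\omega\mapsto\langle\phi,\omega\rangle$, $\phi\in s(\mathcal N)$. For self-adjoint positive definite $A\in L(\ell^2(\mathcal H))$ (i.e. $(f,Af)>0$ for $f\neq0$), $(f,g)_A:=(f,Ag)_{\ell^2(\mathcal H)}$, $\|f\|_A:=\sqrt{(f,f)_A}$, and $\mu_A$ is the unique probability measure on $s'(\mathcal N)$ with $\int\exp(i\langle\phi,\omega\rangle)\,d\mu_A(\omega)=\exp(-\tfrac12(\phi,\phi)_A)$ for all $\phi\in s(\mathcal N)$ (Bochner–Minlos). $L^2(\mu_A)$ is the real space $L^2(s'(\mathcal N),\mu_A;\mathbb R)$. $\ell_A^2(\mathcal H)$ is the completion of $\ell^2(\mathcal H)$ with respect to $(\cdot,\cdot)_A$. Tensor powers. $s(\mathcal N)^{\otimes n}$ is the algebraic tensor power, $s(\mathcal N)^{\widehat\otimes n}$ its subspace of symmetric tensors. $\ell_A^2(\mathcal H)^{\otimes n}$ is the Hilbert space tensor power (completion with respect to $(f_1\otimes\cdots\otimes f_n,g_1\otimes\cdots\otimes g_n)_A=\prod_k(f_k,g_k)_A$), and $\ell_A^2(\mathcal H)^{\widehat\otimes n}$ is the closure in it of the span of $\{f^{\otimes n}\}$; the $0$-th powers are $\mathbb R$. $s(\mathcal N)^{\widehat\otimes n}$ is dense in $\ell_A^2(\mathcal H)^{\widehat\otimes n}$. Wick powers. $\tau_A:s(\mathcal N)^{\otimes2}\to\mathbb R$ is the linear map with $\tau_A(\phi\otimes\psi)=(\phi,\psi)_A$.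 For $\omega\in s'(\mathcal N)$ define linear functionals $\colon\omega^{\otimes n}\colon$ on $s(\mathcal N)^{\otimes n}$ by $\colon\omega^{\otimes0}\colon=\mathrm{id}_{\mathbb R}$, $\colon\omega^{\otimes1}\colon=\omega$, $\colon\omega^{\otimes n}\colon=\omega\widehat\otimes\colon\omega^{\otimes n-1}\colon-(n-1)\tau_A\widehat\otimes\colon\omega^{\otimes n-2}\colon$ for $n\ge2$, where $F\widehat\otimes G$ is the tensor product functional $F\otimes G$ composed with symmetrization of tensors. For $f^{(n)}\in\ell_A^2(\mathcal H)^{\widehat\otimes n}$, $\langle f^{(n)},\colon\cdot^{\otimes n}\colon\rangle\in L^2(\mu_A)$ is the $L^2(\mu_A)$-limit of $\omega\mapsto\langle\phi_k^{(n)},\colon\omega^{\otimes n}\colon\rangle$ for any sequence $\phi_k^{(n)}\in s(\mathcal N)^{\widehat\otimes n}$ converging to $f^{(n)}$ in $\ell_A^2(\mathcal H)^{\otimes n}$ (the limit exists and does not depend on the sequence). *)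

(* Defs.v *)
From HB Require Import structures.
From mathcomp Require Import all_fingroup.
From mathcomp Require Import all_boot all_order all_algebra generic_quotient.
From mathcomp Require Import all_classical all_reals all_analysis.
From mathcomp.real_closed Require Import complex.
From mathcomp Require Import ring lra.

Set Implicit Arguments.
Unset Strict Implicit.
Unset Printing Implicit Defensive.

Import Order.TTheory GRing.Theory Num.Theory.
Import numFieldNormedType.Exports.

Local Open Scope classical_set_scope.
Local Open Scope ring_scope.

HB.mixin Record NormedModule_hasInner (R : realType) V
    & NormedModule R V := {
  inner : V -> V -> R;
  innerC : forall x y, inner x y = inner y x;
  innerPl : forall a x y z, inner (a *: x + y) z = a * inner x z + inner y z;
  inner_norm : forall x, inner x x = `|x| ^+ 2
}.

#[short(type="prehilbertType")]
HB.structure Definition PreHilbert (R : realType) :=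
  {V of NormedModule R V & NormedModule_hasInner R V}.

#[short(type="hilbertType")]
HB.structure Definition Hilbert (R : realType) :=
  {V of CompleteNormedModule R V & NormedModule_hasInner R V}.

HB.factory Record Lmodule_hasInner (R : realType) V & GRing.Lmodule R V := {
  inner : V -> V -> R;
  innerC : forall x y, inner x y = inner y x;
  innerPl : forall a x y z, inner (a *: x + y) z = a * inner x z + inner y z;
  inner_gt0 : forall x, x != 0 -> 0 < inner x x
}.

HB.builders Context R V & Lmodule_hasInner R V.

Let norm x := Num.sqrt (inner x x).

Let innerDl x y z : inner (x + y) z = inner x z + inner y z.
Proof. by rewrite -[x]scale1r innerPl scale1r mul1r. Qed.

Let inner0l z : inner 0 z = 0.
Proof. by apply: (addrI (inner 0 z)); rewrite -innerDl !addr0. Qed.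

Let innerZl a x z : inner (a *: x) z = a * inner x z.
Proof. by rewrite -[a *: x]addr0 innerPl inner0l addr0. Qed.

Let innerDr x y z : inner z (x + y) = inner z x + inner z y.
Proof. by rewrite innerC innerDl !(innerC z). Qed.

Let innerZr a x z : inner z (a *: x) = a * inner z x.
Proof. by rewrite innerC innerZl (innerC z). Qed.

Let inner_ge0 x : 0 <= inner x x.
Proof. by have [->|/inner_gt0/ltW//] := eqVneq x 0; rewrite inner0l. Qed.

Let normsq x : norm x ^+ 2 = inner x x.
Proof. by rewrite sqr_sqrtr. Qed.

Let cauchy_schwarz x y : inner x y <= norm x * norm y.
Proof.
have [->|y0] := eqVneq y 0; first by rewrite innerC inner0l /norm inner0l sqrtr0 mulr0.
have yy := inner_gt0 y0.
apply: (@le_trans _ _ `|inner x y|); first exact: ler_norm.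
rewrite -(@ler_pXn2r _ 2)// ?nnegrE ?mulr_ge0 ?sqrtr_ge0// exprMn !normsq.
rewrite real_normK ?num_real//.
have := inner_ge0 (inner y y *: x + (- inner x y) *: y).
rewrite !(innerDl, innerDr, innerZl, innerZr) (innerC y x) => h.
rewrite -subr_ge0 -(pmulr_rge0 _ yy); apply: le_trans h _.
by rewrite le_eqVlt; apply/orP; left; apply/eqP; ring.
Qed.

Let ler_normD x y : norm (x + y) <= norm x + norm y.
Proof.
rewrite -(@ler_pXn2r _ 2)// ?nnegrE ?addr_ge0 ?sqrtr_ge0// sqrrD !normsq.
rewrite innerDl !innerDr (innerC y x).
have := cauchy_schwarz x y; lra.
Qed.

Let normrZ (l : R) x : norm (l *: x) = `|l| * norm x.
Proof. by rewrite /norm innerZl innerZr mulrA sqrtrM ?sqr_ge0// sqrtr_sqr. Qed.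

Let normr0_eq0 x : norm x = 0 -> x = 0.
Proof.
move=> h; have [//|/inner_gt0] := eqVneq x 0.
by rewrite -normsq h expr0n ltxx.
Qed.

HB.instance Definition _ :=
  Lmodule_isNormed.Build R V ler_normD normrZ normr0_eq0.

Let inner_norm x : inner x x = `|x| ^+ 2.
Proof. by rewrite [RHS]normsq. Qed.

HB.instance Definition _ :=
  NormedModule_hasInner.Build R V innerC innerPl inner_norm.

HB.end.

Section inner_theory.
Context (R : realType) (V : prehilbertType R).
Implicit Types x y z : V.

Lemma innerDl x y z : inner (x + y) z = inner x z + inner y z.
Proof. by rewrite -[x]scale1r innerPl scale1r mul1r. Qed.

Lemma inner0l z : inner 0 z = 0.
Proof. by apply: (addrI (inner 0 z)); rewrite -innerDl !addr0. Qed.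

Lemma innerZl a x z : inner (a *: x) z = a * inner x z.
Proof. by rewrite -[a *: x]addr0 innerPl inner0l addr0. Qed.

Lemma innerDr x y z : inner z (x + y) = inner z x + inner z y.
Proof. by rewrite innerC innerDl !(innerC z). Qed.

Lemma innerZr a x z : inner z (a *: x) = a * inner z x.
Proof. by rewrite innerC innerZl (innerC z). Qed.

End inner_theory.

Definition lspan (R : pzRingType) (V : lmodType R) (B : set V) : set V :=
  [set x | exists n (c : 'I_n -> R) (b : 'I_n -> V),
    (forall i, B (b i)) /\ x = \sum_(i < n) c i *: b i].

Definition orthonormal_basis (R : realType) (V : hilbertType R) (B : set V) :=
  [/\ (forall x, B x -> inner x x = 1),
      (forall x y, B x -> B y -> x <> y -> inner x y = 0)
    & dense (lspan B)].

(* The sum does not depend on the orthonormal basis. *)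
Definition hilbert_schmidt (R : realType) (U V : hilbertType R)
    (f : {linear U -> V}) :=
  exists2 B : set U, orthonormal_basis B &
    (\esum_(x in B) (`|f x| ^+ 2)%:E < +oo)%E.

Definition separable (T : topologicalType) :=
  exists2 D : set T, countable D & dense D.

Definition infinite_dim (R : pzRingType) (V : lmodType R) :=
  forall n (b : 'I_n -> V), lspan (range b) <> setT.

(* A Hilbert space completion of V with respect to the bilinear form b
   (b is forced to be symmetric and positive semidefinite). *)
Record completion (R : realType) (V : lmodType R) (b : V -> V -> R) :=
  Completion {
    completion_sort :> hilbertType R;
    to_completion : {linear V -> completion_sort};
    inner_to_completion : forall x y,
      inner (to_completion x) (to_completion y) = b x y;
    dense_completion : dense (range to_completion)
  }.

Definition upd (n : nat) (V : Type) (v : 'I_n -> V) (i : 'I_n) (x : V) :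
  'I_n -> V := fun j => if j == i then x else v j.

Definition multilinear (R : pzRingType) (V W : lmodType R) n
    (F : ('I_n -> V) -> W) :=
  forall v i a x y,
    F (upd v i (a *: x + y)) = a *: F (upd v i x) + F (upd v i y).

(* The tensor power V^{(x) n} is the quotient of the formal linear combinations
   of n-tuples of vectors by the congruence generated by multilinearity, which
   is the intersection of the kernels of all multilinear maps. *)
Section tensor_power.
Context (R : realType) (V : lmodType R) (n : nat).

Definition formal_comb : choiceType := seq (R * ('I_n -> V)).

Definition eval_comb (W : lmodType R) (F : ('I_n -> V) -> W) (s : formal_comb) :
  W := \sum_(cv <- s) cv.1 *: F cv.2.

Definition comb_eq (s t : formal_comb) : bool :=
  `[< forall (W : lmodType R) (F : ('I_n -> V) -> W), multilinear F ->
      eval_comb F s = eval_comb F t >].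

Let comb_eq_refl : reflexive comb_eq.
Proof. by move=> s; apply/asboolP. Qed.

Let comb_eq_sym : symmetric comb_eq.
Proof.
by move=> s t; apply/idP/idP => /asboolP st; apply/asboolP => W F /st.
Qed.

Let comb_eq_trans : transitive comb_eq.
Proof.
move=> s r t /asboolP rs /asboolP st; apply/asboolP => W F mF.
by rewrite rs// st.
Qed.

Canonical comb_eq_equiv :=
  EquivRel comb_eq comb_eq_refl comb_eq_sym comb_eq_trans.

Local Open Scope quotient_scope.

Definition tpow : Type := {eq_quot comb_eq}.
HB.instance Definition _ := Choice.on tpow.
HB.instance Definition _ := EqQuotient.on tpow.

(* The linear map induced by F; only meaningful for multilinear F. *)
Definition tlift (W : lmodType R) (F : ('I_n -> V) -> W) (t : tpow) : W :=
  eval_comb F (repr t).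

Definition tens (v : 'I_n -> V) : tpow := \pi_tpow [:: (1, v)].

Let scale_comb a (s : formal_comb) : formal_comb :=
  [seq (a * cv.1, cv.2) | cv <- s].

Definition tpow0 : tpow := \pi_tpow [::].
Definition tpow_add (s t : tpow) : tpow := \pi_tpow (repr s ++ repr t).
Definition tpow_scale a (t : tpow) : tpow := \pi_tpow (scale_comb a (repr t)).
Definition tpow_opp (t : tpow) : tpow := tpow_scale (-1) t.

Lemma tlift_pi (W : lmodType R) (F : ('I_n -> V) -> W) s :
  multilinear F -> tlift F (\pi_tpow s) = eval_comb F s.
Proof.
move=> mF; rewrite /tlift.
have : repr (\pi_tpow s : tpow) = s %[mod tpow] by rewrite reprK.
by move=> /eqmodP/asboolP; apply.
Qed.

Let eval_scale (W : lmodType R) (F : ('I_n -> V) -> W) a s :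
  eval_comb F (scale_comb a s) = a *: eval_comb F s.
Proof.
by rewrite /eval_comb big_map scaler_sumr; apply: eq_bigr => i _; rewrite scalerA.
Qed.

Let tlift_add (W : lmodType R) (F : ('I_n -> V) -> W) s t :
  multilinear F -> tlift F (tpow_add s t) = tlift F s + tlift F t.
Proof. by move=> mF; rewrite tlift_pi// /eval_comb big_cat. Qed.

Let tlift_scale (W : lmodType R) (F : ('I_n -> V) -> W) a t :
  multilinear F -> tlift F (tpow_scale a t) = a *: tlift F t.
Proof. by move=> mF; rewrite tlift_pi// eval_scale. Qed.

Let tlift_0 (W : lmodType R) (F : ('I_n -> V) -> W) :
  multilinear F -> tlift F tpow0 = 0.
Proof. by move=> mF; rewrite tlift_pi// /eval_comb big_nil. Qed.

Lemma tpow_ext (s t : tpow) :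
  (forall (W : lmodType R) (F : ('I_n -> V) -> W), multilinear F ->
    tlift F s = tlift F t) -> s = t.
Proof.
move=> h; rewrite -[s]reprK -[t]reprK; apply/eqmodP/asboolP => W F mF.
exact: h.
Qed.

Let addA : associative tpow_add.
Proof. by move=> s t u; apply: tpow_ext => W F mF; rewrite !tlift_add// addrA. Qed.
Let addC : commutative tpow_add.
Proof. by move=> s t; apply: tpow_ext => W F mF; rewrite !tlift_add// addrC. Qed.
Let add0 : left_id tpow0 tpow_add.
Proof.
by move=> s; apply: tpow_ext => W F mF; rewrite tlift_add// tlift_0// add0r.
Qed.
Let addN : left_inverse tpow0 tpow_opp tpow_add.
Proof.
move=> s; apply: tpow_ext => W F mF.
by rewrite tlift_add// tlift_scale// tlift_0// scaleN1r addNr.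
Qed.

HB.instance Definition _ := GRing.isZmodule.Build tpow addA addC add0 addN.

Let scaleA a b t : tpow_scale a (tpow_scale b t) = tpow_scale (a * b) t.
Proof. by apply: tpow_ext => W F mF; rewrite !tlift_scale// scalerA. Qed.
Let scale1 : left_id 1 tpow_scale.
Proof. by move=> t; apply: tpow_ext => W F mF; rewrite tlift_scale// scale1r. Qed.
Let scaleDr : right_distributive tpow_scale +%R.
Proof.
move=> a s t; apply: tpow_ext => W F mF.
by rewrite tlift_scale// !tlift_add// scalerDr !tlift_scale.
Qed.
Let scaleDl v : {morph tpow_scale^~ v : a b / a + b}.
Proof.
move=> a b; apply: tpow_ext => W F mF.
by rewrite tlift_add// !tlift_scale// scalerDl.
Qed.

HB.instance Definition _ :=
  GRing.Zmodule_isLmodule.Build R tpow scaleA scale1 scaleDr scaleDl.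

Lemma tlift_linear (W : lmodType R) (F : ('I_n -> V) -> W) :
  multilinear F -> linear (tlift F).
Proof.
by move=> mF a s t; rewrite [LHS]tlift_add// [X in X + _]tlift_scale.
Qed.

Lemma tlift_tens (W : lmodType R) (F : ('I_n -> V) -> W) v :
  multilinear F -> tlift F (tens v) = F v.
Proof. by move=> mF; rewrite tlift_pi// /eval_comb big_seq1 scale1r. Qed.

Lemma tens_multilinear : multilinear tens.
Proof.
move=> v i a x y; apply: tpow_ext => W F mF.
by rewrite tlift_linear// !tlift_tens.
Qed.

Lemma tpow_tens (t : tpow) : lspan (range tens) t.
Proof.
pose s := repr t; exists (size s).
exists (fun i => (nth (0, fun=> 0) s i).1).
exists (fun i => tens (nth (0, fun=> 0) s i).2); split; first by move=> i; eexists.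
apply: tpow_ext => W F mF.
pose L : {linear tpow -> W} :=
  HB.pack (tlift F) (GRing.isLinear.Build _ _ _ _ _ (tlift_linear mF)).
rewrite -[RHS]/(L _) linear_sum [LHS]/tlift /eval_comb -/s.
rewrite (big_nth (0, fun=> 0)) big_mkord; apply: eq_bigr => i _.
by rewrite linearZ; congr (_ *: _); rewrite -tlift_tens.
Qed.

Definition tperm_act (s : 'S_n) : tpow -> tpow := tlift (fun v => tens (v \o s)).

Definition symmetrize (t : tpow) : tpow :=
  (n`!%:R)^-1 *: \sum_(s : 'S_n) tperm_act s t.

Lemma tperm_multilinear (s : 'S_n) : multilinear (fun v => tens (v \o s)).
Proof.
have updE v i x : upd v i x \o s = upd (v \o s) (s^-1%g i) x.
  apply/funext => j; rewrite /upd /=.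
  by rewrite -(inj_eq (@perm_inj _ s) j) permKV.
by move=> v i a x y; rewrite !updE tens_multilinear.
Qed.

Lemma tperm_act_linear s : linear (tperm_act s).
Proof. exact/tlift_linear/tperm_multilinear. Qed.

Lemma symmetrize_linear : linear symmetrize.
Proof.
move=> a t u; rewrite /symmetrize scalerA [a * _]mulrC -scalerA -scalerDr.
congr (_ *: _); rewrite scaler_sumr -big_split /=.
by apply: eq_bigr => s _; rewrite tperm_act_linear.
Qed.

Definition symmetric_tensor (t : tpow) := forall s : 'S_n, tperm_act s t = t.

End tensor_power.

(* The functional F \hat{\otimes} G: F \otimes G precomposed with symmetrization. *)
Definition sym_tensor_prod (R : realType) (V : lmodType R) (p q : nat)
    (F : tpow V p -> R) (G : tpow V q -> R) : tpow V (p + q) -> R :=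
  fun t => tlift (fun v : 'I_(p + q) -> V =>
      F (tens (fun i => v (lshift q i))) * G (tens (fun j => v (rshift p j))) : R^o)
    (symmetrize t).

Lemma sym_tensor_prod_linear (R : realType) (V : lmodType R) (p q : nat)
    (F : tpow V p -> R) (G : tpow V q -> R) :
  linear (F : _ -> R^o) -> linear (G : _ -> R^o) ->
  linear (sym_tensor_prod F G : _ -> R^o).
Proof.
move=> lF lG a t u; rewrite /sym_tensor_prod symmetrize_linear; apply: tlift_linear.
move=> v i b x y /=.
case: (split_ordP i) => k -> {i}.
  have updl z : (fun i => upd v (lshift q k) z (lshift q i)) =
      upd (fun i => v (lshift q i)) k z.
    by apply/funext => j; rewrite /upd eq_shift.
  have updr z : (fun j => upd v (lshift q k) z (rshift p j)) =
      (fun j => v (rshift p j)).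
    by apply/funext => j; rewrite /upd eq_shift.
  by rewrite !updl !updr tens_multilinear lF mulrDl scalerAl.
have updl z : (fun i => upd v (rshift p k) z (lshift q i)) =
    (fun i => v (lshift q i)).
  by apply/funext => j; rewrite /upd eq_shift.
have updr z : (fun j => upd v (rshift p k) z (rshift p j)) =
    upd (fun j => v (rshift p j)) k z.
  by apply/funext => j; rewrite /upd eq_shift.
by rewrite !updl !updr tens_multilinear lG mulrDr -scalerAr.
Qed.

(* A realization of the n-th Hilbert space tensor power of K: a Hilbert space
   in which the simple tensors span a dense subspace and have the product inner
   product. For n = 0 this is a one-dimensional space spanned by a unit vector. *)
Record hilbert_tensor_power (R : realType) (K : hilbertType R) (n : nat) :=
  HilbertTensorPower {
    htpow_sort :> hilbertType R;
    htens : ('I_n -> K) -> htpow_sort;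
    htens_multilinear : multilinear htens;
    inner_htens : forall f g : 'I_n -> K,
      inner (htens f) (htens g) = \prod_(k < n) inner (f k) (g k);
    dense_htens : dense (lspan (range htens))
  }.

Definition sym_htpow (R : realType) (K : hilbertType R) (n : nat)
    (T : hilbert_tensor_power K n) : set T :=
  closure (lspan (range (fun f : K => htens T (fun=> f)))).

Arguments sym_htpow {R K n} T _.

Definition sqsummable (R : realType) (H : prehilbertType R) (f : nat -> H) :=
  cvgn (series (fun k => `|f k| ^+ 2)).

Section ell2.
Context (R : realType) (H : prehilbertType R).
Implicit Types f g : nat -> H.

Lemma sqsummable0 : sqsummable (fun=> 0 : H).
Proof.
rewrite /sqsummable (_ : series _ = fun=> 0); first exact: is_cvg_cst.
by apply/funext => n; rewrite /series /= big1// => i _; rewrite normr0 expr0n.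
Qed.

Lemma sqsummableZ a f : sqsummable f -> sqsummable (fun k => a *: f k).
Proof.
move=> cf; rewrite /sqsummable.
rewrite (_ : (fun k => _) = (a ^+ 2) *: (fun k => `|f k| ^+ 2)).
  exact: is_cvg_seriesZ.
by apply/funext => k /=; rewrite normrZ exprMn real_normK ?num_real.
Qed.

Lemma sqsummableD f g :
  sqsummable f -> sqsummable g -> sqsummable (fun k => f k + g k).
Proof.
move=> cf cg; have c := is_cvg_seriesZ (k := 2) (is_cvg_seriesD cf cg).
apply: (series_le_cvg _ _ _ c) => k //=; first by rewrite mulr_ge0 ?addr_ge0.
change (`|f k + g k| ^+ 2 <= 2 * (`|f k| ^+ 2 + `|g k| ^+ 2)).
apply: (@le_trans _ _ ((`|f k| + `|g k|) ^+ 2)).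
  by rewrite ler_pXn2r ?nnegrE ?addr_ge0 ?ler_normD.
have := sqr_ge0 (`|f k| - `|g k|); rewrite sqrrB sqrrD; lra.
Qed.

Lemma norm_inner_le (x y : H) : `|inner x y| <= `|x| ^+ 2 + `|y| ^+ 2.
Proof.
have P : 0 <= `|x + y| ^+ 2 by [].
have M : 0 <= `|x + (-1) *: y| ^+ 2 by [].
have x0 : 0 <= `|x| ^+ 2 by [].
have y0 : 0 <= `|y| ^+ 2 by [].
move: P M; rewrite -!inner_norm !(innerDl, innerDr, innerZl, innerZr).
rewrite !inner_norm (innerC y x) ler_norml; lra.
Qed.

Lemma cvg_inner f g : sqsummable f -> sqsummable g ->
  cvgn (series (fun k => inner (f k) (g k))).
Proof.
move=> cf cg; apply: normed_cvg.
apply: (series_le_cvg _ _ _ (is_cvg_seriesD cf cg)) => k //=.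
  by apply: addr_ge0.
exact: norm_inner_le.
Qed.

Definition sqsummable_pred : {pred nat -> H} := fun f => `[< sqsummable f >].

Lemma sqsummable_submod : submod_closed sqsummable_pred.
Proof.
split=> [|a f g /asboolP cf /asboolP cg]; apply/asboolP.
  exact: sqsummable0.
by apply: sqsummableD => //; apply: sqsummableZ.
Qed.

HB.instance Definition _ :=
  GRing.isSubmodClosed.Build R (nat -> H) sqsummable_pred sqsummable_submod.

Record ell2 := Ell2 { ell2_val :> nat -> H; _ : ell2_val \in sqsummable_pred }.

HB.instance Definition _ := [isSub for ell2_val].
HB.instance Definition _ := [Choice of ell2 by <:].
HB.instance Definition _ := [SubChoice_isSubLmodule of ell2 by <:].

Lemma ell2P (f : ell2) : sqsummable f.
Proof. by have /asboolP := valP f. Qed.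

Definition ell2_inner (f g : ell2) : R :=
  limn (series (fun k => inner (f k) (g k))).

Let ell2_innerC (f g : ell2) : ell2_inner f g = ell2_inner g f.
Proof.
by rewrite /ell2_inner; congr (limn (series _)); apply/funext => k; rewrite innerC.
Qed.

Let ell2_innerPl a (f g h : ell2) :
  ell2_inner (a *: f + g) h = a * ell2_inner f h + ell2_inner g h.
Proof.
have c (u v : ell2) : cvgn (series (fun k => inner (u k) (v k))).
  by apply: cvg_inner; apply: ell2P.
rewrite /ell2_inner -[a * _]/(a *: _) -lim_seriesZ// -lim_seriesD//.
  by congr (limn (series _)); apply/funext => k; rewrite innerPl.
exact: is_cvg_seriesZ.
Qed.

Let ell2_inner_gt0 (f : ell2) : f != 0 -> 0 < ell2_inner f f.
Proof.
move=> f0; have [k fk0] : exists k, f k <> 0.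
  apply/not_existsP => h; move/eqP: f0; apply; apply/val_inj/funext => k.
  by apply: contrapT; apply: h.
rewrite /ell2_inner.
rewrite (_ : (fun k => inner _ _) = (fun k => `|f k| ^+ 2)); last first.
  by apply/funext => j; rewrite inner_norm.
have nd : nondecreasing_seq (series (fun k => `|f k| ^+ 2)).
  by apply: nondecreasing_series => // n _ _; apply: exprn_ge0.
apply: (lt_le_trans _ (nondecreasing_cvgn_le nd (@ell2P f) k.+1)).
rewrite /series /= big_nat_recr//= ltr_wpDl ?sumr_ge0//.
by rewrite exprn_gt0// normr_gt0; apply/eqP.
Qed.

HB.instance Definition _ :=
  Lmodule_hasInner.Build R ell2 ell2_innerC ell2_innerPl ell2_inner_gt0.

End ell2.

Definition form_norm (R : realType) (V : lmodType R) (b : {dot V for idfun})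
  (x : V) : R := Num.sqrt (b x x).

Definition norm_cvg0 (R : realType) (V : lmodType R) (N : V -> R)
  (u : nat -> V) := N (u n) @[n --> \oo] --> (0 : R).

Definition norm_cauchy (R : realType) (V : lmodType R) (N : V -> R)
    (u : nat -> V) :=
  forall e : R, 0 < e -> exists n0 : nat, forall m n,
    (n0 <= m)%N -> (n0 <= n)%N -> N (u m - u n) < e.

(* The p-th Hilbert norm of N = nucl is the one of nucl_inner p, N_p = hilb p,
   and H is hilb 0. The continuous extension hilb_incl p of the identity of N is
   the inclusion of N_{p+1} into N_p; see inclH_inj below for its injectivity. *)
Record gelfand_triple (R : realType) := GelfandTriple {
  nucl : lmodType R;
  nucl_inner : nat -> {dot nucl for idfun};
  hilb : forall p, completion (nucl_inner p);
  hilb_incl : forall p, {linear hilb p.+1 -> hilb p};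
  hilb_incl_continuous : forall p, continuous (hilb_incl p);
  hilb_incl_nucl : forall p x,
    hilb_incl p (to_completion (hilb p.+1) x) = to_completion (hilb p) x;
  nucl_norm_le : forall p x,
    form_norm (nucl_inner p) x <= form_norm (nucl_inner p.+1) x;
  nucl_norm_compatible : forall p q u,
    norm_cvg0 (form_norm (nucl_inner p)) u ->
    norm_cauchy (form_norm (nucl_inner q)) u ->
    norm_cvg0 (form_norm (nucl_inner q)) u;
  nucl_complete : forall u,
    (forall p, norm_cauchy (form_norm (nucl_inner p)) u) ->
    exists x, forall p, norm_cvg0 (form_norm (nucl_inner p)) (fun n => u n - x);
  hilb_incl_HS : forall p, hilbert_schmidt (hilb_incl p)
}.

Section sequence_space.
Context (R : realType) (N : gelfand_triple R).

Definition H0 : hilbertType R := hilb N 0.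

Fixpoint inclH (p : nat) : hilb N p -> H0 :=
  match p with
  | 0 => id
  | p'.+1 => fun x => inclH (hilb_incl N p' x)
  end.

Lemma inclH_linear p : linear (@inclH p).
Proof. by elim: p => [//|p IH] a x y /=; rewrite linearP IH. Qed.

HB.instance Definition _ p :=
  GRing.isLinear.Build R (hilb N p) H0 _ (@inclH p) (@inclH_linear p).

Lemma inclH_nucl p x : inclH (to_completion (hilb N p) x) = to_completion (hilb N 0) x.
Proof. by elim: p => [//|p IH] /=; rewrite hilb_incl_nucl IH. Qed.

Lemma inclH_continuous p : continuous (@inclH p).
Proof.
elim: p => [|p IH] x /=; first exact: cvg_id.
apply: (@continuous_comp _ _ _ (hilb_incl N p) (@inclH p)); last exact: IH.
exact: hilb_incl_continuous.
Qed.

Lemma norm_to_completion p x :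
  `|to_completion (hilb N p) x| = form_norm (nucl_inner N p) x.
Proof.
rewrite /form_norm -(inner_to_completion (hilb N p)) inner_norm.
by rewrite sqrtr_sqr normr_id.
Qed.

(* N_p is a subspace of H: this is what compatibility of the norms gives. *)
Lemma inclH_inj p : injective (@inclH p).
Proof.
suff ker g : @inclH p g = 0 -> g = 0.
  move=> x y xy; apply/eqP; rewrite -subr_eq0; apply/eqP/ker.
  by rewrite linearB/= xy subrr.
move=> g0.
have [u ug] : exists u : nat -> nucl N,
    to_completion (hilb N p) (u n) @[n --> \oo] --> g.
  have /choice[u uP] n : exists x, `|g - to_completion (hilb N p) x| < n.+1%:R^-1.
    have [||y [yg [x _ xy]]] := @dense_completion _ _ _ (hilb N p)
        (ball g (n.+1%:R^-1 : R)).
    - by exists g; apply: ballxx; rewrite invr_gt0.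
    - exact: ball_open.
    by exists x; rewrite xy; move: yg; rewrite -ball_normE.
  exists u; apply/cvgrPdist_lt => e e0; near=> n.
  by apply: (lt_trans (uP n)); near: n; exact: near_infty_natSinv_lt (PosNum e0).
have c0 : norm_cvg0 (form_norm (nucl_inner N 0)) u.
  rewrite /norm_cvg0.
  under eq_fun do rewrite -norm_to_completion -(@inclH_nucl p).
  rewrite -(@normr0 _ (H0)) -g0; apply: cvg_norm.
  by apply: continuous_cvg => //; exact: inclH_continuous.
have cp : norm_cauchy (form_norm (nucl_inner N p)) u.
  move=> e e0; have /cvgrPdist_lt/(_ (e / 2)) := ug.
  rewrite divr_gt0// => /(_ isT)[n0 _ h]; exists n0 => m n /h hm /h hn.
  rewrite -norm_to_completion linearB.
  rewrite (_ : _ - _ = (g - to_completion (hilb N p) (u n))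
                     - (g - to_completion (hilb N p) (u m))); last first.
    by rewrite opprB [RHS]addrC subrKA.
  by rewrite (le_lt_trans (ler_normB _ _))// [ltRHS]splitr ltrD.
have := nucl_norm_compatible c0 cp; rewrite /norm_cvg0.
under eq_fun do rewrite -norm_to_completion.
move/(cvg_unique _ (cvg_norm ug)) => /= /(_ _)h.
by apply/eqP; rewrite -normr_eq0; apply/eqP; apply: h.
Unshelve. all: by end_near. Qed.

(* k^{2p} with k ranging over 1, 2, ..., while sequences are indexed from 0 *)
Definition ell2p_weight (p k : nat) : R := k.+1%:R ^+ (2 * p).

Definition ell2p (p : nat) : set (nat -> hilb N p) :=
  [set g | cvgn (series (fun k => ell2p_weight p k * `|g k| ^+ 2))].

Definition ell2p_norm (p : nat) (g : nat -> hilb N p) : R :=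
  Num.sqrt (limn (series (fun k => ell2p_weight p k * `|g k| ^+ 2))).

Lemma ell2pE p (g : nat -> hilb N p) :
  ell2p g <-> sqsummable (fun k => (k.+1%:R ^+ p : R) *: g k).
Proof.
rewrite /ell2p /sqsummable /=.
rewrite (_ : (fun k => _) = (fun k => `|(k.+1%:R ^+ p : R) *: g k| ^+ 2))//.
apply/funext => k; rewrite normrZ exprMn real_normK ?num_real//.
by rewrite /ell2p_weight mulnC exprM.
Qed.

(* s(N), the intersection over p of the spaces ell2p p seen inside ell2 H0 *)
Definition sN_pred : {pred ell2 H0} := fun f =>
  `[< forall p, exists2 g : nat -> hilb N p, ell2p g &
        forall k, inclH (g k) = f k >].

Lemma sN_submod : submod_closed sN_pred.
Proof.
split=> [|a f f' /asboolP sf /asboolP sf']; apply/asboolP => p.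
  exists (fun=> 0) => [|k].
    apply/ell2pE; rewrite (_ : (fun k => _) = fun=> 0); first exact: sqsummable0.
    by apply/funext => k; rewrite scaler0.
  exact: linear0.
have [[g /ell2pE cg gf] [g' /ell2pE cg' gf']] := (sf p, sf' p).
exists (fun k => a *: g k + g' k) => [|k]; last first.
  by rewrite inclH_linear gf gf'.
apply/ell2pE; have := sqsummableD (sqsummableZ (a := a) cg) cg'.
rewrite (_ : (fun k => _) =
  fun k => (k.+1%:R ^+ p : R) *: (a *: g k + g' k))//.
by apply/funext => k; rewrite scalerDr !scalerA mulrC.
Qed.

HB.instance Definition _ :=
  GRing.isSubmodClosed.Build R (ell2 H0) sN_pred sN_submod.

Record sN := SN { sN_val :> ell2 H0; _ : sN_val \in sN_pred }.

HB.instance Definition _ := [isSub for sN_val].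
HB.instance Definition _ := [Choice of sN by <:].
HB.instance Definition _ := [SubChoice_isSubLmodule of sN by <:].
HB.instance Definition _ := isPointed.Build sN 0.

(* f regarded as a sequence in N_p *)
Definition sN_coord (p : nat) (f : sN) : nat -> hilb N p :=
  fun k => xget 0 [set y | inclH y = f k].

Lemma sN_coordK p (f : sN) k : inclH (sN_coord p f k) = f k.
Proof.
have /asboolP/(_ p)[g _ /(_ k) gf] := valP f.
by rewrite /sN_coord; case: xgetP => [y _ //|/(_ (g k))].
Qed.

Lemma ell2p_sN_coord p (f : sN) : ell2p (sN_coord p f).
Proof.
have /asboolP/(_ p)[g cg gf] := valP f.
rewrite (_ : sN_coord p f = g)//; apply/funext => k.
by apply: (@inclH_inj p); rewrite sN_coordK gf.
Qed.

Definition sN_norm (p : nat) (f : sN) : R := ell2p_norm (sN_coord p f).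

(* the topology generated by the balls of all the norms *)
HB.instance Definition _ := @isSubBaseTopological.Build sN
  (sN * nat * R)%type [set i | 0 < i.2]
  (fun i => [set g | sN_norm i.1.2 (g - i.1.1) < i.2]).

Record sdual := SDual {
  sdual_val :> {scalar sN};
  sdual_continuous : continuous (sdual_val : sN -> R)
}.

Let sdual0_continuous : continuous ((\0 : {scalar sN}) : sN -> R).
Proof. exact: (@cst_continuous sN R 0). Qed.

HB.instance Definition _ := gen_eqMixin sdual.
HB.instance Definition _ := gen_choiceMixin sdual.
HB.instance Definition _ := isPointed.Build sdual (SDual sdual0_continuous).

Definition sdual_gen : set (set sdual) :=
  \bigcup_(phi in [set: sN])
    preimage_set_system setT (fun w : sdual => w phi) measurable.

Definition msdual : Type := g_sigma_algebraType sdual_gen.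
HB.instance Definition _ := Measurable.on msdual.

End sequence_space.

Definition cexpi (R : realType) (t : R) : R[i] := (cos t +i* sin t)%C.

Definition cintegral d (T : measurableType d) (R : realType)
    (mu : {measure set T -> \bar R}) (f : T -> R[i]) : R[i] :=
  (Rintegral mu setT (fun x => complex.Re (f x)) +i*
   Rintegral mu setT (fun x => complex.Im (f x)))%C.

Section operator.
Context (R : realType) (V : prehilbertType R) (A : V -> V).

Definition self_adjoint := forall f g, inner f (A g) = inner (A f) g.
Definition positive_definite := forall f, f != 0 -> 0 < inner f (A f).
Definition formA (f g : V) : R := inner f (A g).

End operator.

Section chaos.
Context (R : realType) (N : gelfand_triple R).
Variable A : {linear ell2 (H0 N) -> ell2 (H0 N)}.

(* The Fourier transform that characterizes mu_A (Bochner-Minlos). *)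
Definition is_muA (mu : probability (msdual N) R) :=
  forall phi : sN N,
    cintegral mu (fun w : sdual N => cexpi (w phi)) =
    (expR (- (2^-1 * formA A phi phi)))%:C%C.

Definition tauA : tpow (sN N) 2 -> R :=
  tlift (fun v : 'I_2 -> sN N => formA A (v ord0) (v ord_max) : R^o).

Definition pair1 (w : sdual N) : tpow (sN N) 1 -> R :=
  tlift (fun v : 'I_1 -> sN N => w (v ord0) : R^o).

(* wick w n is the functional :w^{(x) n}: *)
Fixpoint wick (w : sdual N) (n : nat) : tpow (sN N) n -> R :=
  match n with
  | 0 => tlift (fun _ : 'I_0 -> sN N => 1 : R^o)
  | n'.+1 =>
    match n' as k return (tpow (sN N) k -> R) -> tpow (sN N) k.+1 -> R with
    | 0 => fun _ => pair1 w
    | m.+1 => fun wick_n' t =>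
        sym_tensor_prod (p := 1) (pair1 w) wick_n' t
        - m.+1%:R * sym_tensor_prod (p := 2) tauA (@wick w m) t
    end (@wick w n')
  end.

Lemma wick0 w v : wick w (tens v : tpow (sN N) 0) = 1.
Proof. by rewrite /= tlift_tens// => ? []. Qed.

Lemma wick1 w (v : 'I_1 -> sN N) : wick w (tens v) = w (v ord0).
Proof.
rewrite /= /pair1 tlift_tens// => u i a x y.
by rewrite /upd !ord1 eqxx linearP.
Qed.

Lemma wickSS w m (t : tpow (sN N) m.+2) :
  wick w t = sym_tensor_prod (p := 1) (pair1 w) (@wick w m.+1) t
    - m.+1%:R * sym_tensor_prod (p := 2) tauA (@wick w m) t.
Proof. by []. Qed.

Lemma wick_linear w n : linear (@wick w n : _ -> R^o).
Proof.
have lin1 : linear (pair1 w : _ -> R^o).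
  apply: tlift_linear => v i a x y.
  by rewrite /upd !ord1 eqxx linearP.
have lin2 : linear (tauA : _ -> R^o).
  apply: tlift_linear => v i a x y; rewrite /formA /upd.
  have o2 : ((ord0 : 'I_2) == ord_max) = false by [].
  have [->|->] : i = ord0 \/ i = ord_max.
    by case: i => -[|[|//]] h; [left|right]; apply: val_inj.
    by rewrite eqxx [_ == ord0]eq_sym o2 /= innerPl.
  by rewrite eqxx o2 /= linearP/= innerDr innerZr.
elim/ltn_ind: n => -[|[|m]] IH.
- by apply: tlift_linear => v [].
- exact: lin1.
move=> a t u; rewrite !wickSS.
rewrite (sym_tensor_prod_linear (p := 1) lin1 (IH m.+1 _))//.
rewrite (sym_tensor_prod_linear (p := 2) lin2 (IH m _))//.
by rewrite /GRing.scale /=; ring.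
Qed.

(* the canonical map from the algebraic tensor power of s(N) into a
   Hilbert space tensor power of the completion K of ell2 *)
Definition tpow_to_htpow (K : completion (formA A)) n
    (T : hilbert_tensor_power K n) : tpow (sN N) n -> T :=
  tlift (fun v : 'I_n -> sN N => htens T (fun i => to_completion K (v i))).

Definition L2_cvg d (X : measurableType d) (mu : {measure set X -> \bar R})
    (G_ : nat -> X -> R) (G : X -> R) :=
  ('N[mu]_2%:E[EFin \o (G_ n \- G)%R])%E @[n --> \oo] --> 0%E.

(* G represents <f, :.^{(x) n}:>, the limit in L^2 along every approximating
   sequence; wick_L2 below chooses such a representative. *)
Definition is_wick_L2 (mu : probability (msdual N) R) (K : completion (formA A))
    n (T : hilbert_tensor_power K n) (f : T) (G : msdual N -> R) :=
  G \in Lfun mu 2%:E /\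
  forall phi : nat -> tpow (sN N) n,
    (forall k, symmetric_tensor (phi k)) ->
    tpow_to_htpow T (phi k) @[k --> \oo] --> f ->
    L2_cvg mu (fun k w => wick w (phi k)) G.

Definition wick_L2 (mu : probability (msdual N) R) (K : completion (formA A))
    n (T : hilbert_tensor_power K n) (f : T) : msdual N -> R :=
  xget (cst 0) [set G | is_wick_L2 mu f G].

Definition chaos_decomposition (mu : probability (msdual N) R)
    (K : completion (formA A)) (T : forall n, hilbert_tensor_power K n)
    (F : msdual N -> R) (f : forall n, T n) :=
  (forall n, sym_htpow (T n) (f n)) /\
  L2_cvg mu (fun m w => \sum_(n < m) wick_L2 mu (f n) w) F.

End chaos.

(* Main.v *)
(* Under mu_A the pairings X_phi := <phi, .> form a centred Gaussian family
   with covariance (phi, psi)_A, and <phi^{(x)n}, :.^{(x)n}:> is the n-th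
   Hermite polynomial in X_phi. Differentiating the Fourier transform gives
   E[X_p h] = E[D_p h] for trigonometric polynomials h, hence, approximating
   X_p by n sin(X_p / n), for polynomials in the X_phi; this makes Hermite
   polynomials of different degrees orthogonal and gives E[H_n(p) H_n(q)] = n!
   (p, q)_A^n. By polarization, symmetric tensors are spanned by the
   phi^{(x)n}, so t |-> <t, :.^{(x)n}:> is, up to the factor n!, an isometry
   into L^2(mu_A), and it extends to the symmetric Hilbert tensor power. The
   kernel f^(n) of F is the Riesz representative of t |-> E[F <t, :.^{(x)n}:>]
   / n!, and Bessel's inequality makes the series converge. The difference G
   between F and the sum is orthogonal to all Hermite polynomials, hence to
   all powers of X_phi; exponential moments then give orthogonality to all cos
   X_phi and sin X_phi. These span an algebra whose closure under bounded
   pointwise limits contains the indicators of all events in the sigma-algebra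
   generated by the X_phi, so G = 0 almost surely. *)
From HB Require Import structures.
Require Import Defs.
From mathcomp Require Import all_fingroup.
From mathcomp Require Import all_boot all_order all_algebra.
From mathcomp Require Import all_classical all_reals all_analysis.
From mathcomp Require Import measurable_realfun ring lra.

Set Implicit Arguments.
Unset Strict Implicit.
Unset Printing Implicit Defensive.

Import Order.TTheory GRing.Theory Num.Theory.
Import numFieldNormedType.Exports.

Local Open Scope classical_set_scope.
Local Open Scope ring_scope.

(** About the law of X_phi only E cos X_phi and E sin X_phi are given: there is no density, and not
    even square integrability may be presupposed. Integrability is therefore won by Fatou's lemma
    from bounded trigonometric expressions: 2 n^2 (1 - cos (X / n)), which tends to X^2, yields the
    second moment, and the higher ones follow inductively by integration by parts. The sharp bound
    (2n-1)!! c^n on the moment of order 2n is kept because it is what sums to exponential moments.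
    All this is done for an abstract [gaussian_family], free of sequence spaces and tensors.
    Derivatives are carried along as the second argument of an inductive relation, because a
    function of w does not record the expression in the X_phi it came from. Wick powers meet Hermite
    polynomials on diagonal tensors only; polarization is the bridge to all symmetric ones. Elements
    of L^2 are functions here, compared through the semi-inner product [ip]. *)

(** * Real-valued integrals and the semi-inner product of L^2 *)

Section integral_calculus.
Context d (T : measurableType d) (R : realType) (mu : probability T R).
Implicit Types (f g h : T -> R).

Definition intg f := mu.-integrable setT (EFin \o f).
Local Notation E := (Rintegral mu setT).

Lemma intg_measurable f : intg f -> measurable_fun setT f.
Proof. by move=> /measurable_int/measurable_EFinP. Qed.

Lemma intg_cst (c : R) : intg (fun=> c).
Proof. exact: finite_measure_integrable_cst. Qed.

Lemma intgD f g : intg f -> intg g -> intg (fun x => f x + g x).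
Proof. by move=> /integrableD /[apply]; apply. Qed.

Lemma intgZ a f : intg f -> intg (fun x => a * f x).
Proof. by move=> /integrableZl => /(_ measurableT a). Qed.

Lemma intgB f g : intg f -> intg g -> intg (fun x => f x - g x).
Proof. by move=> /integrableB /[apply]; apply. Qed.

Lemma intg_norm f : intg f -> intg (fun x => `|f x|).
Proof. by move=> /integrable_norm. Qed.

Lemma le_intg f g : measurable_fun setT f -> (forall x, `|f x| <= `|g x|) ->
  intg g -> intg f.
Proof.
move=> mf fg; apply: le_integrable => //; first exact/measurable_EFinP.
by move=> x _ /=; rewrite lee_fin.
Qed.

Lemma intg_sum I (s : seq I) (F : I -> T -> R) :
  (forall i, intg (F i)) -> intg (fun x => \sum_(i <- s) F i x).
Proof.
move=> iF; elim: s => [|i s IH].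
  by under eq_fun do rewrite big_nil; exact: intg_cst.
by under eq_fun do rewrite big_cons; exact: intgD.
Qed.

Lemma intg_bounded f (c : R) : measurable_fun setT f -> (forall x, `|f x| <= c) ->
  intg f.
Proof.
move=> mf fc; apply: (@le_intg _ (fun=> c)) => //; last exact: intg_cst.
by move=> x; apply: (le_trans (fc x)); exact: ler_norm.
Qed.

Lemma E_cst (c : R) : E (fun=> c) = c.
Proof. by rewrite /Rintegral integral_cst//= probability_setT mule1. Qed.

Lemma ED f g : intg f -> intg g -> E (fun x => f x + g x) = E f + E g.
Proof. by move=> ? ?; rewrite RintegralD. Qed.

Lemma EB f g : intg f -> intg g -> E (fun x => f x - g x) = E f - E g.
Proof. by move=> ? ?; rewrite RintegralB. Qed.

Lemma EZ a f : intg f -> E (fun x => a * f x) = a * E f.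
Proof. by move=> ?; rewrite RintegralZl. Qed.

Lemma E_sum I (s : seq I) (F : I -> T -> R) : (forall i, intg (F i)) ->
  E (fun x => \sum_(i <- s) F i x) = \sum_(i <- s) E (F i).
Proof.
move=> iF; elim: s => [|i s IH].
  by under eq_Rintegral do rewrite big_nil; rewrite big_nil E_cst.
under eq_Rintegral do rewrite big_cons.
by rewrite big_cons ED ?IH//; exact: intg_sum.
Qed.

Lemma le_E f g : intg f -> intg g -> (forall x, f x <= g x) -> E f <= E g.
Proof. by move=> ? ? fg; apply: le_Rintegral. Qed.

Lemma E_ge0 f : (forall x, 0 <= f x) -> 0 <= E f.
Proof. by move=> f0; apply: Rintegral_ge0. Qed.

Lemma EFin_E f : intg f -> (E f)%:E = (\int[mu]_x (f x)%:E)%E.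
Proof. by move=> ?; rewrite fineK//; exact: integrable_fin_num. Qed.

Lemma E_dominated (F : nat -> T -> R) f g :
  (forall n, measurable_fun setT (F n)) -> intg g ->
  (forall n x, `|F n x| <= g x) -> (forall x, F n x @[n --> \oo] --> f x) ->
  intg f /\ E (F n) @[n --> \oo] --> E f.
Proof.
move=> mF ig Fg Ff.
have mf : measurable_fun setT f.
  by apply: (measurable_fun_cvg mF) => x _; exact: Ff.
have [|||||fi _ c] := @dominated_convergence _ _ _ mu setT measurableT
  (fun n => EFin \o F n) (EFin \o f) (EFin \o g).
- by move=> n; exact/measurable_EFinP.
- exact/measurable_EFinP.
- apply: aeW => x _; apply: cvg_EFin; last exact: Ff.
  by near=> n.
- exact: ig.
- by apply: aeW => x n _; rewrite lee_fin.
split => //; apply: fine_cvg; rewrite fineK; first exact: c.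
exact: integrable_fin_num.
Unshelve. all: by end_near. Qed.

(** Integrability of the limit is part of the conclusion: this is how moments are obtained from
    bounded approximations. *)
Lemma fatou_E (F : nat -> T -> R) f (c : R) :
  (forall n, intg (F n)) -> (forall n x, 0 <= F n x) ->
  (forall x, F n x @[n --> \oo] --> f x) -> (\forall n \near \oo, E (F n) <= c) ->
  intg f /\ E f <= c.
Proof.
move=> iF F0 Ff Fc.
have mF n : measurable_fun setT (F n) by exact: intg_measurable.
have mf : measurable_fun setT f.
  by apply: (measurable_fun_cvg mF) => x _; exact: Ff.
have f0 x : 0 <= f x.
  have /cvg_lim <- // := Ff x; apply: limr_ge; last by apply: nearW => n.
  by apply/cvg_ex; exists (f x).
have le : (\int[mu]_x (f x)%:E <= c%:E)%E.
  have := @fatou _ _ _ mu _ measurableT (fun n => EFin \o F n).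
  rewrite (_ : (fun x => _) = EFin \o f); last first.
    apply/funext => x; have /cvg_limn_einf_sup[] // : (EFin \o F n) x @[n --> \oo] --> (f x)%:E.
    by apply: cvg_EFin; [near=> n|exact: Ff].
  move/(_ _ _)/le_trans; apply.
  - by move=> n; exact/measurable_EFinP.
  - by move=> n x _; rewrite lee_fin.
  rewrite limn_einf_lim; apply: lime_le; first exact: is_cvg_einfs.
  near=> n; apply: (@le_trans _ _ (\int[mu]_x (F n x)%:E)%E).
    by apply: ereal_inf_lbound; exists n => //=.
  by rewrite -EFin_E// lee_fin; near: n.
have fi : intg f.
  apply/integrableP; split; first exact/measurable_EFinP.
  under eq_integral do rewrite /= ger0_norm//.
  by apply: le_lt_trans le _; rewrite ltry.
by split => //; rewrite -lee_fin EFin_E.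
Unshelve. all: by end_near. Qed.

Definition L2 f := measurable_fun setT f /\ intg (fun x => f x ^+ 2).

Lemma L2_mul f g : L2 f -> L2 g -> intg (fun x => f x * g x).
Proof.
move=> [mf f2] [mg g2]; apply: le_intg (intgD f2 g2); first exact: measurable_funM.
move=> x; rewrite [leRHS]ger0_norm ?addr_ge0 ?sqr_ge0// normrM.
rewrite -(real_normK (num_real (f x))) -(real_normK (num_real (g x))).
have := sqr_ge0 (`|f x| - `|g x|); have := sqr_ge0 (`|f x| + `|g x|).
rewrite sqrrB sqrrD; lra.
Qed.

Lemma L2_cst (c : R) : L2 (fun=> c).
Proof. by split; [exact: measurable_cst|exact: intg_cst]. Qed.

Lemma L2_intg f : L2 f -> intg f.
Proof.
move=> Lf; have := L2_mul Lf (L2_cst 1).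
by under eq_fun do rewrite mulr1.
Qed.

Lemma L2Z a f : L2 f -> L2 (fun x => a * f x).
Proof.
move=> [mf f2]; split; first exact: measurable_funM.
by under eq_fun do rewrite exprMn; exact: intgZ.
Qed.

Lemma L2D f g : L2 f -> L2 g -> L2 (fun x => f x + g x).
Proof.
move=> Lf Lg; have [mf f2] := Lf; have [mg g2] := Lg.
split; first exact: measurable_funD.
under eq_fun do rewrite sqrrD -mulr_natl.
by apply: intgD => //; apply: intgD => //; apply: intgZ; exact: L2_mul.
Qed.

Lemma L2B f g : L2 f -> L2 g -> L2 (fun x => f x - g x).
Proof.
move=> Lf Lg; have := L2D Lf (L2Z (-1) Lg).
by under eq_fun do rewrite mulN1r.
Qed.

Lemma L2_sum I (s : seq I) (F : I -> T -> R) :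
  (forall i, L2 (F i)) -> L2 (fun x => \sum_(i <- s) F i x).
Proof.
move=> iF; elim: s => [|i s IH].
  by under eq_fun do rewrite big_nil; exact: L2_cst.
by under eq_fun do rewrite big_cons; exact: L2D.
Qed.

Definition ip f g := E (fun x => f x * g x).

Lemma ipC f g : ip f g = ip g f.
Proof. by apply: eq_Rintegral => x _; rewrite mulrC. Qed.

Lemma ipDl f g h : L2 f -> L2 g -> L2 h ->
  ip (fun x => f x + g x) h = ip f h + ip g h.
Proof.
by move=> *; rewrite /ip; under eq_Rintegral do rewrite mulrDl; rewrite ED//; exact: L2_mul.
Qed.

Lemma ipZl a f g : L2 f -> L2 g -> ip (fun x => a * f x) g = a * ip f g.
Proof.
by move=> *; rewrite /ip; under eq_Rintegral do rewrite -mulrA; rewrite EZ//; exact: L2_mul.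
Qed.

Lemma ipBl f g h : L2 f -> L2 g -> L2 h ->
  ip (fun x => f x - g x) h = ip f h - ip g h.
Proof.
by move=> *; rewrite /ip; under eq_Rintegral do rewrite mulrBl; rewrite EB//; exact: L2_mul.
Qed.

Lemma ipBr f g h : L2 f -> L2 g -> L2 h ->
  ip h (fun x => f x - g x) = ip h f - ip h g.
Proof. by move=> *; rewrite ipC ipBl// !(ipC h). Qed.

Lemma ipDr f g h : L2 f -> L2 g -> L2 h ->
  ip h (fun x => f x + g x) = ip h f + ip h g.
Proof. by move=> *; rewrite ipC ipDl// !(ipC h). Qed.

Lemma ipZr a f g : L2 f -> L2 g -> ip g (fun x => a * f x) = a * ip g f.
Proof. by move=> *; rewrite ipC ipZl// ipC. Qed.

Lemma ip_suml I (s : seq I) (F : I -> T -> R) g : (forall i, L2 (F i)) -> L2 g ->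
  ip (fun x => \sum_(i <- s) F i x) g = \sum_(i <- s) ip (F i) g.
Proof.
move=> LF Lg; rewrite /ip; under eq_Rintegral do rewrite mulr_suml.
by rewrite E_sum// => i; exact: L2_mul.
Qed.

Lemma ip_ge0 f : 0 <= ip f f.
Proof. by apply: E_ge0 => x; rewrite -expr2 sqr_ge0. Qed.

Lemma ip_CS f g : L2 f -> L2 g -> ip f g ^+ 2 <= ip f f * ip g g.
Proof.
move=> Lf Lg.
have q a : 0 <= ip f f - 2 * a * ip f g + a ^+ 2 * ip g g.
  have := ip_ge0 (fun x => f x - a * g x).
  have Lag := L2Z a Lg.
  rewrite ipBl ?ipBr ?ipZl ?ipZr//; last exact: L2B.
  rewrite (ipC g f); congr (0 <= _); ring.
have [g0|g0] := eqVneq (ip g g) 0.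
  (* When [ip g g] vanishes, the quadratic in [q] is affine in a; at this a it would equal -1. *)
  rewrite g0 mulr0; have := q ((ip f f + 1) / (2 * ip f g)).
  have [->|fg0] := eqVneq (ip f g) 0; first by rewrite expr0n.
  rewrite g0 mulr0 addr0.
  rewrite (_ : _ - _ = -1); last by field.
  by rewrite lerNr oppr0 ler10.
have g_gt0 : 0 < ip g g by rewrite lt_def g0 ip_ge0.
have := q (ip f g / ip g g).
rewrite -(pmulr_lge0 _ g_gt0).
rewrite (_ : (_ + _) * _ = ip f f * ip g g - ip f g ^+ 2); last by field.
by rewrite subr_ge0.
Qed.

(** Cauchy-Schwarz against the constant 1, whose norm is 1 for a probability. It turns L^2
    increments into L^1 increments in the completeness proof. *)
Lemma E_norm_le f : L2 f -> E (fun x => `|f x|) <= Num.sqrt (ip f f).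
Proof.
move=> Lf; have [mf f2] := Lf.
have Ln : L2 (fun x => `|f x|).
  split; first exact: measurableT_comp.
  by under eq_fun do rewrite real_normK ?num_real//.
rewrite -(@ler_pXn2r _ 2)// ?nnegrE ?sqrtr_ge0 ?E_ge0// sqr_sqrtr ?ip_ge0//.
have := ip_CS Ln (L2_cst 1).
have -> : ip (fun x => `|f x|) (fun=> 1) = E (fun x => `|f x|).
  by apply: eq_Rintegral => x _; rewrite mulr1.
have -> : ip (fun=> 1) (fun=> 1) = 1 by rewrite /ip mulr1 E_cst.
rewrite mulr1.
move=> /le_trans; apply; rewrite le_eqVlt; apply/orP; left; apply/eqP.
by apply: eq_Rintegral => x _; rewrite -!expr2 real_normK ?num_real.
Qed.

Lemma L2P f : f \in Lfun mu 2%:E <-> L2 f.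
Proof.
split=> [Lf|[mf f2]].
  split; last exact: Lfun2_integrable_sqr.
  by move: Lf; rewrite inE => /andP[]; rewrite inE.
rewrite inE; apply/andP; split; rewrite inE//= /finite_norm unlock.
apply: poweR_lty; move/integrableP: f2 => [_]; apply: le_lt_trans.
rewrite le_eqVlt; apply/orP; left; apply/eqP; apply: eq_integral => x _ /=.
by rewrite powR_mulrn// normrX.
Qed.

Lemma Lnorm_fin f : L2 f -> ('N[mu]_2%:E[EFin \o f] = (Num.sqrt (ip f f))%:E)%E.
Proof.
move=> [mf f2]; rewrite unlock.
rewrite (_ : (\int[mu]_x _)%E = (ip f f)%:E); last first.
  rewrite /ip; under eq_Rintegral do rewrite -expr2.
  rewrite EFin_E//; apply: eq_integral => x _ /=.
  by rewrite powR_mulrn// real_normK ?num_real.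
by rewrite poweR12_sqrt// lee_fin ip_ge0.
Qed.

Lemma Lnorm_sqr f : L2 f -> ('N[mu]_2%:E[EFin \o f] ^+ 2 = (ip f f)%:E)%E.
Proof. by move=> /Lnorm_fin ->; rewrite -EFin_expe sqr_sqrtr// ip_ge0. Qed.

Lemma L2_cvgP (F : nat -> T -> R) f : (forall n, L2 (F n)) -> L2 f ->
  L2_cvg mu F f <->
  ip (fun x => F n x - f x) (fun x => F n x - f x) @[n --> \oo] --> (0 : R).
Proof.
move=> LF Lf; rewrite /L2_cvg.
have LFf n : L2 (fun x => F n x - f x) by exact: L2B.
rewrite (_ : (fun n => _) = EFin \o (fun n => Num.sqrt
    (ip (fun x => F n x - f x) (fun x => F n x - f x)))); last first.
  by apply/funext => n /=; rewrite -Lnorm_fin.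
split=> [/fine_cvgP[_] /= c|c].
  rewrite -[X in _ --> X](mulr0 (0 : R)); apply: cvg_trans (cvgM c c); apply: near_eq_cvg.
  by apply: nearW => n /=; rewrite -expr2 sqr_sqrtr// ip_ge0.
apply: cvg_EFin; first by near=> n.
rewrite /comp /= -[X in _ --> X]sqrtr0.
by apply: continuous_cvg => //; exact: sqrt_continuous.
Unshelve. all: by end_near. Qed.

End integral_calculus.

Lemma cvg_exprn (R : realType) (u : nat -> R) (l : R) k :
  u n @[n --> \oo] --> l -> u n ^+ k @[n --> \oo] --> l ^+ k.
Proof.
move=> ul; elim: k => [|k IH].
  by under eq_fun do rewrite expr0; rewrite expr0; exact: cvg_cst.
by under eq_fun do rewrite exprS; rewrite exprS; apply: cvgM.
Qed.

Lemma cvgnR_unique (R : realType) (u : nat -> R) (l l' : R) :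
  u n @[n --> \oo] --> l -> u n @[n --> \oo] --> l' -> l = l'.
Proof. by move=> /(@cvg_lim _ (@Rhausdorff R)) <- /(@cvg_lim _ (@Rhausdorff R)) <-. Qed.

(** * Completeness of L^2 for sequences of functions *)

Section L2_completeness.
Context d (T : measurableType d) (R : realType) (mu : probability T R).
Local Notation E := (Rintegral mu setT).
Local Notation L2 := (L2 mu).
Local Notation ip := (ip mu).

Lemma ae_E (f g : T -> R) : measurable_fun setT f -> measurable_fun setT g ->
  {ae mu, forall x, f x = g x} -> E f = E g.
Proof.
move=> mf mg fg; congr fine; apply: ae_eq_integral => //.
- exact/measurable_EFinP.
- exact/measurable_EFinP.
- by apply: filterS fg => x -> _.
Qed.

(** The sum of all increments |G (k+1) - G k| has integral at most c, hence is finite almost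
    everywhere. A is the set where it is finite; there the telescoping series converges
    absolutely. *)
Lemma ae_cvg_of_summable (G : nat -> T -> R) (c : R) :
  (forall n, intg mu (G n)) ->
  (forall n, \sum_(k < n) E (fun x => `|G k.+1 x - G k x|) <= c) ->
  exists A : set T, [/\ measurable A, {ae mu, forall x, A x} &
    forall x, A x -> cvgn (G^~ x)].
Proof.
move=> iG Gc.
pose D k x : R := `|G k.+1 x - G k x|.
have iD k : intg mu (D k) by apply: intg_norm; apply: intgB.
have mD k : measurable_fun setT (EFin \o D k) by exact/measurable_EFinP/(@intg_measurable _ _ _ mu).
pose S x : \bar R := (\sum_(k <oo) (D k x)%:E)%E.
have S0 x : (0 <= S x)%E by apply: nneseries_ge0 => k _ _; rewrite lee_fin /D.
have mS : measurable_fun setT S.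
  have := @ge0_emeasurable_sum _ _ _ setT (fun k x => (D k x)%:E) xpredT.
  move=> h; apply: h => [k x _ _|k _]; last exact: mD.
  by rewrite lee_fin /D.
have iS : mu.-integrable setT S.
  apply/integrableP; split => //.
  under eq_integral do rewrite gee0_abs//.
  rewrite integral_nneseries//; last by move=> k x _; rewrite lee_fin /D.
  apply: (@le_lt_trans _ _ c%:E); last exact: ltry.
  apply: lime_le.
    apply: ereal_nondecreasing_is_cvgn; apply: ereal_nondecreasing_series => k _ _.
    by apply: integral_ge0 => x _; rewrite lee_fin /D.
  apply: nearW => n; rewrite big_mkord.
  under eq_bigr do rewrite -EFin_E//.
  by rewrite sumEFin lee_fin; exact: Gc.
exists [set x | S x \is a fin_num]; split.
- have := @emeasurable_fin_num _ _ _ setT S measurableT mS.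
  by rewrite setTI.
- have := integrable_ae measurableT iS.
  by apply: filterS => x /(_ Logic.I).
- move=> x /= Sx.
  have cD : cvgn (series (fun k => D k x)).
    apply: nondecreasing_is_cvgn.
      by apply: nondecreasing_series => k _ _; rewrite /D.
    exists (fine (S x)) => _ [n _ <-].
    rewrite -lee_fin fineK// /series /= -sumEFin.
    rewrite /S; apply: (@nneseries_lim_ge _ _ xpredT 0 n) => k _ _.
    by rewrite lee_fin /D.
  have : cvgn (series (fun k => G k.+1 x - G k x)) by exact: normed_cvg.
  rewrite (_ : series _ = fun n => G n x - G 0%N x); last first.
    by apply/funext => n; rewrite /series /= telescope_sumr.
  move=> /cvg_ex[l cl]; apply/cvg_ex; exists (l + G 0%N x).
  apply: cvg_trans (cvgD cl (cvg_cst (G 0%N x))); apply: near_eq_cvg; apply: nearW => n /=.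
  by rewrite subrK.
Qed.

Lemma L2_complete (F : nat -> T -> R) : (forall n, L2 (F n)) ->
  (forall e : R, 0 < e -> exists N : nat, forall m n, (N <= m)%N -> (N <= n)%N ->
    ip (fun x => F m x - F n x) (fun x => F m x - F n x) <= e) ->
  exists2 f, L2 f &
    ip (fun x => F n x - f x) (fun x => F n x - f x) @[n --> \oo] --> (0 : R).
Proof.
move=> LF Fc.
(* Squared distances 4^-k mean L^1 increments at most 2^-k, whose sum stays below 2. *)
have /choice[N NP] : forall k : nat, exists N : nat, forall m n,
    (N <= m)%N -> (N <= n)%N ->
    ip (fun x => F m x - F n x) (fun x => F m x - F n x) <= (4^-1) ^+ k.
  by move=> k; apply: Fc; rewrite exprn_gt0// invr_gt0.
(* Adding up the thresholds makes j monotone and at least [N k]; the summand k forces it to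
   infinity. *)
pose j k := (k + \sum_(i < k.+1) N i)%N.
have jN k : (N k <= j k)%N by rewrite /j big_ord_recr /= addnA leq_addl.
have jS k : (j k <= j k.+1)%N.
  by rewrite /j [in leqRHS]big_ord_recr /= addSn leqW// leq_add2l leq_addr.
pose G k := F (j k).
have [||A [mA aA cA]] := @ae_cvg_of_summable G 2.
- by move=> n; apply: L2_intg; exact: LF.
- move=> n; apply: (@le_trans _ _ (\sum_(k < n) (2^-1) ^+ k)).
    apply: ler_sum => k _.
    have LD : L2 (fun x => G k.+1 x - G k x) by apply: L2B; exact: LF.
    apply: le_trans (E_norm_le LD) _.
    rewrite -[leRHS](@ger0_norm _ _) ?exprn_ge0 ?invr_ge0// -sqrtr_sqr.
    apply: ler_wsqrtr; rewrite -exprM mulnC exprM.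
    rewrite (_ : 2^-1 ^+ 2 = 4^-1 :> R); last by field.
    by apply: NP; [exact: leq_trans (jN _) (jS _)|exact: jN].
  have h : \sum_(k < n) (2^-1 : R) ^+ k = 2 - 2 * (2^-1) ^+ n.
    elim: n => [|n IH]; first by rewrite big_ord0 expr0; ring.
    by rewrite big_ord_recr /= IH exprS; field.
  by rewrite h gerBl mulr_ge0// exprn_ge0// invr_ge0.
(* The indicator changes G k on a null set only and makes the pointwise limit exist everywhere, as
   [fatou_E] requires. *)
pose g k x := G k x * \1_A x.
have mG k : measurable_fun setT (G k) by case: (LF (j k)).
have Lg k : L2 (g k).
  have mg : measurable_fun setT (g k).
    by apply: measurable_funM => //; exact: measurable_indic.
  split => //; have [_ GG] := LF (j k); apply: le_intg GG.
    exact: measurable_funX.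
  move=> x; rewrite !ger0_norm ?sqr_ge0// /g indicE.
  by case: (x \in A); rewrite ?mulr1// mulr0 expr0n sqr_ge0.
have gG k : {ae mu, forall x, g k x = G k x}.
  by apply: filterS aA => x Ax; rewrite /g indicE mem_set// mulr1.
pose f x := limn (g^~ x).
have gf x : g k x @[k --> \oo] --> f x.
  rewrite /f /g indicE; case: (boolP (x \in A)) => [/set_mem /cA cx|_] /=.
    by under eq_fun do rewrite mulr1; exact: cx.
  by under eq_fun do rewrite mulr0; exact: is_cvg_cst.
(* Fatou in the second index, along the subsequence: the Cauchy bound on F n - F m is inherited by F
   n - f. *)
have key (e : R) n : 0 < e ->
  (\forall m \near \oo, ip (fun x => F n x - F m x) (fun x => F n x - F m x) <= e) ->
  intg mu (fun x => (F n x - f x) ^+ 2) /\ E (fun x => (F n x - f x) ^+ 2) <= e.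
  move=> e0 ne; apply: (@fatou_E _ _ _ _ (fun k x => (F n x - g k x) ^+ 2)).
  - by move=> k; have [] := L2B (LF n) (Lg k).
  - by move=> k x; exact: sqr_ge0.
  - move=> x; apply: cvg_exprn.
    by apply: cvgB; [exact: cvg_cst|exact: gf].
  - near=> k.
    rewrite (@ae_E _ (fun x => (F n x - G k x) ^+ 2)); last first.
    + by apply: filterS (gG k) => x ->.
    + by have [] := L2B (LF n) (LF (j k)) => ? /intg_measurable.
    + by have [] := L2B (LF n) (Lg k) => ? /intg_measurable.
    under eq_Rintegral do rewrite expr2.
    near: k; case: ne => m0 _ ne; exists m0 => // k /= mk; apply: ne => /=.
    by rewrite /j; apply: leq_trans (leq_addr _ _).
have Fe (e : R) : 0 < e -> exists m0 : nat, forall n, (m0 <= n)%N ->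
  intg mu (fun x => (F n x - f x) ^+ 2) /\ E (fun x => (F n x - f x) ^+ 2) <= e.
  move=> e0; have [m0 h] := Fc _ e0; exists m0 => n mn.
  by apply: key => //; exists m0 => // m /= mm; apply: h.
have mf : measurable_fun setT f.
  by apply: (@measurable_fun_cvg _ _ _ _ g) => [k|x _]; [case: (Lg k)|exact: gf].
have Lf : L2 f.
  have [m0 /(_ m0 (leqnn _))[i _]] := Fe 1 ltr01.
  have := L2B (LF m0) (_ : L2 (fun x => F m0 x - f x)).
  rewrite (_ : (fun x => _ - (_ - _)) = f); last first.
    by apply/funext => x; rewrite opprB addrC subrK.
  apply; split => //; apply: measurable_funB => //; by case: (LF m0).
exists f => //; apply/cvgrPdist_le => e e0.
have [m0 h] := Fe _ e0; exists m0 => // n /= /h[_].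
by rewrite sub0r normrN ger0_norm ?ip_ge0.
Unshelve. all: by end_near. Qed.

End L2_completeness.

(** * Difference quotients of sine, cosine and exponential *)

Section trigonometric_bounds.
Context (R : realType).
Implicit Types x y : R.

(** One mean value statement serves twice: it bounds the sine by its argument, and it gives the
    error x^2 / n in n sin (x / n) -> x. *)
Lemma sin_mean_value x : exists2 c, `|c| <= `|x| & sin x = x * cos c.
Proof.
wlog x0 : x / 0 <= x => [h|].
  have [|/ltW x0] := leP 0 x; first exact: h.
  have [|c cx e] := h (- x); first by rewrite oppr_ge0.
  exists c; first by rewrite -(normrN x).
  by apply: oppr_inj; rewrite -sinN e mulNr.
have [->|xn0] := eqVneq x 0; first by exists 0; rewrite ?sin0 ?mul0r.
have xp : 0 < x by rewrite lt_def xn0.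
have [] := @MVT R sin cos 0 x xp.
  by apply: continuous_subspaceT => y; exact: continuous_sin.
move=> c; rewrite in_itv /= => /andP[c0 cx]; rewrite sin0 !subr0 => e.
by exists c; [rewrite !ger0_norm// ltW|rewrite mulrC].
Qed.

Lemma normr_sin_le x : `|sin x| <= `|x|.
Proof.
have [c _ ->] := sin_mean_value x.
by rewrite normrM ler_piMr// cos_max.
Qed.

Lemma cos_half_sin x : 1 - cos x = 2 * sin (x / 2) ^+ 2.
Proof.
rewrite [in LHS](_ : x = (x / 2) *+ 2); last by rewrite -mulr_natr divfK.
by rewrite cos_mulr2n cos2sin2 -mulr_natl; ring.
Qed.

Lemma cosB1_le x : `|1 - cos x| <= `|x|.
Proof.
rewrite cos_half_sin normrM normrX expr2 mulrA ger0_norm//.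
have -> : `|x| = 2 * `|x / 2| * 1 by rewrite normrM (@ger0_norm _ 2^-1)// mulr1 mulrCA mulfV// mulr1.
by apply: ler_pM => //; rewrite ?mulr_ge0// ?sin_max// ler_pM2l// normr_sin_le.
Qed.

(** The constant need not be sharp: the bound only has to be uniform in n when y is replaced by y /
    n, to serve as majorant for the difference quotients. *)
Lemma cosB_le x y : `|cos (x + y) - cos x| <= 2 * `|y|.
Proof.
rewrite cosD (_ : _ - _ = - (cos x * (1 - cos y)) - sin x * sin y); last by ring.
apply: (le_trans (ler_normB _ _)); rewrite normrN !normrM mulr_natl mulr2n.
apply: lerD.
  by apply: le_trans (cosB1_le y); rewrite ler_piMl// cos_max.
by apply: le_trans (normr_sin_le y); rewrite ler_piMl// sin_max.
Qed.

Lemma sinB_le x y : `|sin (x + y) - sin x| <= 2 * `|y|.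
Proof.
rewrite sinD (_ : _ - _ = cos x * sin y - sin x * (1 - cos y)); last by ring.
apply: (le_trans (ler_normB _ _)); rewrite !normrM mulr_natl mulr2n.
apply: lerD.
  by apply: le_trans (normr_sin_le y); rewrite ler_piMl// cos_max.
by apply: le_trans (cosB1_le y); rewrite ler_piMl// sin_max.
Qed.

Lemma cvg_natSV : (n.+1%:R^-1 : R) @[n --> \oo] --> (0 : R).
Proof.
apply/cvgrPdist_le => e e0; near=> n; rewrite sub0r normrN gtr0_norm ?invr_gt0//.
by apply: ltW; near: n; exact: near_infty_natSinv_lt (PosNum e0).
Unshelve. all: by end_near. Qed.

Lemma cvg_cst_natSV x : x / n.+1%:R @[n --> \oo] --> (0 : R).
Proof. by rewrite -(mulr0 x); apply: cvgM; [exact: cvg_cst|exact: cvg_natSV]. Qed.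

Lemma cvg_sin_scale x : n.+1%:R * sin (x / n.+1%:R) @[n --> \oo] --> x.
Proof.
apply/cvgrPdist_le => e e0.
have := cvg_cst_natSV (x ^+ 2); move=> /cvgrPdist_le/(_ _ e0)[m0 _ h].
exists m0 => // n /h; rewrite sub0r normrN; apply: le_trans.
have [c cx ->] := sin_mean_value (x / n.+1%:R).
rewrite mulrCA mulrA divfK// -{1}[x]mulr1 -mulrBr normrM.
rewrite expr2 -mulrA normrM ler_wpM2l//.
exact: le_trans (cosB1_le c) cx.
Qed.

Lemma cvg_cosB1_scale x : n.+1%:R * (1 - cos (x / n.+1%:R)) @[n --> \oo] --> (0 : R).
Proof.
have E n : n.+1%:R * (1 - cos (x / n.+1%:R)) =
    (n.+1%:R * sin (x / 2 / n.+1%:R)) * (2 * sin (x / 2 / n.+1%:R)).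
  by rewrite cos_half_sin (mulrAC x); ring.
under eq_cvg do rewrite E.
have h : (n.+1%:R * sin (x / 2 / n.+1%:R)) * (2 * sin (x / 2 / n.+1%:R))
    @[n --> \oo] --> x / 2 * (2 * sin 0).
  apply: cvgM; first exact: cvg_sin_scale.
  apply: cvgM; first exact: cvg_cst.
  exact: continuous_cvg (@continuous_sin R 0) (cvg_cst_natSV _).
by rewrite sin0 !mulr0 in h.
Qed.

Lemma cvg_cos_shift x y :
  n.+1%:R * (cos (x + y / n.+1%:R) - cos x) @[n --> \oo] --> - (y * sin x).
Proof.
have E n : n.+1%:R * (cos (x + y / n.+1%:R) - cos x) =
    - (cos x * (n.+1%:R * (1 - cos (y / n.+1%:R))))
    - (n.+1%:R * sin (y / n.+1%:R)) * sin x by rewrite cosD; ring.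
under eq_cvg do rewrite E.
rewrite (_ : - (y * _) = - (cos x * 0) - y * sin x); last by ring.
apply: cvgB.
  by apply: cvgN; apply: cvgM; [exact: cvg_cst|exact: cvg_cosB1_scale].
by apply: cvgM; [exact: cvg_sin_scale|exact: cvg_cst].
Qed.

Lemma cvg_sin_shift x y :
  n.+1%:R * (sin (x + y / n.+1%:R) - sin x) @[n --> \oo] --> y * cos x.
Proof.
have E n : n.+1%:R * (sin (x + y / n.+1%:R) - sin x) =
    - (sin x * (n.+1%:R * (1 - cos (y / n.+1%:R))))
    + (n.+1%:R * sin (y / n.+1%:R)) * cos x by rewrite sinD; ring.
under eq_cvg do rewrite E.
rewrite (_ : y * _ = - (sin x * 0) + y * cos x); last by ring.
apply: cvgD.
  by apply: cvgN; apply: cvgM; [exact: cvg_cst|exact: cvg_cosB1_scale].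
by apply: cvgM; [exact: cvg_sin_scale|exact: cvg_cst].
Qed.

(** The derivative of exp at 0 along a varying direction. With u = a n / n, the inequality 1 + x <=
    exp x at u and at -u squeezes the quotient between a n and a n exp u. *)
Lemma cvg_expR_scale (a : nat -> R) (l : R) : a n @[n --> \oo] --> l ->
  n.+1%:R * (expR (a n / n.+1%:R) - 1) @[n --> \oo] --> l.
Proof.
move=> al; pose u n := a n / n.+1%:R.
have u0 : u n @[n --> \oo] --> (0 : R).
  by rewrite -(mulr0 l); apply: cvgM => //; exact: cvg_natSV.
have e1 : a n * expR (u n) @[n --> \oo] --> l.
  rewrite -[l]mulr1 -expR0; apply: cvgM => //.
  exact: continuous_cvg (@continuous_expR R 0) u0.
apply: (squeeze_cvgr _ al e1); apply: nearW => n; rewrite -/(u n).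
have ->: a n = n.+1%:R * u n by rewrite /u mulrCA mulfV// mulr1.
rewrite -mulrA !ler_pM2l//.
have h1 := expR_ge1Dx (u n); have h2 := expR_ge1Dx (- u n).
apply/andP; split; first by lra.
have -> : expR (u n) - 1 = (1 - expR (- u n)) * expR (u n).
  by rewrite mulrBl mul1r -expRD addNr expR0.
by rewrite ler_pM2r ?expR_gt0//; lra.
Qed.

End trigonometric_bounds.

(** * Gaussian families and integration by parts for trigonometric polynomials *)

(** The last two fields are the real and imaginary parts of the Fourier transform. Applied to
    combinations of indices they also carry the joint laws, since X is linear. Nonnegativity of c p
    p is derived in [gf_c_ge0]. *)
Record gaussian_family d (T : measurableType d) (R : realType) (mu : probability T R)
    (V : lmodType R) (X : V -> T -> R) (c : V -> V -> R) : Prop := GaussianFamily {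
  gf_measurable : forall p, measurable_fun setT (X p);
  gf_linear : forall a p q w, X (a *: p + q) w = a * X p w + X q w;
  gf_covC : forall p q, c p q = c q p;
  gf_cov_linear : forall a p q r, c (a *: p + q) r = a * c p r + c q r;
  gf_cos : forall p, Rintegral mu setT (fun w => cos (X p w)) = expR (- (2^-1 * c p p));
  gf_sin : forall p, Rintegral mu setT (fun w => sin (X p w)) = 0
}.

Section gaussian_family_theory.
Context d (T : measurableType d) (R : realType) (mu : probability T R).
Context (V : lmodType R) (X : V -> T -> R) (c : V -> V -> R).
Hypothesis GF : gaussian_family mu X c.
Local Notation E := (Rintegral mu setT).
Local Notation L2 := (L2 mu).
Local Notation intg := (intg mu).
Implicit Types (p q r : V) (w : T) (h k : T -> R).

Let mX p : measurable_fun setT (X p). Proof. exact: (gf_measurable GF). Qed.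
Let XL a p q w : X (a *: p + q) w = a * X p w + X q w. Proof. exact: (gf_linear GF). Qed.
Let cC p q : c p q = c q p. Proof. exact: (gf_covC GF). Qed.

Lemma gf_X0 w : X 0 w = 0.
Proof. by have := XL 1 0 0 w; rewrite scale1r addr0 mul1r; lra. Qed.

Lemma gf_XD p q w : X (p + q) w = X p w + X q w.
Proof. by rewrite -[p in LHS]scale1r XL mul1r. Qed.

Lemma gf_XZ a p w : X (a *: p) w = a * X p w.
Proof. by rewrite -[_ *: _]addr0 XL gf_X0 addr0. Qed.

Lemma gf_c0l q : c 0 q = 0.
Proof. by have := gf_cov_linear GF 1 0 0 q; rewrite scale1r addr0 mul1r; lra. Qed.

Lemma gf_cDl p q r : c (p + q) r = c p r + c q r.
Proof. by rewrite -[p in LHS]scale1r (gf_cov_linear GF) mul1r. Qed.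

Lemma gf_cZl a p r : c (a *: p) r = a * c p r.
Proof. by rewrite -[_ *: _]addr0 (gf_cov_linear GF) gf_c0l addr0. Qed.

Lemma gf_cDr p q r : c r (p + q) = c r p + c r q.
Proof. by rewrite cC gf_cDl !(cC r). Qed.

Lemma gf_cZr a p r : c r (a *: p) = a * c r p.
Proof. by rewrite cC gf_cZl (cC r). Qed.

Lemma measurable_cosX p : measurable_fun setT (fun w => cos (X p w)).
Proof.
apply: (measurableT_comp _ (mX p)).
by apply: continuous_measurable_fun; exact: continuous_cos.
Qed.

Lemma measurable_sinX p : measurable_fun setT (fun w => sin (X p w)).
Proof.
apply: (measurableT_comp _ (mX p)).
by apply: continuous_measurable_fun; exact: continuous_sin.
Qed.

Lemma intg_cosX p : intg (fun w => cos (X p w)).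
Proof. by apply: (@intg_bounded _ _ _ _ _ 1) => [|x]; [exact: measurable_cosX|exact: cos_max]. Qed.

Lemma intg_sinX p : intg (fun w => sin (X p w)).
Proof. by apply: (@intg_bounded _ _ _ _ _ 1) => [|x]; [exact: measurable_sinX|exact: sin_max]. Qed.

(** Fatou for 2 n^2 (1 - cos (X / n)) -> X^2. The mean of the left side is 2 n^2 (1 - exp (- c / (2
    n^2))), at most c because exp x >= 1 + x. *)
Lemma intg_X2 p : intg (fun w => X p w ^+ 2) /\ E (fun w => X p w ^+ 2) <= c p p.
Proof.
pose e n : R := n.+1%:R^-1.
have X2E n w : (2 * n.+1%:R ^+ 2) * (1 - cos (X (e n *: p) w)) =
    (2 * (n.+1%:R * sin (X p w / 2 / n.+1%:R))) ^+ 2.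
  rewrite cos_half_sin gf_XZ (_ : e n * X p w / 2 = X p w / 2 / n.+1%:R); last first.
    by rewrite /e; field.
  by ring.
have ie n : intg (fun w => (2 * n.+1%:R ^+ 2) * (1 - cos (X (e n *: p) w))).
  by apply: intgZ; apply: intgB; [exact: intg_cst|exact: intg_cosX].
apply: (@fatou_E _ _ _ _ (fun n w => (2 * n.+1%:R ^+ 2) * (1 - cos (X (e n *: p) w)))) => //.
- move=> w; under eq_fun do rewrite X2E; apply: cvg_exprn.
  rewrite [X in _ --> X](_ : _ = 2 * (X p w / 2)); last by rewrite mulrC divfK.
  by apply: cvgM; [exact: cvg_cst|exact: cvg_sin_scale].
apply: nearW => n; rewrite EZ; last by apply: intgB; [exact: intg_cst|exact: intg_cosX].
rewrite EB ?E_cst ?(gf_cos GF); [|exact: intg_cst|exact: intg_cosX].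
rewrite gf_cZl gf_cZr.
have := expR_ge1Dx (- (2^-1 * (e n * (e n * c p p)))) => h.
apply: (@le_trans _ _ (2 * n.+1%:R ^+ 2 * (2^-1 * (e n * (e n * c p p))))).
  by apply: ler_wpM2l; [rewrite mulr_ge0 ?sqr_ge0|lra].
rewrite le_eqVlt; apply/orP; left; apply/eqP; by rewrite /e; field.
Qed.

Lemma gf_c_ge0 p : 0 <= c p p.
Proof. by have [_] := intg_X2 p; apply: le_trans; apply: E_ge0 => w; exact: sqr_ge0. Qed.

Lemma intg_X p : intg (X p).
Proof. by apply: L2_intg; split => //; have [] := intg_X2 p. Qed.

Lemma intg_X_bounded p h (C : R) : measurable_fun setT h -> (forall w, `|h w| <= C) ->
  intg (fun w => X p w * h w).
Proof.
move=> mh hC; apply: (@le_intg _ _ _ _ _ (fun w => C * X p w)).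
- exact: measurable_funM.
- move=> w; rewrite !normrM mulrC ler_wpM2r//.
  exact: le_trans (hC w) (ler_norm _).
- by apply: intgZ; exact: intg_X.
Qed.

Let shiftE p q n w : X (n.+1%:R^-1 *: p + q) w = X q w + X p w / n.+1%:R.
Proof. by rewrite XL addrC mulrC. Qed.

Let scale_shift_le (t : R) n (u : R) : `|u| <= 2 * `|t / n.+1%:R| ->
  `|n.+1%:R * u| <= 2 * `|t|.
Proof.
move=> h; rewrite normrM ger0_norm//.
rewrite -(@ler_pM2l _ n.+1%:R)// in h; apply: le_trans h _.
by rewrite normrM (@ger0_norm _ n.+1%:R^-1)// mulrCA (mulrCA n.+1%:R) mulfV// mulr1.
Qed.

(** The mean of n (cos X_(q + p/n) - cos X_q) has two limits: by domination it tends to -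
    E[X_p sin X_q], while the Fourier transform gives the directional derivative of exp (- c q q /
    2). *)
Lemma stein_sin p q : E (fun w => X p w * sin (X q w)) = c p q * E (fun w => cos (X q w)).
Proof.
pose F n w := n.+1%:R * (cos (X (n.+1%:R^-1 *: p + q) w) - cos (X q w)).
have [_ c1] : intg (fun w => - (X p w * sin (X q w))) /\
    E (F n) @[n --> \oo] --> E (fun w => - (X p w * sin (X q w))).
  apply: (@E_dominated _ _ _ _ F _ (fun w => 2 * `|X p w|)).
  - move=> n; apply: measurable_funM => //; apply: measurable_funB; exact: measurable_cosX.
  - by apply: intgZ; apply: intg_norm; exact: intg_X.
  - by move=> n w; rewrite /F shiftE; apply: scale_shift_le; exact: cosB_le.
  - by move=> w; rewrite /F; under eq_cvg do rewrite shiftE; exact: cvg_cos_shift.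
have c2 : E (F n) @[n --> \oo] --> expR (- (2^-1 * c q q)) * - c p q.
  (* Expanding c at q + p/n leaves a second-order term c p p / n^2; it is why the exponent is (a n)
     / n with a n only convergent, as in [cvg_expR_scale]. *)
  have EF n : E (F n) = expR (- (2^-1 * c q q)) *
      (n.+1%:R * (expR ((- c p q - 2^-1 * c p p / n.+1%:R) / n.+1%:R) - 1)).
    rewrite EZ; last by apply: intgB; exact: intg_cosX.
    rewrite EB ?(gf_cos GF); [|exact: intg_cosX|exact: intg_cosX].
    rewrite [RHS]mulrCA; congr (_ * _); rewrite mulrBr mulr1 -expRD; congr (expR _ - _).
    by rewrite !(gf_cDl, gf_cDr, gf_cZl, gf_cZr) (cC q p); field.
  under eq_cvg do rewrite EF.
  apply: cvgM; first exact: cvg_cst.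
  apply: cvg_expR_scale; rewrite -[X in _ --> X]subr0.
  by apply: cvgB; [exact: cvg_cst|exact: cvg_cst_natSV].
have e := cvgnR_unique c1 c2.
rewrite (gf_cos GF); apply: oppr_inj.
rewrite -mulrN mulrC mulNr -mulrN -e.
rewrite -mulN1r -EZ; first by apply: eq_Rintegral => w _; rewrite mulN1r.
by apply: (@intg_X_bounded _ _ 1) => [|w]; [exact: measurable_sinX|exact: sin_max].
Qed.

(** The same difference quotient for the sine, all of whose means vanish. *)
Lemma stein_cos p q : E (fun w => X p w * cos (X q w)) = 0.
Proof.
pose F n w := n.+1%:R * (sin (X (n.+1%:R^-1 *: p + q) w) - sin (X q w)).
have [_ c1] : intg (fun w => X p w * cos (X q w)) /\
    E (F n) @[n --> \oo] --> E (fun w => X p w * cos (X q w)).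
  apply: (@E_dominated _ _ _ _ F _ (fun w => 2 * `|X p w|)).
  - move=> n; apply: measurable_funM => //; apply: measurable_funB; exact: measurable_sinX.
  - by apply: intgZ; apply: intg_norm; exact: intg_X.
  - by move=> n w; rewrite /F shiftE; apply: scale_shift_le; exact: sinB_le.
  - by move=> w; rewrite /F; under eq_cvg do rewrite shiftE; exact: cvg_sin_shift.
have c2 : E (F n) @[n --> \oo] --> (0 : R).
  have EF n : E (F n) = 0.
    rewrite EZ; last by apply: intgB; exact: intg_sinX.
    rewrite EB ?(gf_sin GF); [|exact: intg_sinX|exact: intg_sinX].
    by rewrite subrr mulr0.
  by under eq_cvg do rewrite EF; exact: cvg_cst.
exact: cvgnR_unique c1 c2.
Qed.

(* [trig h Dh]: h is a trigonometric polynomial in the variables [X p] and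
   [Dh q] is its derivative in the direction q, where D_q (X p) = c q p. *)
Inductive trig : (T -> R) -> (V -> T -> R) -> Prop :=
| trig_cos p : trig (fun w => cos (X p w)) (fun q w => - c q p * sin (X p w))
| trig_sin p : trig (fun w => sin (X p w)) (fun q w => c q p * cos (X p w))
| trig_lin a h Dh k Dk : trig h Dh -> trig k Dk ->
    trig (fun w => a * h w + k w) (fun q w => a * Dh q w + Dk q w).

Lemma trig_eq h Dh h' Dh' : trig h Dh -> (forall w, h w = h' w) ->
  (forall q w, Dh q w = Dh' q w) -> trig h' Dh'.
Proof.
move=> t hh DD; rewrite (_ : h' = h); last by apply/funext => w.
by rewrite (_ : Dh' = Dh)//; apply/funext => q; apply/funext => w.
Qed.

Lemma trig_cst (a : R) : trig (fun=> a) (fun _ _ => 0).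
Proof.
apply: trig_eq (trig_lin (a - 1) (trig_cos 0) (trig_cos 0)) _ _ => [w|q w].
  by rewrite gf_X0 cos0; ring.
by rewrite gf_X0 sin0; ring.
Qed.

Lemma trigZ (a : R) h Dh : trig h Dh -> trig (fun w => a * h w) (fun q w => a * Dh q w).
Proof.
move=> t; apply: trig_eq (trig_lin a t (trig_cst 0)) _ _ => *; exact: addr0.
Qed.

Lemma trigD h Dh k Dk : trig h Dh -> trig k Dk ->
  trig (fun w => h w + k w) (fun q w => Dh q w + Dk q w).
Proof. by move=> th tk; apply: trig_eq (trig_lin 1 th tk) _ _ => *; rewrite mul1r. Qed.

Lemma gf_XN p w : X (- p) w = - X p w.
Proof. by rewrite -scaleN1r gf_XZ mulN1r. Qed.

Lemma gf_cNr q p : c q (- p) = - c q p.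
Proof. by rewrite -scaleN1r gf_cZr mulN1r. Qed.

Let gfE := (gf_XD, gf_XN, gf_cDr, gf_cNr, cosD, sinD, cosN, sinN).

(** Product-to-sum formulas, by induction on both factors; they turn a product of generators back
    into a linear combination, compatibly with the Leibniz rule. *)
Lemma trigM h Dh k Dk : trig h Dh -> trig k Dk ->
  trig (fun w => h w * k w) (fun q w => Dh q w * k w + h w * Dk q w).
Proof.
move=> th; elim: th k Dk => {h Dh} [p|p|a h Dh h' Dh' th IH th' IH'] k Dk.
- elim=> {k Dk} [r|r|a k Dk k' Dk' tk IH tk' IH'].
  + apply: trig_eq (trigZ 2^-1 (trigD (trig_cos (p + r)) (trig_cos (p - r)))) _ _ => [w|q w];
    by rewrite !gfE; field.
  + apply: trig_eq (trigZ 2^-1 (trigD (trig_sin (p + r)) (trigZ (-1) (trig_sin (p - r))))) _ _ => [w|q w];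
    by rewrite !gfE; field.
  + apply: trig_eq (trig_lin a IH IH') _ _ => [w|q w]; ring.
- elim=> {k Dk} [r|r|a k Dk k' Dk' tk IH tk' IH'].
  + apply: trig_eq (trigZ 2^-1 (trigD (trig_sin (p + r)) (trig_sin (p - r)))) _ _ => [w|q w];
    by rewrite !gfE; field.
  + apply: trig_eq (trigZ 2^-1 (trigD (trig_cos (p - r)) (trigZ (-1) (trig_cos (p + r))))) _ _ => [w|q w];
    by rewrite !gfE; field.
  + apply: trig_eq (trig_lin a IH IH') _ _ => [w|q w]; ring.
- move=> tk; apply: trig_eq (trig_lin a (IH _ _ tk) (IH' _ _ tk)) _ _ => [w|q w]; ring.
Qed.

Lemma trig_bounded h Dh : trig h Dh ->
  measurable_fun setT h /\ exists C, forall w, `|h w| <= C.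
Proof.
elim=> {h Dh} [p|p|a h Dh k Dk _ [mh [C hC]] _ [mk [C' kC]]].
- by split; [exact: measurable_cosX|exists 1 => w; exact: cos_max].
- by split; [exact: measurable_sinX|exists 1 => w; exact: sin_max].
- split; first by apply: measurable_funD => //; exact: measurable_funM.
  exists (`|a| * C + C') => w; apply: (le_trans (ler_normD _ _)).
  by rewrite lerD// normrM ler_wpM2l.
Qed.

Lemma trig_derivative_bounded h Dh q : trig h Dh ->
  measurable_fun setT (Dh q) /\ exists C, forall w, `|Dh q w| <= C.
Proof.
elim=> {h Dh} [p|p|a h Dh k Dk _ [mh [C hC]] _ [mk [C' kC]]].
- split; first by apply: measurable_funM => //; exact: measurable_sinX.
  by exists `|c q p| => w; rewrite normrM normrN ler_piMr// sin_max.
- split; first by apply: measurable_funM => //; exact: measurable_cosX.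
  by exists `|c q p| => w; rewrite normrM ler_piMr// cos_max.
- split; first by apply: measurable_funD => //; exact: measurable_funM.
  exists (`|a| * C + C') => w; apply: (le_trans (ler_normD _ _)).
  by rewrite lerD// normrM ler_wpM2l.
Qed.

Lemma stein_trig p h Dh : trig h Dh -> E (fun w => X p w * h w) = E (Dh p).
Proof.
have iX h' Dh' : trig h' Dh' -> intg (fun w => X p w * h' w).
  by move=> /trig_bounded[mh [C hC]]; exact: intg_X_bounded hC.
elim=> {h Dh} [r|r|a h Dh k Dk th IH tk IH'].
- rewrite stein_cos EZ ?(gf_sin GF) ?mulr0//; exact: intg_sinX.
- by rewrite stein_sin EZ//; exact: intg_cosX.
- under eq_Rintegral do rewrite mulrDr mulrCA.
  have [mh [C hC]] := trig_derivative_bounded p th.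
  have [mk [C' kC]] := trig_derivative_bounded p tk.
  have ih := intg_bounded mu mh hC; have ik := intg_bounded mu mk kC.
  have iXh := iX _ _ th; have iXk := iX _ _ tk.
  rewrite ED//; last exact: intgZ.
  rewrite EZ// IH IH' [RHS]ED//; last exact: intgZ.
  by rewrite EZ.
Qed.

End gaussian_family_theory.

(** * Passing to the limit in integration by parts; even moments *)

Section polynomial_stein.
Context d (T : measurableType d) (R : realType) (mu : probability T R).
Context (V : lmodType R) (X : V -> T -> R) (c : V -> V -> R).
Hypothesis GF : gaussian_family mu X c.
Local Notation E := (Rintegral mu setT).
Local Notation L2 := (L2 mu).
Local Notation intg := (intg mu).
Local Notation trig := (trig X c).
Implicit Types (p q r : V) (w : T) (h g : T -> R).

Let mX p : measurable_fun setT (X p). Proof. exact: (gf_measurable GF). Qed.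

Lemma stein_limit p g (g' : T -> R) (h : nat -> T -> R) (Dh : nat -> V -> T -> R) (B B' : T -> R) :
  (forall n, trig (h n) (Dh n)) ->
  (forall w, h n w @[n --> \oo] --> g w) ->
  (forall w, Dh n p w @[n --> \oo] --> g' w) ->
  intg B -> (forall n w, `|X p w * h n w| <= B w) ->
  intg B' -> (forall n w, `|Dh n p w| <= B' w) ->
  E (fun w => X p w * g w) = E g'.
Proof.
move=> th hg Dg iB hB iB' DB'.
have [] := @E_dominated _ _ _ mu (fun n w => X p w * h n w) (fun w => X p w * g w) B _ iB hB.
- by move=> n; apply: measurable_funM => //; have [] := trig_bounded GF (th n).
- by move=> w; apply: cvgM; [exact: cvg_cst|exact: hg].
move=> _ c1; have [] := @E_dominated _ _ _ mu (fun n => Dh n p) g' B' _ iB' DB' Dg.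
  by move=> n; have [] := trig_derivative_bounded GF p (th n).
move=> _ c2; apply: cvgnR_unique c1 _.
by under eq_cvg do rewrite (stein_trig GF p (th _)); exact: c2.
Qed.

(** A bounded stand-in for X p inside the trigonometric algebra: it never exceeds |X p| and its
    derivative in direction q never exceeds |c q p|, uniformly in n. *)
Definition sinX n p w := n.+1%:R * sin (X (n.+1%:R^-1 *: p) w).

Lemma trig_sinX n p :
  trig (sinX n p) (fun q w => c q p * cos (X (n.+1%:R^-1 *: p) w)).
Proof.
apply: trig_eq (trigZ GF n.+1%:R (trig_sin X c (n.+1%:R^-1 *: p))) _ _ => // q w.
by rewrite (gf_cZr GF) !mulrA mulfV// mul1r.
Qed.

Let scaleX n p w : X (n.+1%:R^-1 *: p) w = X p w / n.+1%:R.
Proof. by rewrite (gf_XZ GF) mulrC. Qed.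

Lemma sinX_le n p w : `|sinX n p w| <= `|X p w|.
Proof.
rewrite /sinX scaleX normrM ger0_norm//.
have := normr_sin_le (X p w / n.+1%:R); rewrite -(@ler_pM2l _ n.+1%:R)//.
by move=> /le_trans; apply; rewrite normrM (@ger0_norm _ n.+1%:R^-1)// mulrCA mulfV// mulr1.
Qed.

Lemma cvg_sinX p w : sinX n p w @[n --> \oo] --> X p w.
Proof. by rewrite /sinX; under eq_cvg do rewrite scaleX; exact: cvg_sin_scale. Qed.

Lemma cvg_cosX p w : cos (X (n.+1%:R^-1 *: p) w) @[n --> \oo] --> (1 : R).
Proof.
rewrite -[X in _ --> X]cos0; under eq_cvg do rewrite scaleX.
exact: continuous_cvg (@continuous_cos R 0) (cvg_cst_natSV _).
Qed.

Lemma trigX h Dh k : trig h Dh ->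
  trig (fun w => h w ^+ k) (fun q w => k%:R * h w ^+ k.-1 * Dh q w).
Proof.
move=> th; elim: k => [|[|k] IH].
- by apply: trig_eq (trig_cst GF 1) _ _ => [w|q w]; rewrite ?mul0r ?expr0.
- by apply: trig_eq th _ _ => [w|q w]; rewrite ?expr1// expr0 !mul1r.
apply: trig_eq (trigM GF th IH) _ _ => [w|q w]; first by rewrite [RHS]exprS.
by rewrite /= [in RHS]exprS exprS -[in RHS]natr1; ring.
Qed.

Lemma normX_le_pow (x : R) j m : (j <= m)%N -> `|x| ^+ j <= 1 + `|x| ^+ m.
Proof.
move=> jm; have [x1|x1] := leP `|x| 1.
  by rewrite (le_trans (exprn_ile1 j (normr_ge0 x) x1))// lerDl exprn_ge0.
by rewrite (le_trans (ler_weXn2l (ltW x1) jm))// lerDr.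
Qed.

Lemma intg_normX_le p m j : intg (fun w => `|X p w| ^+ m) -> (j <= m)%N ->
  intg (fun w => `|X p w| ^+ j).
Proof.
move=> im jm; apply: (@le_intg _ _ _ _ _ (fun w => 1 + `|X p w| ^+ m)).
- by apply: measurable_funX; exact: measurableT_comp.
- move=> w; rewrite [leLHS]ger0_norm ?exprn_ge0// [leRHS]ger0_norm ?addr_ge0 ?exprn_ge0//.
  exact: normX_le_pow.
- by apply: intgD => //; exact: intg_cst.
Qed.

Lemma intg_powX_bounded p m k h (C : R) : intg (fun w => `|X p w| ^+ m) -> (k <= m)%N ->
  measurable_fun setT h -> (forall w, `|h w| <= C) -> intg (fun w => X p w ^+ k * h w).
Proof.
move=> im km mh hC; have ik := intg_normX_le im km.
apply: (@le_intg _ _ _ _ _ (fun w => C * `|X p w| ^+ k)).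
- by apply: measurable_funM => //; exact: measurable_funX.
- move=> w; rewrite !normrM !normrX normr_id mulrC ler_wpM2r ?exprn_ge0//.
  exact: le_trans (hC w) (ler_norm _).
- exact: intgZ.
Qed.

(** The bounded factor g lets this hold with no moment beyond k+1, so that it can drive the
    induction on moments. *)
Lemma stein_power p k g Dg : trig g Dg -> intg (fun w => `|X p w| ^+ k.+1) ->
  E (fun w => X p w * (X p w ^+ k * g w)) =
  E (fun w => k%:R * X p w ^+ k.-1 * c p p * g w + X p w ^+ k * Dg p w).
Proof.
move=> tg ik; have [_ [C gC]] := trig_bounded GF tg.
have [_ [C' gC']] := trig_derivative_bounded GF p tg.
pose h n w := sinX n p w ^+ k * g w.
have th n := trigM GF (trigX k (trig_sinX n p)) tg.
apply: (stein_limit (B := fun w => C * `|X p w| ^+ k.+1)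
   (B' := fun w => k%:R * `|c p p| * C * `|X p w| ^+ k.-1 + C' * `|X p w| ^+ k) th).
- by move=> w; apply: cvgM; [apply: cvg_exprn; exact: cvg_sinX|exact: cvg_cst].
- move=> w; apply: cvgD.
    apply: cvgM; last exact: cvg_cst.
    apply: cvgM; first by apply: cvgM; [exact: cvg_cst|apply: cvg_exprn; exact: cvg_sinX].
    rewrite -[X in _ --> X]mulr1; apply: cvgM; [exact: cvg_cst|exact: cvg_cosX].
  by apply: cvgM; [apply: cvg_exprn; exact: cvg_sinX|exact: cvg_cst].
- exact: intgZ.
- move=> n w; rewrite !normrM normrX exprS mulrCA [leRHS]mulrC mulrA.
  apply: ler_pM; rewrite ?mulr_ge0 ?exprn_ge0//.
  by rewrite mulrC ler_wpM2l// lerXn2r ?nnegrE// sinX_le.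
- by apply: intgD; apply: intgZ; apply: intg_normX_le ik _ => //; rewrite ?leqW// (leq_trans (leq_pred _)).
- move=> n w; apply: (le_trans (ler_normD _ _)); apply: lerD.
    rewrite !normrM normr_nat normrX -!mulrA ler_wpM2l//.
    rewrite (_ : `|c p p| * _ = `|X p w| ^+ k.-1 * (`|c p p| * (1 * C))); last by ring.
    apply: ler_pM; rewrite ?mulr_ge0 ?exprn_ge0//.
      by rewrite lerXn2r ?nnegrE// sinX_le.
    by apply: ler_wpM2l => //; apply: ler_pM => //; exact: cos_max.
  rewrite normrM normrX mulrC; apply: ler_pM; rewrite ?exprn_ge0//.
  by rewrite lerXn2r ?nnegrE// sinX_le.
Qed.

(** The product is (2n-1)!!, as for a Gaussian of variance c p p. The next power X^2 is first
    replaced by a bounded g j, integration by parts bounds the mean of X^(2m) g j, and Fatou removes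
    the truncation. *)
Lemma moment_even p n : intg (fun w => `|X p w| ^+ n.*2) /\
  E (fun w => `|X p w| ^+ n.*2) <= (\prod_(i < n) (i.*2.+1)%:R) * c p p ^+ n.
Proof.
have normXE (x : R) m : `|x| ^+ m.*2 = x ^+ m.*2.
  by rewrite -mul2n !exprM real_normK ?num_real.
elim: n => [|[|n] [i1 IH]].
- by under eq_fun do rewrite expr0; rewrite E_cst big_ord0 mul1r; split; [exact: intg_cst|].
- rewrite big_ord_recr big_ord0 /= expr1 !mul1r.
  under eq_fun do rewrite (normXE _ 1%N); exact: (intg_X2 GF).
(* Since m >= 1, a factor X can be split off X^(2m); the second moment was [intg_X2]. *)
set m := n.+1 in i1 IH *.
(* A trigonometric truncation of X^2 from below, with derivative 2 c [sinX]. *)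
pose g j w : R := (2 * j.+1%:R ^+ 2) * (1 - cos (X (j.+1%:R^-1 *: p) w)).
have tg j : trig (g j) (fun q w => 2 * c q p * sinX j p w).
  apply: trig_eq (trigZ GF (2 * j.+1%:R ^+ 2)
    (trigD (trig_cst GF 1) (trigZ GF (-1) (trig_cos X c (j.+1%:R^-1 *: p))))) _ _ => [w|q w].
    by rewrite mulN1r.
  by rewrite (gf_cZr GF) /sinX; field.
have gE j w : g j w = (2 * (j.+1%:R * sin (X p w / 2 / j.+1%:R))) ^+ 2.
  by rewrite /g scaleX cos_half_sin (mulrAC (X p w)); ring.
have gX j w : g j w <= X p w ^+ 2.
  rewrite gE -[leRHS]real_normK ?num_real// -[leLHS]real_normK ?num_real//.
  rewrite lerXn2r ?nnegrE//.
  have := sinX_le j (2^-1 *: p) w; rewrite /sinX scaleX (gf_XZ GF) (mulrC 2^-1) => h.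
  rewrite normrM ger0_norm// (_ : `|X p w| = 2 * `|X p w / 2|) ?ler_wpM2l//.
  by rewrite normrM (@ger0_norm _ 2^-1)// mulrCA mulfV// mulr1.
have g0 j w : 0 <= g j w by rewrite gE sqr_ge0.
have mg j : measurable_fun setT (g j) by have [] := trig_bounded GF (tg j).
have ig j : intg (fun w => X p w ^+ m.*2 * g j w).
  have [_ [C hC]] := trig_bounded GF (tg j).
  exact: intg_powX_bounded i1 (leqnn _) (mg j) hC.
have cp := gf_c_ge0 GF p.
(* Of the factor 2m+1, the derivative of X^(2m-1) contributes 2m-1, using g j <= X^2, and that of g
   j contributes 2. *)
have Eg j : E (fun w => X p w ^+ m.*2 * g j w) <=
    m.*2.+1%:R * c p p * E (fun w => `|X p w| ^+ m.*2).
  have e1 : E (fun w => X p w ^+ m.*2 * g j w) =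
      E (fun w => X p w * (X p w ^+ m.*2.-1 * g j w)).
    by apply: eq_Rintegral => w _; rewrite mulrA -exprS.
  have := stein_power (tg j) i1 (k := m.*2.-1); rewrite -e1 => ->.
  rewrite -EZ//; apply: le_E; last 2 first.
  - exact: intgZ.
  - move=> w; rewrite normXE.
    have h1 : m.*2.-1%:R * X p w ^+ m.*2.-2 * c p p * g j w <=
        m.*2.-1%:R * c p p * X p w ^+ m.*2.
      rewrite (_ : X p w ^+ m.*2 = X p w ^+ m.*2.-2 * X p w ^+ 2); last by rewrite -exprD addn2.
      rewrite (_ : _ * g j w = m.*2.-1%:R * c p p * X p w ^+ m.*2.-2 * g j w); last by ring.
      rewrite [leRHS]mulrA; apply: ler_wpM2l => //.
      by rewrite !mulr_ge0// /m doubleS /= exprn_even_ge0// odd_double.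
    have h2 : X p w ^+ m.*2.-1 * (2 * c p p * sinX j p w) <= 2 * c p p * X p w ^+ m.*2.
      rewrite mulrCA ler_wpM2l ?mulr_ge0//.
      apply: (le_trans (ler_norm _)); rewrite normrM normrX -normXE.
      by rewrite -[m.*2 in leRHS]/(m.*2.-1.+1) exprSr ler_wpM2l ?exprn_ge0// sinX_le.
    have -> : m.*2.+1%:R * c p p * X p w ^+ m.*2 =
        m.*2.-1%:R * c p p * X p w ^+ m.*2 + 2 * c p p * X p w ^+ m.*2.
      by rewrite -!mulrDl -natrD addn2.
    exact: lerD.
  have [_ [C gC]] := trig_bounded GF (tg j).
  have [mg' [C' gC']] := trig_derivative_bounded GF p (tg j).
  apply: intgD; last first.
    by apply: intg_powX_bounded i1 _ mg' gC'; exact: leq_pred.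
  have := intgZ (m.*2.-1%:R * c p p) (intg_powX_bounded i1 (_ : m.*2.-2 <= m.*2)%N (mg j) gC).
  move=> /(_ (leq_trans (leq_pred _) (leq_pred _))).
  by apply: eq_integrable => // w _ /=; congr _%:E; ring.
have [] := @fatou_E _ _ _ mu (fun j w => X p w ^+ m.*2 * g j w)
  (fun w => `|X p w| ^+ m.+1.*2)
  (m.*2.+1%:R * c p p * E (fun w => `|X p w| ^+ m.*2)) ig.
- by move=> j w; rewrite mulr_ge0// -normXE exprn_ge0.
- move=> w; rewrite normXE doubleS 2!exprSr -mulrA -expr2; apply: cvgM; first exact: cvg_cst.
  under eq_cvg do rewrite gE; apply: cvg_exprn.
  rewrite [X in _ --> X](_ : _ = 2 * (X p w / 2)); last by rewrite mulrC divfK.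
  by apply: cvgM; [exact: cvg_cst|exact: cvg_sin_scale].
- exact: nearW.
move=> i2 h; split=> //; apply: (le_trans h).
rewrite big_ord_recr /= exprS mulrA -(mulrA _ _ (c p p)) [leRHS]mulrAC.
by rewrite [leRHS]mulrC; apply: ler_wpM2l => //; rewrite mulr_ge0.
Qed.

End polynomial_stein.

(** * Functions with moments of all orders *)

Section all_moments.
Context d (T : measurableType d) (R : realType) (mu : probability T R).
Local Notation intg := (intg mu).
Implicit Types f g : T -> R.

(** Unlike L^2, this class is closed under products, so polynomials and their majorants stay inside
    it. *)
Definition all_moments f :=
  measurable_fun setT f /\ forall k, intg (fun w => `|f w| ^+ k).

Lemma all_moments_cst (a : R) : all_moments (fun=> a).
Proof. by split => [|k]; [exact: measurable_cst|exact: intg_cst]. Qed.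

Lemma all_moments_le f g : measurable_fun setT f -> (forall w, `|f w| <= `|g w|) ->
  all_moments g -> all_moments f.
Proof.
move=> mf fg [mg ig]; split => // k; apply: le_intg (ig k).
  by apply: measurable_funX; exact: measurableT_comp.
by move=> w; rewrite !normrX !normr_id lerXn2r ?nnegrE.
Qed.

Lemma all_moments_norm f : all_moments f -> all_moments (fun w => `|f w|).
Proof.
move=> af; apply: all_moments_le (af) => [|w]; last by rewrite normr_id.
by case: af => mf _; exact: measurableT_comp.
Qed.

Lemma all_momentsM f g : all_moments f -> all_moments g -> all_moments (fun w => f w * g w).
Proof.
move=> [mf jf] [mg jg]; split => [|k]; first exact: measurable_funM.
apply: (@le_intg _ _ _ _ _ (fun w => `|f w| ^+ k.*2 + `|g w| ^+ k.*2)).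
- apply: measurable_funX; apply: measurableT_comp => //; exact: measurable_funM.
- move=> w; rewrite [leLHS]ger0_norm ?exprn_ge0// [leRHS]ger0_norm ?addr_ge0 ?exprn_ge0//.
  rewrite normrM exprMn -muln2 !exprM.
  have := sqr_ge0 (`|f w| ^+ k - `|g w| ^+ k).
  have := sqr_ge0 (`|f w| ^+ k + `|g w| ^+ k).
  rewrite sqrrB sqrrD; lra.
- exact: intgD.
Qed.

Lemma all_momentsD f g : all_moments f -> all_moments g -> all_moments (fun w => f w + g w).
Proof.
move=> [mf jf] [mg jg]; split => [|k]; first exact: measurable_funD.
apply: (@le_intg _ _ _ _ _ (fun w => 2 ^+ k * (`|f w| ^+ k + `|g w| ^+ k))).
- apply: measurable_funX; apply: measurableT_comp => //; exact: measurable_funD.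
- move=> w; rewrite [leLHS]ger0_norm ?exprn_ge0//.
  rewrite [leRHS]ger0_norm ?mulr_ge0 ?addr_ge0 ?exprn_ge0//.
  apply: (@le_trans _ _ ((2 * Num.max `|f w| `|g w|) ^+ k)).
    rewrite lerXn2r ?nnegrE// ?mulr_ge0// ?le_max ?normr_ge0//.
    apply: (le_trans (ler_normD _ _)); rewrite mulr_natl mulr2n.
    by apply: lerD; rewrite le_max lexx// orbT.
  rewrite exprMn; apply: ler_wpM2l; first exact: exprn_ge0.
  by rewrite maxEle; case: ifP => _; rewrite ?lerDl ?lerDr exprn_ge0.
- by apply: intgZ; exact: intgD.
Qed.

Lemma all_moments_L2 f : all_moments f -> L2 mu f.
Proof.
move=> [mf jf]; split => //; apply: eq_integrable (jf 2) => // w _ /=.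
by rewrite real_normK ?num_real.
Qed.

Lemma all_moments_intg f : all_moments f -> intg f.
Proof. by move/all_moments_L2; exact: L2_intg. Qed.

Lemma all_momentsX f k : all_moments f -> all_moments (fun w => f w ^+ k).
Proof.
move=> af; elim: k => [|k IH].
  by under eq_fun do rewrite expr0; exact: all_moments_cst.
by under eq_fun do rewrite exprS; exact: all_momentsM.
Qed.

End all_moments.

(** * Integration by parts for polynomials and Hermite orthogonality *)

Section gaussian_polynomials.
Context d (T : measurableType d) (R : realType) (mu : probability T R).
Context (V : lmodType R) (X : V -> T -> R) (c : V -> V -> R).
Hypothesis GF : gaussian_family mu X c.
Local Notation E := (Rintegral mu setT).
Local Notation L2 := (L2 mu).
Local Notation intg := (intg mu).
Local Notation trig := (trig X c).
Local Notation all_moments := (all_moments mu).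
Implicit Types (p q r : V) (w : T) (h g : T -> R).

Let mX p : measurable_fun setT (X p). Proof. exact: (gf_measurable GF). Qed.

Lemma all_moments_X p : all_moments (X p).
Proof.
split => // k; have [i _] := moment_even GF p k.
by apply: (intg_normX_le GF i); rewrite -addnn leq_addr.
Qed.

(* As [trig], for polynomials in the variables [X p]. *)
Inductive polyX : (T -> R) -> (V -> T -> R) -> Prop :=
| polyX_cst a : polyX (fun=> a) (fun _ _ => 0)
| polyX_X p : polyX (X p) (fun q _ => c q p)
| polyX_D h Dh g Dg : polyX h Dh -> polyX g Dg ->
    polyX (fun w => h w + g w) (fun q w => Dh q w + Dg q w)
| polyX_M h Dh g Dg : polyX h Dh -> polyX g Dg ->
    polyX (fun w => h w * g w) (fun q w => Dh q w * g w + h w * Dg q w).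

Lemma polyX_eq h Dh h' Dh' : polyX h Dh -> (forall w, h w = h' w) ->
  (forall q w, Dh q w = Dh' q w) -> polyX h' Dh'.
Proof.
move=> t hh DD; rewrite (_ : h' = h); last by apply/funext => w.
by rewrite (_ : Dh' = Dh)//; apply/funext => q; apply/funext => w.
Qed.

Lemma all_moments_polyX g Dg : polyX g Dg -> all_moments g.
Proof.
elim=> {g Dg} [a|p|h Dh g Dg _ ah _ ag|h Dh g Dg _ ah _ ag].
- exact: all_moments_cst.
- exact: all_moments_X.
- exact: all_momentsD.
- exact: all_momentsM.
Qed.

(** The majorant is asked to have all moments rather than to be integrable: this makes the notion
    stable under products. *)
Definition dominated (F : nat -> T -> R) (f : T -> R) :=
  (forall w, F n w @[n --> \oo] --> f w) /\
  exists2 B, all_moments B & forall n w, `|F n w| <= B w.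

Let dominated_cst f : all_moments f -> dominated (fun=> f) f.
Proof.
move=> af; split => [w|]; first exact: cvg_cst.
by exists (fun w => `|f w|) => //; exact: all_moments_norm.
Qed.

Let dominatedD F f G g : dominated F f -> dominated G g ->
  dominated (fun n w => F n w + G n w) (fun w => f w + g w).
Proof.
move=> [cF [B aB FB]] [cG [C aC GC]]; split => [w|]; first exact: cvgD.
exists (fun w => B w + C w); first exact: all_momentsD.
by move=> n w; apply: (le_trans (ler_normD _ _)); apply: lerD.
Qed.

Let dominatedM F f G g : dominated F f -> dominated G g ->
  dominated (fun n w => F n w * G n w) (fun w => f w * g w).
Proof.
move=> [cF [B aB FB]] [cG [C aC GC]]; split => [w|]; first exact: cvgM.
exists (fun w => B w * C w); first exact: all_momentsM.
by move=> n w; rewrite normrM; apply: ler_pM.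
Qed.

(** Every X p in the polynomial is replaced by [sinX] n p; the derivatives then converge along the
    same sequence. *)
Lemma polyX_trig_approx g Dg : polyX g Dg ->
  exists (h : nat -> T -> R) (Dh : nat -> V -> T -> R),
  [/\ forall n : nat, trig (h n) (Dh n), dominated h g &
    forall q, dominated (fun n => Dh n q) (Dg q)].
Proof.
elim=> {g Dg} [a|p|g Dg k Dk _ [h [Dh [th hg Dhg]]] _ [h' [Dh' [th' hg' Dhg']]]
  |g Dg k Dk _ [h [Dh [th hg Dhg]]] _ [h' [Dh' [th' hg' Dhg']]]].
- exists (fun=> fun=> a), (fun _ _ _ => 0); split.
  + by move=> n; exact: (trig_cst GF).
  + by apply: dominated_cst; exact: all_moments_cst.
  + by move=> q; apply: dominated_cst; exact: all_moments_cst.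
- exists (fun n => sinX X n p), (fun n q w => c q p * cos (X (n.+1%:R^-1 *: p) w)); split.
  + by move=> n; exact: (trig_sinX GF).
  + split; first exact: (cvg_sinX GF).
    exists (fun w => `|X p w|); first by apply: all_moments_norm; exact: all_moments_X.
    by move=> n w; exact: (sinX_le GF).
  + move=> q; split => [w|].
      rewrite -[X in _ --> X]mulr1; apply: cvgM; [exact: cvg_cst|exact: (cvg_cosX GF)].
    exists (fun=> `|c q p|); first exact: all_moments_cst.
    by move=> n w; rewrite normrM ler_piMr// cos_max.
- exists (fun n w => h n w + h' n w), (fun n q w => Dh n q w + Dh' n q w); split.
  + by move=> n; exact: trigD.
  + exact: dominatedD.
  + by move=> q; exact: dominatedD.
- exists (fun n w => h n w * h' n w),
    (fun n q w => Dh n q w * h' n w + h n w * Dh' n q w); split.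
  + by move=> n; exact: (trigM GF).
  + exact: dominatedM.
  + by move=> q; apply: dominatedD; exact: dominatedM.
Qed.

(* Gaussian integration by parts. *)
Lemma stein_polyX p g Dg : polyX g Dg -> E (fun w => X p w * g w) = E (Dg p).
Proof.
move=> /polyX_trig_approx[h [Dh [th [hg [B aB hB]] Dhg]]].
have [cD [B' aB' DB]] := Dhg p.
apply: (stein_limit GF th hg cD (B := fun w => `|X p w| * B w) (B' := B')) => //.
- apply: all_moments_intg; apply: all_momentsM => //.
  by apply: all_moments_norm; exact: all_moments_X.
- by move=> n w; rewrite normrM ler_wpM2l.
- exact: all_moments_intg.
Qed.

Lemma all_moments_DpolyX g Dg q : polyX g Dg -> all_moments (Dg q).
Proof.
move=> pg; elim: pg => {g Dg} [a|p|h Dh g Dg _ ah _ ag|h Dh g Dg ph ah pg ag].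
- exact: all_moments_cst.
- exact: all_moments_cst.
- exact: all_momentsD.
- by apply: all_momentsD; apply: all_momentsM => //; [exact: all_moments_polyX pg|exact: all_moments_polyX ph].
Qed.

Lemma polyXZ a g Dg : polyX g Dg -> polyX (fun w => a * g w) (fun q w => a * Dg q w).
Proof.
by move=> pg; apply: polyX_eq (polyX_M (polyX_cst a) pg) _ _ => // q w; rewrite mul0r add0r.
Qed.

(** For c p p > 0 this is c^(n/2) He_n (X / sqrt c) with He_n the probabilists' Hermite polynomial;
    the recursion avoids dividing by c and has the shape of that of [wick]. *)
Fixpoint hermite n p w : R :=
  match n with
  | 0 => 1
  | n'.+1 => match n' with
    | 0 => X p w
    | m.+1 => X p w * hermite n' p w - m.+1%:R * c p p * hermite m p w
    end
  end.

Lemma hermiteSS n p w :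
  hermite n.+2 p w = X p w * hermite n.+1 p w - n.+1%:R * c p p * hermite n p w.
Proof. by []. Qed.

(** A uniform recursion: for n = 0 the truncated predecessor is harmless, as its coefficient n is
    0. *)
Lemma hermiteS n p w :
  hermite n.+1 p w = X p w * hermite n p w - n%:R * c p p * hermite n.-1 p w.
Proof. by case: n => [|n] //=; rewrite mulr1 !mul0r subr0. Qed.

Lemma polyX_hermite n p :
  polyX (hermite n p) (fun q w => n%:R * c q p * hermite n.-1 p w).
Proof.
elim/ltn_ind: n => -[|[|n]] IH.
- by apply: polyX_eq (polyX_cst 1) _ _ => // q w; rewrite !mul0r.
- by apply: polyX_eq (polyX_X p) _ _ => // q w; rewrite mul1r mulr1.
apply: polyX_eq (polyX_D (polyX_M (polyX_X p) (IH n.+1 _)) (polyXZ (- (n.+1%:R * c p p)) (IH n _))) _ _ => //.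
  by move=> w; rewrite hermiteSS mulNr.
move=> q w /=; have -> : n.+2%:R = n.+1%:R + 1 :> R by rewrite natr1.
by rewrite -/(hermite n.+1 p w) (hermiteS n); ring.
Qed.

(** X_p - D_p is the adjoint of D_p and raises H_n to H_(n+1): the term n c H_(n-1) g produced by
    the Leibniz rule cancels against the recursion. *)
Lemma E_hermiteS n p g Dg : polyX g Dg ->
  E (fun w => hermite n.+1 p w * g w) = E (fun w => hermite n p w * Dg p w).
Proof.
move=> pg; have pn := polyX_hermite n p.
have png := polyX_M pn pg.
have e := stein_polyX p png.
have ag := all_moments_polyX pg; have aD := all_moments_DpolyX p pg.
have ah m : all_moments (hermite m p) by exact: all_moments_polyX (polyX_hermite m p).
rewrite (_ : E _ = E (fun w => X p w * (hermite n p w * g w)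
    - n%:R * c p p * (hermite n.-1 p w * g w))); last first.
  by apply: eq_Rintegral => w _; rewrite hermiteS; ring.
have i1 : intg (fun w => n%:R * c p p * (hermite n.-1 p w * g w)).
  by apply/intgZ/all_moments_intg/all_momentsM.
have i2 : intg (fun w => X p w * (hermite n p w * g w)).
  apply: all_moments_intg; apply: all_momentsM; first exact: all_moments_X.
  exact: all_momentsM.
have i3 : intg (fun w => hermite n p w * Dg p w).
  by apply: all_moments_intg; exact: all_momentsM.
rewrite EB// e.
rewrite -EB//; first by apply: eq_Rintegral => w _; ring.
by apply: all_moments_intg (all_moments_DpolyX p png).
Qed.

Lemma E_hermite n p : E (hermite n.+1 p) = 0.
Proof.
have := E_hermiteS n p (polyX_cst 1).
rewrite (_ : E _ = E (hermite n.+1 p)); last by apply: eq_Rintegral => w _; rewrite mulr1.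
by move=> ->; under eq_Rintegral do rewrite mulr0; rewrite E_cst.
Qed.

(** Each use of [E_hermiteS] lowers both degrees and releases a factor (m+1) c p q. If one degree
    reaches 0 first, the mean of a Hermite polynomial of positive degree is left. *)
Lemma ip_hermite n m p q : ip mu (hermite n p) (hermite m q) =
  (n == m)%:R * n`!%:R * c p q ^+ n.
Proof.
elim: n m => [|n IH] [|m]; rewrite /ip.
- by under eq_Rintegral do rewrite mulr1; rewrite E_cst expr0 !mulr1.
- by under eq_Rintegral do rewrite mul1r; rewrite E_hermite !mul0r.
- by under eq_Rintegral do rewrite mulr1; rewrite E_hermite !mul0r.
rewrite (E_hermiteS n p (polyX_hermite m.+1 q)) /=.
rewrite (_ : E _ = E (fun w => m.+1%:R * c p q * (hermite n p w * hermite m q w))); last first.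
  by apply: eq_Rintegral => w _; ring.
rewrite EZ; last first.
  apply: all_moments_intg; apply: all_momentsM;
  by apply: all_moments_polyX; exact: polyX_hermite.
rewrite [E _](IH m) eqSS; have [->|] := eqVneq n m; last by rewrite !mul0r mulr0.
by rewrite factS natrM exprS; ring.
Qed.

(** An induction principle in place of explicit connection coefficients, proved for X^k H_n through
    X H_n = H_(n+1) + n c H_(n-1). *)
Lemma powX_hermite_ind (P : (T -> R) -> Prop) p :
  (forall a f g, P f -> P g -> P (fun w => a * f w + g w)) ->
  (forall n, P (hermite n p)) -> forall n, P (fun w => X p w ^+ n).
Proof.
move=> Plin Ph.
have P0 : P (fun=> 0).
  have := Plin (-1) _ _ (Ph 0%N) (Ph 0%N).
  by under eq_fun do rewrite mulN1r addNr.
suff XP k n : P (fun w => X p w ^+ k * hermite n p w).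
  by move=> n; have := XP n 0%N; under eq_fun do rewrite mulr1.
elim: k n => [|k IH] n; first by under eq_fun do rewrite expr0 mul1r; exact: Ph.
have := Plin (n%:R * c p p) _ _ (IH n.-1) (IH n.+1).
by congr P; apply/funext => w; rewrite hermiteS exprS; ring.
Qed.

End gaussian_polynomials.

(** * Power series for exponential moments *)

Section exponential_series.
Context (R : realType).
Implicit Types x y : R.

Lemma cvg_exp_series x : series (exp_coeff x) n @[n --> \oo] --> expR x.
Proof. exact: is_cvg_series_exp_coeff. Qed.

Lemma exp_series_le x n : 0 <= x -> series (exp_coeff x) n <= expR x.
Proof.
move=> x0; apply: nondecreasing_cvgn_le; last exact: is_cvg_series_exp_coeff.
by apply: nondecreasing_series => k _ _; exact: exp_coeff_ge0.
Qed.

(** Cutting at an even index cancels the odd terms; what remains of 2 cosh x has nonnegative terms,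
    fit for Fatou. *)
Lemma series_cosh_even x n :
  series (exp_coeff x) n.*2 + series (exp_coeff (- x)) n.*2 =
  \sum_(k < n) 2 * x ^+ k.*2 / k.*2`!%:R.
Proof.
elim: n => [|n IH]; first by rewrite /series /= !big_geq// big_ord0 addr0.
rewrite big_ord_recr -IH /= doubleS /series /= !big_nat_recr//= /exp_coeff /=.
have e : (- x) ^+ n.*2 = x ^+ n.*2 by rewrite exprNn -mul2n exprM sqrrN expr1n expr1n mul1r.
have o : (- x) ^+ n.*2.+1 = - x ^+ n.*2.+1 by rewrite exprS e exprS mulNr.
by rewrite o e; ring.
Qed.

Lemma cvg_double (u : nat -> R) (l : R) : u n @[n --> \oo] --> l ->
  u n.*2 @[n --> \oo] --> l.
Proof.
move=> /cvgrPdist_le h; apply/cvgrPdist_le => e /h[m0 _ hm]; exists m0 => // n /= mn.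
by apply: hm => /=; apply: leq_trans mn _; rewrite -addnn leq_addr.
Qed.

(** Divided by (2n)!, the moment bound (2n-1)!! c^n becomes (c/2)^n / n!, a term of exp (c/2). *)
Lemma factor_double n : n.*2`!%:R = 2 ^+ n * n`!%:R * \prod_(i < n) (i.*2.+1)%:R :> R.
Proof.
elim: n => [|n IH]; first by rewrite big_ord0 expr0 !mulr1.
rewrite big_ord_recr /= doubleS !factS !natrM IH exprS.
have -> : n.*2.+2%:R = 2 * n.+1%:R :> R by rewrite -doubleS -mul2n natrM.
by ring.
Qed.

Lemma powerseries_le_exp (a : nat -> R) x n :
  (forall k, `|a k| <= (k`!%:R)^-1) ->
  `|\sum_(k < n) a k * x ^+ k| <= expR `|x|.
Proof.
move=> ha; apply: le_trans (exp_series_le n (normr_ge0 x)).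
rewrite /series /= big_mkord; apply: (le_trans (ler_norm_sum _ _ _)).
apply: ler_sum => k _; rewrite normrM normrX /exp_coeff /= mulrC.
by rewrite ler_wpM2l ?exprn_ge0.
Qed.

End exponential_series.

(** * Exponential moments, and from powers to cosines and sines *)

Section exponential_moments.
Context d (T : measurableType d) (R : realType) (mu : probability T R).
Context (V : lmodType R) (X : V -> T -> R) (c : V -> V -> R).
Hypothesis GF : gaussian_family mu X c.
Local Notation E := (Rintegral mu setT).
Local Notation L2 := (L2 mu).
Local Notation intg := (intg mu).
Implicit Types (p q r : V) (w : T) (F h g : T -> R).

Let mX p : measurable_fun setT (X p). Proof. exact: (gf_measurable GF). Qed.

Lemma intg_cosh p : intg (fun w => expR (X p w) + expR (- X p w)).
Proof.
pose G n w : R := \sum_(k < n) 2 * X p w ^+ k.*2 / k.*2`!%:R.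
have GE n w : G n w = \sum_(k < n) (2 / k.*2`!%:R) * `|X p w| ^+ k.*2.
  apply: eq_bigr => k _; rewrite -mul2n [in RHS]exprM real_normK ?num_real// -exprM.
  by rewrite mulrAC.
have iG k : intg (fun w => `|X p w| ^+ k.*2) by have [] := moment_even GF p k.
have [] := @fatou_E _ _ _ mu G (fun w => expR (X p w) + expR (- X p w))
  (2 * expR (c p p / 2)) => //.
- move=> n; rewrite (_ : G n = fun w => \sum_(k < n) (2 / k.*2`!%:R) * `|X p w| ^+ k.*2); last first.
    by apply/funext => w; exact: GE.
  by apply: intg_sum => k; exact: intgZ.
- move=> n w; rewrite GE; apply: sumr_ge0 => k _.
  by rewrite mulr_ge0// divr_ge0.
- move=> w; rewrite /G; under eq_cvg do rewrite -series_cosh_even.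
  by apply: cvgD; apply: cvg_double; exact: cvg_exp_series.
apply: nearW => n; rewrite (_ : E (G n) = E (fun w => \sum_(k < n) (2 / k.*2`!%:R) * `|X p w| ^+ k.*2)); last first.
  by apply: eq_Rintegral => w _; exact: GE.
rewrite E_sum; last by move=> k; exact: intgZ.
have c0 : 0 <= c p p / 2 by rewrite divr_ge0// (gf_c_ge0 GF).
apply: le_trans (ler_wpM2l _ (exp_series_le n c0)) => //.
rewrite /series /= big_mkord mulr_sumr; apply: ler_sum => k _.
rewrite EZ//; have [_ h] := moment_even GF p k.
apply: (le_trans (ler_wpM2l _ h)) => //.
rewrite /exp_coeff /= factor_double expr_div_n.
have P0 : \prod_(i < k) (i.*2.+1)%:R != 0 :> R.
  by apply/prodf_neq0 => i _; rewrite pnatr_eq0.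
have f0 : k`!%:R != 0 :> R by rewrite pnatr_eq0 -lt0n fact_gt0.
have t0 : 2 ^+ k != 0 :> R by rewrite expf_neq0.
rewrite le_eqVlt; apply/orP; left; apply/eqP; field.
by rewrite P0 f0 t0.
Qed.

(** The square is exp (2 |X p|), which is below 2 cosh of the variable of index 2 p. *)
Lemma L2_expR_norm p : L2 (fun w => expR `|X p w|).
Proof.
have mexp g : measurable_fun setT g -> measurable_fun setT (fun w => expR (g w)).
  move=> mg; apply: (measurableT_comp _ mg).
  by apply: continuous_measurable_fun; exact: continuous_expR.
have m1 : measurable_fun setT (fun w => expR `|X p w|).
  by apply: mexp; exact: measurableT_comp.
split => //; apply: le_intg (intg_cosh (2 *: p)).
  exact: measurable_funX.
move=> w; rewrite !(gf_XZ GF) ger0_norm ?exprn_ge0 ?expR_ge0//.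
rewrite [leRHS]ger0_norm ?addr_ge0 ?expR_ge0// -expRM_natl.
have := expR_gt0 (2 * X p w); have := expR_gt0 (- (2 * X p w)).
have [x0|x0] := leP 0 (X p w); first by rewrite ger0_norm//; lra.
by rewrite ltr0_norm// mulrN; lra.
Qed.

(** Coefficients below 1/k! keep all partial sums below exp |X p|, so |F| exp |X p|, a product of
    two L^2 functions, dominates the termwise pairing. Cosine and sine are the two instances. *)
Lemma ip_powerseries F (a : nat -> R) (S : R -> R) p :
  L2 F -> (forall n, ip mu F (fun w => X p w ^+ n) = 0) ->
  (forall k, `|a k| <= (k`!%:R)^-1) ->
  (forall x, \sum_(k < n) a k * x ^+ k @[n --> \oo] --> S x) ->
  ip mu F (fun w => S (X p w)) = 0.
Proof.
move=> LF F0 ha aS.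
have LX n : L2 (fun w => X p w ^+ n).
  by apply: all_moments_L2; apply: all_momentsX; exact: all_moments_X GF p.
pose G n w := \sum_(k < n) a k * X p w ^+ k.
have LG n : L2 (G n) by apply: L2_sum => k; exact: L2Z.
have [] := @E_dominated _ _ _ mu (fun n w => F w * G n w) (fun w => F w * S (X p w))
  (fun w => `|F w| * expR `|X p w|).
- by move=> n; exact/intg_measurable/(L2_mul LF (LG n)).
- apply: L2_mul; last exact: L2_expR_norm.
  have [mF iF] := LF; split; first exact: measurableT_comp.
  by apply: eq_integrable iF => // w _ /=; rewrite real_normK ?num_real.
- by move=> n w; rewrite normrM ler_wpM2l// powerseries_le_exp.
- by move=> w; apply: cvgM; [exact: cvg_cst|exact: aS].
move=> _ c1; apply: cvgnR_unique c1 _.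
have G0 n : E (fun w => F w * G n w) = 0.
  rewrite -[LHS]/(ip mu F (G n)) ipC /G ip_suml//; last by move=> k; exact: L2Z.
  by apply: big1 => k _; rewrite ipZl// ipC F0 mulr0.
by under eq_cvg do rewrite G0; exact: cvg_cst.
Qed.

Lemma ip_cosX F p : L2 F -> (forall n, ip mu F (fun w => X p w ^+ n) = 0) ->
  ip mu F (fun w => cos (X p w)) = 0.
Proof.
move=> LF F0; apply: (ip_powerseries (a := fun k => (~~ odd k)%:R * (-1)^k./2 / k`!%:R) LF F0).
  move=> k; rewrite normrM normfV normr_nat -[leRHS]mul1r ler_wpM2r//.
  by rewrite normrM normr_nat -exprnP normrX normrN1 expr1n mulr1; case: odd.
move=> x; have : series (cos_coeff x) n @[n --> \oo] --> cos x.
  by rewrite unlock; exact: is_cvg_series_cos_coeff.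
apply: cvg_trans; apply: near_eq_cvg; apply: nearW => n.
by rewrite /series /= big_mkord; apply: eq_bigr => k _; rewrite /cos_coeff /= mulrAC.
Qed.

Lemma ip_sinX F p : L2 F -> (forall n, ip mu F (fun w => X p w ^+ n) = 0) ->
  ip mu F (fun w => sin (X p w)) = 0.
Proof.
move=> LF F0; apply: (ip_powerseries (a := fun k => (odd k)%:R * (-1)^+k.-1./2 / k`!%:R) LF F0).
  move=> k; rewrite normrM normfV normr_nat -[leRHS]mul1r ler_wpM2r//.
  by rewrite normrM normr_nat normrX normrN1 expr1n mulr1; case: odd.
move=> x; have : series (sin_coeff x) n @[n --> \oo] --> sin x.
  by rewrite unlock; exact: is_cvg_series_sin_coeff.
apply: cvg_trans; apply: near_eq_cvg; apply: nearW => n.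
by rewrite /series /= big_mkord; apply: eq_bigr => k _; rewrite /sin_coeff /= mulrAC.
Qed.

End exponential_moments.

(** * The sign function as a limit of polynomials *)

Section sign_approximation.
Context (R : realType).
Implicit Types x y : R.

(** The Newton-Schulz iteration for the sign: it fixes -1, 0 and 1 and is flat at -1 and 1. Being a
    polynomial, it acts on any algebra of functions. *)
Definition sign_step y := (3 * y - y ^+ 3) / 2.

Lemma sign_step_bound y : `|y| <= 1 -> `|sign_step y| <= 1.
Proof.
rewrite !ler_norml /sign_step => /andP[y0 y1].
have h1 : 0 <= (1 - y) ^+ 2 * (2 + y) by rewrite mulr_ge0 ?sqr_ge0//; lra.
have h2 : 0 <= (1 + y) ^+ 2 * (2 - y) by rewrite mulr_ge0 ?sqr_ge0//; lra.
have e1 : (1 - y) ^+ 2 * (2 + y) = 2 - (3 * y - y ^+ 3) by ring.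
have e2 : (1 + y) ^+ 2 * (2 - y) = 2 + (3 * y - y ^+ 3) by ring.
by apply/andP; split; lra.
Qed.

Lemma iter_sign_step_bound n y : `|y| <= 1 -> `|iter n sign_step y| <= 1.
Proof. by move=> y1; elim: n => [//|n IH]; rewrite iterS sign_step_bound. Qed.

Lemma sign_stepN y : sign_step (- y) = - sign_step y.
Proof. by rewrite /sign_step; field. Qed.

Lemma iter_sign_stepN n y : iter n sign_step (- y) = - iter n sign_step y.
Proof. by elim: n => [//|n IH]; rewrite !iterS IH sign_stepN. Qed.

Lemma cvg_sign_step_pos y : 0 < y -> y <= 1 -> iter n sign_step y @[n --> \oo] --> (1 : R).
Proof.
(* One step multiplies 1 - u by (1 - u)(2 + u)/2, which decreases for u >= 0. Iterates never fall
   below y, so z, the value at y, is a uniform contraction factor. *)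
move=> y0 y1; pose z := (1 - y) * (2 + y) / 2.
have z0 : 0 <= z by rewrite divr_ge0// mulr_ge0//; lra.
have z1 : z < 1.
  have -> : z = 1 - y * (1 + y) / 2 by rewrite /z; field.
  by rewrite ltrBlDr ltrDl divr_gt0// mulr_gt0//; lra.
have h n : (y <= iter n sign_step y <= 1) && (1 - iter n sign_step y <= z ^+ n * (1 - y)).
  elim: n => [|n]; first by rewrite lexx y1 expr0 mul1r lexx.
  rewrite iterS; move: (iter n sign_step y) => u /andP[/andP[yu u1] hu].
  have e : 1 - sign_step u = (1 - u) * ((1 - u) * (2 + u) / 2) by rewrite /sign_step; field.
  have uz : (1 - u) * (2 + u) / 2 <= z.
    rewrite ler_pM2r// -subr_ge0.
    have -> : (1 - y) * (2 + y) - (1 - u) * (2 + u) = (u - y) * (1 + u + y) by ring.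
    by rewrite mulr_ge0//; lra.
  have u0 : 0 <= (1 - u) * (2 + u) / 2 by rewrite divr_ge0// mulr_ge0//; lra.
  have hle : (1 - u) * ((1 - u) * (2 + u) / 2) <= (1 - u) * z by rewrite ler_wpM2l//; lra.
  have hlez : (1 - u) * z <= 1 - u by rewrite ler_piMr ?(ltW z1)//; lra.
  have h0 : 0 <= (1 - u) * ((1 - u) * (2 + u) / 2) by rewrite mulr_ge0//; lra.
  apply/andP; split; first by apply/andP; split; lra.
  rewrite e; apply: (le_trans hle).
  by rewrite exprS -mulrA mulrC ler_wpM2l.
apply/cvgrPdist_le => e e0.
have : z ^+ n * (1 - y) @[n --> \oo] --> (0 : R).
  rewrite -[X in _ --> X](mul0r (1 - y)); apply: cvgM; last exact: cvg_cst.
  by apply: cvg_expr; rewrite ger0_norm.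
move=> /cvgrPdist_le/(_ _ e0)[m0 _ hm]; exists m0 => // n /hm /=.
have /andP[/andP[_ n1] hn] := h n.
rewrite sub0r normrN !ger0_norm ?subr_ge0 ?mulr_ge0 ?exprn_ge0 ?subr_ge0//.
exact: le_trans.
Qed.

Lemma cvg_sign_step y : `|y| <= 1 -> iter n sign_step y @[n --> \oo] --> Num.sg y.
Proof.
have [y0|y0|<-] := ltrgtP 0 y; last first.
- move=> _; rewrite sgr0; have h n : iter n sign_step (0 : R) = 0.
    by elim: n => // n IH; rewrite iterS IH /sign_step expr0n mulr0 subr0 mul0r.
  by under eq_cvg do rewrite h; exact: cvg_cst.
- move=> y1; rewrite ltr0_sg//; have h n : iter n sign_step y = - iter n sign_step (- y).
    by rewrite iter_sign_stepN opprK.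
  under eq_cvg do rewrite h; apply: cvgN; apply: cvg_sign_step_pos; first by rewrite oppr_gt0.
  by move: y1; rewrite ltr0_norm.
- move=> y1; rewrite gtr0_sg//; apply: cvg_sign_step_pos => //.
  exact: le_trans (ler_norm y) y1.
Qed.

(** Once |x| / n is below pi, the bounded sin (x / n) has the sign of x. This matters because
    [bclosure] offers sines of X p but not the unbounded X p itself. *)
Lemma cvg_sg_sin x : Num.sg (sin (x / n.+1%:R)) @[n --> \oo] --> Num.sg x.
Proof.
wlog x0 : x / 0 <= x => [h|].
  have [|/ltW x0] := leP 0 x; first exact: h.
  have hx n : Num.sg (sin (x / n.+1%:R)) = - Num.sg (sin (- x / n.+1%:R)).
    by rewrite mulNr sinN sgrN opprK.
  rewrite -[Num.sg x]opprK -sgrN; under eq_cvg do rewrite hx.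
  by apply: cvgN; apply: h; rewrite oppr_ge0.
have [->|xn0] := eqVneq x 0.
  by under eq_cvg do rewrite mul0r sin0; exact: cvg_cst.
have xp : 0 < x by rewrite lt_def xn0.
apply: cvg_near_cst.
have /cvgrPdist_lt/(_ 1 ltr01)[m0 _ h] := cvg_cst_natSV x.
exists m0 => // n /h /=; rewrite sub0r normrN ger0_norm ?divr_ge0// => x1.
rewrite !gtr0_sg// sin_gt0_pi// divr_gt0//=.
by apply: (lt_trans x1); apply: (lt_le_trans _ (@pi_ge2 R)); rewrite ltr1n.
Qed.

End sign_approximation.

(** * Hermite polynomials are total in L^2 *)

Section totality.
Context d (T : measurableType d) (R : realType) (mu : probability T R).
Context (V : lmodType R) (X : V -> T -> R) (c : V -> V -> R).
Hypothesis GF : gaussian_family mu X c.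
Hypothesis Xgen : @measurable d T `<=`
  <<s \bigcup_(p in setT) preimage_set_system setT (X p) measurable >>.
Local Notation E := (Rintegral mu setT).
Local Notation L2 := (L2 mu).
Local Notation intg := (intg mu).
Implicit Types (p q r : V) (w : T) (F f g : T -> R).

Let mX p : measurable_fun setT (X p). Proof. exact: (gf_measurable GF). Qed.

(* The smallest linear space of functions that contains all cos (X p) and
   sin (X p) and is closed under bounded pointwise limits. *)
Inductive bclosure : (T -> R) -> Prop :=
| bclosure_cos p : bclosure (fun w => cos (X p w))
| bclosure_sin p : bclosure (fun w => sin (X p w))
| bclosure_lin a f g : bclosure f -> bclosure g -> bclosure (fun w => a * f w + g w)
| bclosure_lim (u : nat -> T -> R) f (M : R) : (forall n, bclosure (u n)) ->
    (forall n w, `|u n w| <= M) -> (forall w, u n w @[n --> \oo] --> f w) -> bclosure f.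

Lemma bclosure_bounded f : bclosure f ->
  measurable_fun setT f /\ exists M : R, forall w, `|f w| <= M.
Proof.
elim=> {f} [p|p|a f g _ [mf [M fM]] _ [mg [M' gM]]|u f M _ IH uM uf].
- by split; [exact: (measurable_cosX GF)|exists 1 => w; exact: cos_max].
- by split; [exact: (measurable_sinX GF)|exists 1 => w; exact: sin_max].
- split; first by apply: measurable_funD => //; exact: measurable_funM.
  exists (`|a| * M + M') => w; apply: (le_trans (ler_normD _ _)).
  by rewrite lerD// normrM ler_wpM2l.
- split; first by apply: (@measurable_fun_cvg _ _ _ _ u) => [n|w _]; [case: (IH n)|exact: uf].
  exists M => w; have /cvg_norm uw := uf w.
  have /cvg_lim <- // := uw; apply: limr_le; last exact: nearW.
  by apply/cvg_ex; eexists; exact: uw.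
Qed.

Lemma bclosure_eq f g : bclosure f -> (forall w, f w = g w) -> bclosure g.
Proof. by move=> bf fg; rewrite (_ : g = f)//; apply/funext => w. Qed.

Lemma bclosure_cst (a : R) : bclosure (fun=> a).
Proof.
apply: bclosure_eq (bclosure_lin (a - 1) (bclosure_cos 0) (bclosure_cos 0)) _ => w.
by rewrite (gf_X0 GF) cos0; ring.
Qed.

Lemma bclosureZ a f : bclosure f -> bclosure (fun w => a * f w).
Proof. by move=> bf; apply: bclosure_eq (bclosure_lin a bf (bclosure_cst 0)) _ => w; rewrite addr0. Qed.

Lemma bclosureD f g : bclosure f -> bclosure g -> bclosure (fun w => f w + g w).
Proof. by move=> bf bg; apply: bclosure_eq (bclosure_lin 1 bf bg) _ => w; rewrite mul1r. Qed.

Let bclosureM_lim u f g (M : R) : (forall n, bclosure (fun w => g w * u n w)) ->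
  (forall n w, `|u n w| <= M) -> (forall w, u n w @[n --> \oo] --> f w) ->
  (exists M' : R, forall w, `|g w| <= M') -> bclosure (fun w => g w * f w).
Proof.
move=> bu uM uf [M' gM].
apply: (bclosure_lim (u := fun n w => g w * u n w) (M := M' * M) bu).
  by move=> n w; rewrite normrM ler_pM.
by move=> w; apply: cvgM; [exact: cvg_cst|exact: uf].
Qed.

(** Product-to-sum formulas settle the generators; a limit in one factor survives multiplication by
    the other because that factor is bounded. *)
Lemma bclosureM f g : bclosure f -> bclosure g -> bclosure (fun w => f w * g w).
Proof.
have gfE := (gf_XD GF, gf_XN GF, cosD, sinD, cosN, sinN).
move=> bf; elim: bf g => {f} [p|p|a f f' bf IHf bf' IHf'|u f M bu IH uM uf] g.
- elim=> {g} [q|q|a g g' bg IHg bg' IHg'|u g M bu IH uM uf].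
  + apply: bclosure_eq (bclosureZ 2^-1 (bclosureD (bclosure_cos (p + q)) (bclosure_cos (p - q)))) _ => w.
    by rewrite !gfE; field.
  + apply: bclosure_eq (bclosureZ 2^-1 (bclosure_lin (-1) (bclosure_sin (p - q)) (bclosure_sin (p + q)))) _ => w.
    by rewrite !gfE; field.
  + by apply: bclosure_eq (bclosure_lin a IHg IHg') _ => w; ring.
  + by apply: bclosureM_lim IH uM uf _; exists 1 => w; exact: cos_max.
- elim=> {g} [q|q|a g g' bg IHg bg' IHg'|u g M bu IH uM uf].
  + apply: bclosure_eq (bclosureZ 2^-1 (bclosureD (bclosure_sin (p + q)) (bclosure_sin (p - q)))) _ => w.
    by rewrite !gfE; field.
  + apply: bclosure_eq (bclosureZ 2^-1 (bclosure_lin (-1) (bclosure_cos (p + q)) (bclosure_cos (p - q)))) _ => w.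
    by rewrite !gfE; field.
  + by apply: bclosure_eq (bclosure_lin a IHg IHg') _ => w; ring.
  + by apply: bclosureM_lim IH uM uf _; exists 1 => w; exact: sin_max.
- by move=> bg; apply: bclosure_eq (bclosure_lin a (IHf _ bg) (IHf' _ bg)) _ => w; ring.
- move=> bg; apply: (bclosure_eq (f := fun w => g w * f w)); last by move=> w; rewrite mulrC.
  apply: (bclosureM_lim (u := u) (M := M)) => //; last by have [] := bclosure_bounded bg.
  by move=> n; apply: bclosure_eq (IH n _ bg) _ => w; rewrite mulrC.
Qed.

Lemma bclosure_sg f : bclosure f -> (forall w, `|f w| <= 1) -> bclosure (fun w => Num.sg (f w)).
Proof.
move=> bf f1; apply: (bclosure_lim (u := fun n w => iter n (@sign_step R) (f w)) (M := 1)).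
- elim=> [//|n IH]; have b3 := bclosureM IH (bclosureM IH IH).
  apply: bclosure_eq (bclosureD (bclosureZ (3 / 2) IH) (bclosureZ (- 2^-1) b3)) _ => w.
  by rewrite iterS /sign_step; field.
- by move=> n w; exact: iter_sign_step_bound.
- by move=> w; exact: cvg_sign_step.
Qed.

(** The addition formula writes sin ((X p - a) / n) through the sine and cosine of index p / n;
    signs and two limits then give sg (X p - a). *)
Lemma bclosure_halfline p (a : R) : bclosure (\1_[set w | a < X p w]).
Proof.
have b : bclosure (fun w => Num.sg (X p w - a)).
  apply: (bclosure_lim (u := fun n w => Num.sg (sin ((X p w - a) / n.+1%:R))) (M := 1)).
  - move=> n; apply: bclosure_sg => [|w]; last exact: sin_max.
    pose t := a / n.+1%:R; pose q := n.+1%:R^-1 *: p.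
    apply: bclosure_eq (bclosureD (bclosureZ (cos t) (bclosure_sin q)) (bclosureZ (- sin t) (bclosure_cos q))) _ => w.
    by rewrite mulrBl sinB /q (gf_XZ GF) (mulrC n.+1%:R^-1); ring.
  - by move=> n w; rewrite normr_sg lern1; case: (_ == _).
  - by move=> w; exact: cvg_sg_sin.
(* For s in {-1, 0, 1}, (s + s^2) / 2 is the indicator of s = 1. *)
apply: bclosure_eq (bclosureZ 2^-1 (bclosureD b (bclosureM b b))) _ => w.
rewrite indicE; have [h|h|h] := ltgtP a (X p w).
- by rewrite mem_set//= gtr0_sg ?subr_gt0//; field.
- rewrite memNset /=; last by apply/negP; rewrite -leNgt ltW.
  by rewrite ltr0_sg ?subr_lt0//; ring.
- rewrite memNset /=; last by rewrite -h ltxx.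
  by rewrite -h subrr sgr0 mulr0 addr0 mulr0.
Qed.

(** Products of indicators give intersections, hence finite unions by complements; a countable union
    is the bounded limit of its finite parts. *)
Lemma bclosure_sigma_algebra : sigma_algebra setT [set B | bclosure (\1_B)].
Proof.
have bI A B : bclosure (\1_A) -> bclosure (\1_B) -> bclosure (\1_(A `&` B)).
  by move=> bA bB; rewrite indicI; exact: bclosureM.
have bC A : bclosure (\1_A) -> bclosure (\1_(~` A)).
  move=> bA; apply: bclosure_eq (bclosureD (bclosure_cst 1) (bclosureZ (-1) bA)) _ => w.
  by rewrite indicC indicE; case: (w \in A) => /=; ring.
have b0 : bclosure (\1_(set0 : set T)).
  by apply: bclosure_eq (bclosure_cst 0) _ => w; rewrite indicE in_set0.
split => //= [A|A bA]; first by rewrite setTD; exact: bC.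
pose B n := \big[setU/set0]_(k < n) A k.
have bB n : bclosure (\1_(B n)).
  elim: n => [|n IH]; first by rewrite /B big_ord0.
  by rewrite /B big_ord_recr /= -[_ `|` _]setCK setCU; apply/bC/bI; exact: bC.
apply: (bclosure_lim (u := fun n => \1_(B n)) (M := 1)) => // [n w|w].
  by rewrite indicE normr_nat lern1; case: (_ \in _).
apply: cvg_near_cst; rewrite indicE; case: (boolP (_ \in _)) => [/set_mem[k _ Akw]|/negP nA].
  exists k.+1 => // n /= kn; rewrite indicE mem_set// /B.
  by apply: (@bigsetU_sup _ (Ordinal kn)).
apply: nearW => n; rewrite indicE memNset// => h.
by apply: nA; apply: mem_set; exact: bigsetU_bigcup h.
Qed.

Lemma bclosure_indic B : measurable B -> bclosure (\1_B).
Proof.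
move=> /Xgen; move: B.
apply: (@smallest_sub _ _ _ [set B | bclosure (\1_B)]) => //; first exact: bclosure_sigma_algebra.
move=> _ [p _ [A mA <-]]; rewrite setTI.
(* Borel sets are generated by open half-lines, whose preimages are [bclosure_halfline]. *)
have {mA} : (@RGenOInfty.G R).-sigma.-measurable A by rewrite -RGenOInfty.measurableE.
have [h0 hC hU] := bclosure_sigma_algebra.
move: A; apply: (@smallest_sub _ _ _ [set A | bclosure (\1_(X p @^-1` A))]) => [|_ [a ->]] /=.
  split => [|A bA|A bA] /=; first by rewrite preimage_set0.
    by have := hC _ bA; rewrite /= setTD setTD preimage_setC.
  by rewrite preimage_bigcup; exact: hU.
have := bclosure_halfline p a; congr (bclosure (\1_ _)).
by apply/seteqP; split => w /=; rewrite in_itv /= andbT.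
Qed.

Lemma ip_bclosure F f : L2 F -> (forall p n, ip mu F (fun w => X p w ^+ n) = 0) ->
  bclosure f -> ip mu F f = 0.
Proof.
move=> LF F0; elim=> {f} [p|p|a f g bf IHf bg IHg|u f M bu IH uM uf].
- exact: (ip_cosX GF).
- exact: (ip_sinX GF).
- have Lb h : bclosure h -> L2 h.
    move=> /bclosure_bounded[mh [M hM]]; split => //; apply: (@intg_bounded _ _ _ _ _ (M ^+ 2)).
      exact: measurable_funX.
    by move=> w; rewrite normrX lerXn2r ?nnegrE// (le_trans _ (hM w)).
  have Lf := Lb _ bf; have Lg := Lb _ bg.
  by rewrite ipDr// ?ipZr ?IHf ?IHg ?mulr0 ?addr0//; exact: L2Z.
have mu_ n : measurable_fun setT (u n) by have [] := bclosure_bounded (bu n).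
have [mF _] := LF.
have [] := @E_dominated _ _ _ mu (fun n w => F w * u n w) (fun w => F w * f w)
  (fun w => M * `|F w|).
- by move=> n; exact: measurable_funM.
- by apply: intgZ; apply: intg_norm; exact: L2_intg.
- by move=> n w; rewrite normrM mulrC ler_wpM2r.
- by move=> w; apply: cvgM; [exact: cvg_cst|exact: uf].
move=> _ c1; apply: cvgnR_unique c1 _.
by under eq_cvg do rewrite [E _]IH; exact: cvg_cst.
Qed.

Lemma hermite_total F : L2 F -> (forall p n, ip mu F (hermite X c n p) = 0) -> ip mu F F = 0.
Proof.
move=> LF F0.
have Fp p n : ip mu F (fun w => X p w ^+ n) = 0.
  suff [] : L2 (fun w => X p w ^+ n) /\ ip mu F (fun w => X p w ^+ n) = 0 by [].
  apply: (powX_hermite_ind (X := X) (c := c)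
    (P := fun f => L2 f /\ ip mu F f = 0)) => [a f g [Lf f0] [Lg g0]|m].
    split; first by apply: L2D => //; exact: L2Z.
    by rewrite ipDr ?ipZr ?f0 ?g0 ?mulr0 ?addr0//; exact: L2Z.
  split; last exact: F0.
  apply: all_moments_L2; exact: all_moments_polyX GF _ _ (polyX_hermite X c m p).
have [mF iF2] := LF; have iF := L2_intg LF.
(* Indicators lie in [bclosure], so F integrates to 0 over every event and therefore vanishes almost
   everywhere. *)
have FB B : measurable B -> (\int[mu]_(x in B) (F x)%:E = 0)%E.
  move=> mB; have := ip_bclosure LF Fp (bclosure_indic mB).
  rewrite /ip => h; rewrite integral_mkcond.
  have iFB : intg (fun w => F w * \1_B w).
    apply: le_intg iF => [|w]; first by apply: measurable_funM => //; exact: measurable_indic.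
    by rewrite normrM ler_piMr// indicE normr_nat lern1; case: (_ \in _).
  rewrite -[RHS]/(0%:E) -h EFin_E//; apply: eq_integral => w _.
  by rewrite /= patchE indicE; case: (_ \in _); rewrite ?mulr1 ?mulr0.
have ae0 : ae_eq mu setT (EFin \o F) (cst 0%E).
  by apply: integral_ae_eq => // B _ mB; rewrite integral_cst// mul0e; exact: FB.
rewrite /ip (@ae_E _ _ _ mu _ (fun=> 0)) ?E_cst//; first exact: measurable_funM.
by apply: filterS ae0 => w /(_ Logic.I) [->]; rewrite mulr0.
Qed.

End totality.

(** * Expansion of multilinear maps and polarization of symmetric tensors *)

Section multilinear_expansion.
Context (R : comPzRingType) (V W : lmodType R) (n : nat) (F : ('I_n -> V) -> W).
Hypothesis mF : multilinear F.

Lemma multilinear_upd_sum (I : finType) (S : pred I) (v : 'I_n -> V) j (a : I -> V) :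
  F (upd v j (\sum_(i | S i) a i)) = \sum_(i | S i) F (upd v j (a i)).
Proof.
have F0 : F (upd v j 0) = 0.
  have := mF v j 1 0 0; rewrite scaler0 addr0 scale1r => /eqP.
  by rewrite -subr_eq0 opprD addrA subrr sub0r oppr_eq0 => /eqP.
have FD x y : F (upd v j (x + y)) = F (upd v j x) + F (upd v j y).
  by rewrite -[x in LHS]scale1r mF scale1r.
exact: (big_morph (fun x => F (upd v j x)) FD F0).
Qed.

Lemma multilinear_sum (S : pred 'I_n) (v : 'I_n -> V) :
  F (fun=> \sum_(i | S i) v i) =
  \sum_(f : {ffun 'I_n -> 'I_n} | f \in ffun_on S) F (fun j => v (f j)).
Proof.
pose s := \sum_(i | S i) v i.
(* Slots are expanded one at a time. For a slot j not yet in r the index function is pinned to the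
   dummy value j, so that it is counted once. *)
pose Q (r : seq 'I_n) j : pred 'I_n := if j \in r then S else pred1 j.
pose mix (r : seq 'I_n) (u b : 'I_n -> V) j := if j \in r then u j else b j.
have key r b : uniq r -> F (mix r (fun=> s) b) =
    \sum_(f : {ffun 'I_n -> 'I_n} | f \in family (Q r)) F (mix r (fun j => v (f j)) b).
  elim: r b => [|j r IH] b.
    move=> _; rewrite (big_pred1 [ffun j => j]) => [|f].
      by congr F; apply/funext => j; rewrite /mix in_nil.
    apply/familyP/eqP => [fQ|-> j]; last by rewrite /Q in_nil ffunE inE.
    by apply/ffunP => j; have := fQ j; rewrite /Q in_nil inE ffunE => /eqP.
  rewrite /= => /andP[jr ur].
  have -> : mix (j :: r) (fun=> s) b = upd (mix r (fun=> s) b) j s.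
    apply/funext => k; rewrite /mix /upd in_cons; case: eqVneq => //=.
  rewrite multilinear_upd_sum.
  transitivity (\sum_(i | S i) \sum_(f : {ffun 'I_n -> 'I_n} | f \in family (Q r))
      F (mix r (fun j' => v (f j')) (upd b j (v i)))).
    apply: eq_bigr => i Si; rewrite -(IH _ ur); congr F.
    apply/funext => k; rewrite /mix /upd; case: eqVneq => // ->.
    by rewrite (negbTE jr).
  rewrite pair_big_dep /=.
  (* Choosing i in S for the new slot j and f for the others is the same as one function g with g j
     = i; going back resets g at j to the dummy value. *)
  rewrite (reindex_onto
    (fun g : {ffun 'I_n -> 'I_n} => (g j, [ffun k => if k == j then j else g k]))
    (fun p => [ffun k => if k == j then p.1 else p.2 k])) /=; last first.
    move=> [i f] /= /andP[Si /familyP fQ]; congr pair; first by rewrite ffunE eqxx.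
    apply/ffunP => k; rewrite !ffunE; case: eqVneq => // ->.
    by have := fQ j; rewrite /Q (negbTE jr) inE => /eqP.
  apply: eq_big => [g|g].
    rewrite (_ : [ffun k => if k == j then g j else _] = g); last first.
      by apply/ffunP => k; rewrite !ffunE; case: eqVneq => // ->.
    rewrite eqxx andbT; apply/andP/familyP => [[Sg /familyP gQ] k|gQ].
      rewrite /Q in_cons; case: eqVneq => [->//|kj /=].
      by have := gQ k; rewrite /Q ffunE (negbTE kj).
    split; first by have := gQ j; rewrite /Q mem_head.
    apply/familyP => k; rewrite /Q ffunE; case: eqVneq => [->|kj].
      by rewrite (negbTE jr) inE.
    by have := gQ k; rewrite /Q in_cons (negbTE kj).
  move=> _; congr F; apply/funext => k; rewrite /mix /upd in_cons ffunE.
  by case: eqVneq => [->|//]; rewrite (negbTE jr).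
have := key (enum 'I_n) (fun=> 0) (enum_uniq _).
rewrite (_ : mix _ _ _ = fun=> s); last by apply/funext => j; rewrite /mix mem_enum.
move=> ->; apply: eq_big => [f|f _].
  by apply/familyP/familyP => h j; have := h j; rewrite /Q mem_enum.
by congr F; apply/funext => j; rewrite /mix mem_enum.
Qed.

End multilinear_expansion.

Section symmetric_tensors.
Context (R : realType) (V : lmodType R) (n : nat).
Local Notation tpow := (tpow V n).
Implicit Types (t : tpow) (v : 'I_n -> V) (s : 'S_n).

Lemma tperm_act_tens s v : tperm_act s (tens v) = tens (v \o s).
Proof. by rewrite /tperm_act tlift_tens//; exact: tperm_multilinear. Qed.

HB.instance Definition _ s :=
  GRing.isLinear.Build R tpow tpow _ (tperm_act s) (tperm_act_linear s).

HB.instance Definition _ :=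
  GRing.isLinear.Build R tpow tpow _ (@symmetrize R V n) (@symmetrize_linear R V n).

Lemma symmetrize_tens v :
  symmetrize (tens v) = (n`!%:R)^-1 *: \sum_(s : 'S_n) tens (v \o s).
Proof.
by rewrite /symmetrize; congr (_ *: _); apply: eq_bigr => s _; rewrite tperm_act_tens.
Qed.

Let fact_neq0 : n`!%:R != 0 :> R.
Proof. by rewrite pnatr_eq0 -lt0n fact_gt0. Qed.

Lemma symmetric_tensor_symmetrize t : symmetric_tensor t -> symmetrize t = t.
Proof.
move=> st; rewrite /symmetrize; under eq_bigr do rewrite st.
by rewrite sumr_const card_Sn -[t *+ _]scaler_nat scalerA mulVf// scale1r.
Qed.

Lemma tpow_linear_ext (W : lmodType R) (f g : {linear tpow -> W}) :
  (forall v, f (tens v) = g (tens v)) -> f =1 g.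
Proof.
move=> fg t; have [m [a [b [hb ->]]]] := tpow_tens t.
rewrite !linear_sum; apply: eq_bigr => i _; rewrite !linearZ.
by have [v _ <-] := hb i; rewrite fg.
Qed.

Lemma symmetrize_symmetric t : symmetric_tensor (symmetrize t).
Proof.
move=> s; apply: (tpow_linear_ext (f := tperm_act s \o @symmetrize R V n)) => v /=.
rewrite symmetrize_tens linearZ linear_sum /=; congr (_ *: _).
rewrite [RHS](reindex_inj (mulgI s)) /=; apply: eq_bigr => s' _.
rewrite tperm_act_tens; congr tens; apply/funext => j /=.
by rewrite permM.
Qed.

Lemma tens_cst_symmetric (p : V) : symmetric_tensor (tens (fun=> p) : tpow).
Proof. by move=> s; rewrite tperm_act_tens. Qed.

(** The inclusion-exclusion sign (-1)^(n - |S|), written as a product over slots so that a sum over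
    S factorizes. *)
Let subset_coef (S : {set 'I_n}) : R := \prod_(i < n) (if i \in S then 1 else -1).

(** The sum over all S containing the range of f is the product over i of 1 - [i outside the range].
    It detects surjectivity, which for a self-map of a finite set is injectivity. *)
Let sum_subset_coef (f : {ffun 'I_n -> 'I_n}) :
  \sum_(S : {set 'I_n} | f \in ffun_on (mem S)) subset_coef S = (injectiveb f)%:R.
Proof.
(* The side condition on S is absorbed into the factors: a point of the range missing from S
   contributes 0. *)
transitivity (\sum_(S in {set 'I_n}) \prod_(i < n)
    (if i \in S then 1 else - (i \notin codom f)%:R) : R).
  rewrite big_mkcond /=; apply: eq_bigr => S _; case: ifPn => [/ffun_onP fS|fS].
    apply: eq_bigr => i _; case: ifPn => // iS; case: codomP => [[j ij]|]; last by [].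
    by move: iS; rewrite ij fS.
  have [j fj] : exists j, f j \notin S.
    by apply/existsP; rewrite -negb_forall; apply: contraNN fS => /forallP h; apply/ffun_onP.
  by rewrite (bigD1 (f j))//= (negbTE fj) codom_f /= oppr0 mul0r.
rewrite -(@bigA_distr _ _ _ _ _ _ (fun=> 1) (fun i => - (i \notin codom f)%:R)).
have [injf|ninjf] := boolP (injectiveb f).
  apply: big1 => i _; have := (injF_bij (injectiveP _ injf)) => -[g _ gf].
  by rewrite -(gf i) codom_f /= oppr0 addr0.
have [i ni] : exists i, i \notin codom f.
  apply/existsP; rewrite -negb_forall; apply: contraNN ninjf => /forallP h.
  have e : #|codom f| == #|'I_n| by apply/eqP; apply: eq_card => i; rewrite h.
  by apply/injectiveP => x y; move/image_injP: e; apply.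
by rewrite (bigD1 i)//= ni subrr mul0r.
Qed.

(** Expand each diagonal tensor over functions f and exchange the sums: [sum_subset_coef] keeps only
    the permutations. *)
Lemma symmetrize_polarization v : symmetrize (tens v) = (n`!%:R)^-1 *:
  \sum_(S : {set 'I_n}) subset_coef S *: (tens (fun=> \sum_(i in S) v i) : tpow).
Proof.
rewrite symmetrize_tens; congr (_ *: _).
under [RHS]eq_bigr => S _.
  rewrite (multilinear_sum (@tens_multilinear _ _ _)) scaler_sumr.
  over.
rewrite [RHS](exchange_big_dep xpredT)//=.
under [RHS]eq_bigr do rewrite -scaler_suml sum_subset_coef.
rewrite [RHS](bigID (fun f : {ffun 'I_n -> 'I_n} => injectiveb f)) /= [X in _ + X]big1 ?addr0; last first.
  by move=> f /negbTE ->; rewrite scale0r.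
rewrite (reindex (fun s : 'S_n => pval s)) /=; last first.
  have s0 : 'S_n by exact: 1%g.
  exists (insubd s0) => /= [s _|f]; first by rewrite valKd.
  by rewrite inE => injf; rewrite insubdK.
apply: eq_big => [s|s _]; first by rewrite (valP s).
by rewrite (valP s) scale1r; congr tens; apply/funext => j; rewrite /= pvalE.
Qed.

(** The only way diagonal tensors are used later: a property stable under linear combinations has to
    be checked on them alone, where Wick powers are Hermite polynomials. *)
Lemma symmetric_tensor_ind (P : tpow -> Prop) :
  (forall a t u, P t -> P u -> P (a *: t + u)) ->
  (forall p : V, P (tens (fun=> p))) ->
  forall t, symmetric_tensor t -> P t.
Proof.
move=> Plin Pp t /symmetric_tensor_symmetrize <-.
have P0 : P 0 by have := Plin (-1) _ _ (Pp 0) (Pp 0); rewrite scaleN1r addNr.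
have PZ a u : P u -> P (a *: u) by move=> Pu; have := Plin a _ _ Pu P0; rewrite addr0.
have PD u u' : P u -> P u' -> P (u + u').
  by move=> Pu Pu'; have := Plin 1 _ _ Pu Pu'; rewrite scale1r.
have [m [a [b [hb ->]]]] := tpow_tens t.
rewrite [symmetrize _]linear_sum; apply: (big_ind P) => // i _; rewrite linearZ; apply: (PZ) => /=.
have [v _ <-] := hb i; rewrite symmetrize_polarization; apply: (PZ).
by apply: (big_ind P) => // S _; exact: PZ.
Qed.

End symmetric_tensors.

Lemma cvg_dist0 (R : realType) (V : normedModType R) (u : nat -> V) (x : V) :
  u n @[n --> \oo] --> x -> `|u n - x| @[n --> \oo] --> (0 : R).
Proof.
move=> /cvgrPdist_le ux; apply/cvgrPdist_le => e /ux[N _ h]; exists N => // n /h /=.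
by rewrite sub0r normrN normr_id distrC.
Qed.

(** * Inner products and Riesz representation *)

Section inner_product.
Context (R : realType) (V : prehilbertType R).
Implicit Types x y z : V.

Lemma innerBl x y z : inner (x - y) z = inner x z - inner y z.
Proof. by rewrite innerDl -scaleN1r innerZl mulN1r. Qed.

Lemma innerBr x y z : inner z (x - y) = inner z x - inner z y.
Proof. by rewrite innerC innerBl !(innerC z). Qed.

Lemma inner_ge0 x : 0 <= inner x x.
Proof. by rewrite inner_norm exprn_ge0. Qed.

Lemma inner_le_norm x y : `|inner x y| <= `|x| * `|y|.
Proof.
have q a : 0 <= `|x| ^+ 2 - 2 * a * inner x y + a ^+ 2 * `|y| ^+ 2.
  have := inner_ge0 (x - a *: y).
  rewrite innerBl !innerBr !innerZl !innerZr (innerC y x) !inner_norm.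
  by congr (0 <= _); ring.
have [y0|y0] := eqVneq `|y| 0.
  have := q ((`|x| ^+ 2 + 1) / (2 * inner x y)).
  have [->|xy0] := eqVneq (inner x y) 0; first by rewrite normr0 mulr_ge0.
  rewrite y0 expr0n mulr0 addr0.
  rewrite (_ : _ - _ = -1); last by field.
  by rewrite lerNr oppr0 ler10.
have yp : 0 < `|y| ^+ 2 by rewrite exprn_gt0// lt_def y0 normr_ge0.
have := q (inner x y / `|y| ^+ 2); rewrite -(pmulr_lge0 _ yp).
rewrite (_ : (_ + _) * _ = (`|x| * `|y|) ^+ 2 - inner x y ^+ 2); last by field.
rewrite subr_ge0 => h; rewrite -(@ler_pXn2r _ 2)// ?nnegrE ?mulr_ge0//.
by rewrite real_normK ?num_real.
Qed.

Lemma cvg_inner_seq (u v : nat -> V) x y :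
  u n @[n --> \oo] --> x -> v n @[n --> \oo] --> y ->
  inner (u n) (v n) @[n --> \oo] --> inner x y.
Proof.
move=> ux vy.
have e n : inner (u n) (v n) =
    inner x y + (inner (u n - x) (v n) + inner x (v n - y)).
  by rewrite innerBl innerBr; ring.
rewrite -[X in _ --> X]addr0; under eq_cvg do rewrite e.
apply: cvgD; first exact: cvg_cst.
apply/norm_cvg0P.
have b n : 0 <= `|inner (u n - x) (v n) + inner x (v n - y)| <=
    `|u n - x| * `|v n| + `|x| * `|v n - y|.
  rewrite normr_ge0 /=; apply: (le_trans (ler_normD _ _)).
  by apply: lerD; exact: inner_le_norm.
have lim : `|u n - x| * `|v n| + `|x| * `|v n - y| @[n --> \oo] -->
    0 * `|y| + `|x| * 0.
  apply: cvgD; apply: cvgM; [exact: cvg_dist0|exact: cvg_norm|exact: cvg_cst|exact: cvg_dist0].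
rewrite mul0r mulr0 addr0 in lim.
by apply: (squeeze_cvgr (nearW _ b)) lim; exact: cvg_cst.
Qed.

End inner_product.

Section riesz.
Context (R : realType) (H : hilbertType R).

Lemma hilbert_cauchy_cvg (u : nat -> H) :
  (forall e : R, 0 < e -> exists N : nat, forall m n, (N <= m)%N -> (N <= n)%N ->
    `|u m - u n| < e) -> cvgn u.
Proof.
move=> h; apply: cauchy_cvg; apply/cauchy_ballP => e e0.
have [N hN] := h _ e0; pose S := u @` [set n | (N <= n)%N].
exists (S, S) => [|[_ _] /= [[m mm <-] [n nn <-]]].
  by split; exists N => // k /= Nk; exists k.
by rewrite -ball_normE /=; exact: hN.
Qed.

Lemma parallelogram (x y : H) : `|x - y| ^+ 2 = 2 * `|x| ^+ 2 + 2 * `|y| ^+ 2 - `|x + y| ^+ 2.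
Proof.
rewrite -!inner_norm innerBl !innerBr !(innerDl, innerDr) (innerC y x); ring.
Qed.

(* f minimizes |j w|^2 / 2 - l w. *)
Lemma riesz_representation (W : lmodType R) (j : {linear W -> H}) (l : {scalar W}) (C : R) :
  (forall w, `|l w| <= C * `|j w|) ->
  exists f : H, (exists u : nat -> W, j (u n) @[n --> \oo] --> f) /\
    forall w, l w = inner f (j w).
Proof.
move=> lC; pose Q w : R := `|j w| ^+ 2 / 2 - l w.
have Qlb w : - (C ^+ 2 / 2) <= Q w.
  have := lC w; have := ler_norm (l w); have := sqr_ge0 (`|j w| - C).
  rewrite /Q sqrrB; lra.
have hinf : has_inf (range Q).
  by split; [exists (Q 0), 0|exists (- (C ^+ 2 / 2)) => _ [w _ <-]].
have [m mQ minf] : exists2 m : R, forall w, m <= Q w &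
    forall e, 0 < e -> exists w, Q w < m + e.
  exists (inf (range Q)) => [w|e e0]; first by apply: ge_inf; [case: hinf|exists w].
  by have [_ [w _ <-] hw] := inf_adherent e0 hinf; exists w.
have /choice[u uQ] n : exists w, Q w < m + n.+1%:R^-1.
  by apply: minf; rewrite invr_gt0.
(* The parallelogram identity at the midpoint, where Q is still at least m, makes every minimizing
   sequence Cauchy. *)
have uv w w' : `|j w - j w'| ^+ 2 <= 4 * ((Q w - m) + (Q w' - m)).
  have jE : j (2^-1 *: (w + w')) = 2^-1 *: (j w + j w') by rewrite linearZ linearD.
  have lE : l (2^-1 *: (w + w')) = 2^-1 * (l w + l w') by rewrite linearZ linearD.
  have := mQ (2^-1 *: (w + w')); rewrite parallelogram /Q jE lE normrZ exprMn ger0_norm//.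
  by move: (`|_ + _| ^+ 2) => z; rewrite expr2 => h; lra.
have cu : cvgn (fun n => j (u n)).
  apply: hilbert_cauchy_cvg => e e0.
  have e2 : 0 < e ^+ 2 / 8 by rewrite divr_gt0// exprn_gt0.
  have /cvgrPdist_lt/(_ _ e2)[N _ hN] := @cvg_natSV R.
  have small k : (N <= k)%N -> k.+1%:R^-1 < e ^+ 2 / 8.
    by move=> /hN /=; rewrite sub0r normrN ger0_norm ?invr_ge0.
  exists N => n n' hn hn'.
  suff : `|j (u n) - j (u n')| ^+ 2 < e ^+ 2 by rewrite ltr_pXn2r ?nnegrE// ltW.
  apply: (le_lt_trans (uv _ _)).
  have Qs k : (N <= k)%N -> Q (u k) < m + e ^+ 2 / 8.
    by move=> hk; apply: (lt_trans (uQ k)); rewrite ltrD2l small.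
  move: (Qs _ hn) (Qs _ hn'); move: (Q (u n)) (Q (u n')) => a b.
  by lra.
have [f uf] := (cvg_ex _).1 cu.
exists f; split; first by exists u.
move=> w; set s := inner f (j w) - l w; set b := `|j w| ^+ 2.
suff var t : 0 <= t * s + t ^+ 2 * b / 2.
  have b0 : 0 <= b by rewrite exprn_ge0.
  have bp : 0 < b + 1 by lra.
  (* A negative value of t s + t^2 b / 2 unless s = 0; the added 1 covers j w = 0. *)
  have := var (- s / (b + 1)).
  rewrite (_ : _ + _ = - (s ^+ 2 * (b + 2) / (2 * (b + 1) ^+ 2))); last by field; lra.
  rewrite oppr_ge0 => h; have s0 : s ^+ 2 <= 0.
    have p : 0 < (b + 2) / (2 * (b + 1) ^+ 2) by rewrite divr_gt0 ?mulr_gt0 ?exprn_gt0//; lra.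
    by rewrite -(pmulr_lle0 _ p) mulrA.
  have /eqP : s ^+ 2 = 0 by apply/eqP; rewrite eq_le s0 sqr_ge0.
  by rewrite sqrf_eq0 /s subr_eq0 => /eqP.
(* The minimum need not be attained in W, so the variation is made at u n, whose defect below
   1/(n+1) disappears in the limit. *)
have lim : (n.+1%:R^-1 + (t * (inner (j (u n)) (j w) - l w) + t ^+ 2 * b / 2))
    @[n --> \oo] --> 0 + (t * s + t ^+ 2 * b / 2).
  apply: cvgD; first exact: cvg_natSV.
  apply: cvgD; last exact: cvg_cst.
  apply: cvgM; first exact: cvg_cst.
  apply: cvgB; last exact: cvg_cst.
  by apply: cvg_inner_seq => //; exact: cvg_cst.
rewrite -[X in 0 <= X]add0r; have /cvg_lim <- // := lim.
apply: limr_ge; first by apply/cvg_ex; eexists; exact: lim.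
apply: nearW => n.
have jE : j (u n + t *: w) = j (u n) + t *: j w by rewrite linearD linearZ.
have lE : l (u n + t *: w) = l (u n) + t * l w by rewrite linearD linearZ.
have nE : `|j (u n) + t *: j w| ^+ 2 =
    `|j (u n)| ^+ 2 + 2 * (t * inner (j (u n)) (j w)) + t ^+ 2 * b.
  rewrite -inner_norm !(innerDl, innerDr, innerZl, innerZr) (innerC (j w)) !inner_norm.
  by rewrite /b; ring.
have := mQ (u n + t *: w); have := uQ n; rewrite /Q jE lE nE mulrBr.
move: (t * inner _ _) (t * l w) (t ^+ 2 * b) (`|j (u n)| ^+ 2) (l (u n)) (n.+1%:R^-1).
by move=> *; lra.
Qed.

End riesz.

(** * Wick powers, Hermite polynomials and the isometry on symmetric tensors *)

Section wick_hermite.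
Context (R : realType) (N : gelfand_triple R) (A : {linear ell2 (H0 N) -> ell2 (H0 N)}).

Definition coordX (phi : sN N) (w : msdual N) : R := (w : sdual N) phi.

Definition covA (phi psi : sN N) : R := formA A phi psi.

(** A diagonal tensor is fixed by symmetrization, so the recursion of [wick] becomes on it the
    scalar recursion of [hermite]. *)
Lemma sym_tensor_prod_cst (p q : nat) (V : lmodType R)
    (F : tpow V p -> R) (G : tpow V q -> R) (x : V) :
  linear (F : _ -> R^o) -> linear (G : _ -> R^o) ->
  sym_tensor_prod F G (tens (fun=> x)) = F (tens (fun=> x)) * G (tens (fun=> x)).
Proof.
move=> lF lG; rewrite /sym_tensor_prod symmetric_tensor_symmetrize; last exact: tens_cst_symmetric.
rewrite tlift_tens// => v i b y z /=.
case: (split_ordP i) => k -> {i}.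
  have updl u : (fun i => upd v (lshift q k) u (lshift q i)) =
      upd (fun i => v (lshift q i)) k u.
    by apply/funext => j; rewrite /upd eq_shift.
  have updr u : (fun j => upd v (lshift q k) u (rshift p j)) =
      (fun j => v (rshift p j)).
    by apply/funext => j; rewrite /upd eq_shift.
  by rewrite !updl !updr tens_multilinear lF mulrDl scalerAl.
have updl u : (fun i => upd v (rshift p k) u (lshift q i)) = (fun i => v (lshift q i)).
  by apply/funext => j; rewrite /upd eq_shift.
have updr u : (fun j => upd v (rshift p k) u (rshift p j)) =
    upd (fun j => v (rshift p j)) k u.
  by apply/funext => j; rewrite /upd eq_shift.
by rewrite !updl !updr tens_multilinear lG mulrDr -scalerAr.
Qed.

Lemma tauA_multilinear :
  multilinear (fun v : 'I_2 -> sN N => formA A (v ord0) (v ord_max) : R^o).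
Proof.
move=> v i a x y; rewrite /formA /upd.
have o2 : ((ord0 : 'I_2) == ord_max) = false by [].
have [->|->] : i = ord0 \/ i = ord_max.
  by case: i => -[|[|//]] h; [left|right]; apply: val_inj.
  by rewrite eqxx [_ == ord0]eq_sym o2 /= innerPl.
by rewrite eqxx o2 /= linearP/= innerDr innerZr.
Qed.

Lemma wick_hermite (w : msdual N) n (phi : sN N) :
  wick A w (tens (fun=> phi) : tpow (sN N) n) = hermite coordX covA n phi w.
Proof.
have l1 : linear (pair1 w : _ -> R^o) := @wick_linear _ _ A w 1.
have l2 : linear (tauA A : _ -> R^o) by apply: tlift_linear; exact: tauA_multilinear.
elim/ltn_ind: n => -[|[|n]] IH; [exact: wick0|exact: wick1|].
rewrite wickSS hermiteSS.
rewrite (@sym_tensor_prod_cst 1 n.+1)//; last exact: wick_linear.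
rewrite (@sym_tensor_prod_cst 2 n)//; last exact: wick_linear.
have p1 : pair1 w (tens (fun=> phi)) = coordX phi w by exact: (@wick1 _ _ A w (fun=> phi)).
rewrite !IH// p1 /tauA tlift_tens ?mulrA//.
exact: tauA_multilinear.
Qed.

Hypothesis A_self_adjoint : self_adjoint A.
Variable mu : probability (msdual N) R.
Hypothesis mu_A : is_muA A mu.

Lemma gaussian_family_muA : gaussian_family mu coordX covA.
Proof.
split.
- move=> phi _ B mB; rewrite setTI; apply: sub_sigma_algebra.
  by exists phi => //; exists B => //; rewrite setTI.
- by move=> a p q w; rewrite /coordX linearP.
- by move=> p q; rewrite /covA /formA innerC A_self_adjoint.
- by move=> a p q r; rewrite /covA /formA -innerPl.
- by move=> phi; have [] := mu_A phi.
- by move=> phi; have [] := mu_A phi.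
Qed.

Lemma all_moments_wick n (t : tpow (sN N) n) : symmetric_tensor t ->
  all_moments mu (fun w => wick A w t).
Proof.
apply: (symmetric_tensor_ind (P := fun t => all_moments mu (fun w => wick A w t))).
- move=> a u v hu hv; rewrite (_ : (fun w => _) = fun w => a * wick A w u + wick A w v); last first.
    by apply/funext => w; rewrite (wick_linear A w).
  by apply: all_momentsD => //; apply: all_momentsM => //; exact: all_moments_cst.
- move=> phi; rewrite (_ : (fun w => _) = hermite coordX covA n phi); last first.
    by apply/funext => w; rewrite -wick_hermite.
  exact: (all_moments_polyX gaussian_family_muA (polyX_hermite _ _ _ _)).
Qed.

Context (K : completion (formA A)).

Section tensor_power_map.
Context (n : nat) (T : hilbert_tensor_power K n).

Lemma tpow_to_htpow_multilinear :
  multilinear (fun v : 'I_n -> sN N => htens T (fun i => to_completion K (v i))).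
Proof.
have updE (v : 'I_n -> sN N) i x : (fun j => to_completion K (upd v i x j)) =
    upd (fun j => to_completion K (v j)) i (to_completion K x).
  by apply/funext => j; rewrite /upd; case: eqP.
by move=> v i a x y; rewrite !updE /= linearP htens_multilinear.
Qed.

Lemma tpow_to_htpow_linear : linear (tpow_to_htpow T).
Proof. exact/tlift_linear/tpow_to_htpow_multilinear. Qed.

HB.instance Definition _ :=
  GRing.isLinear.Build R (tpow (sN N) n) T _ (tpow_to_htpow T) tpow_to_htpow_linear.

Lemma tpow_to_htpow_cst (phi : sN N) :
  tpow_to_htpow T (tens (fun=> phi)) = htens T (fun=> to_completion K phi).
Proof. by rewrite /tpow_to_htpow tlift_tens//; exact: tpow_to_htpow_multilinear. Qed.

Lemma inner_htens_cst (x y : K) :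
  inner (htens T (fun=> x)) (htens T (fun=> y)) = inner x y ^+ n.
Proof. by rewrite inner_htens prodr_const card_ord. Qed.

End tensor_power_map.

Lemma L2_wick n (t : tpow (sN N) n) : symmetric_tensor t -> L2 mu (fun w => wick A w t).
Proof. by move=> st; apply: all_moments_L2; exact: all_moments_wick. Qed.

Lemma symmetric_tensor_linear n a (s t : tpow (sN N) n) :
  symmetric_tensor s -> symmetric_tensor t -> symmetric_tensor (a *: s + t).
Proof. by move=> ss st r; rewrite tperm_act_linear ss st. Qed.

Lemma ip_wickl n a (s t : tpow (sN N) n) h : symmetric_tensor s -> symmetric_tensor t ->
  L2 mu h -> ip mu (fun w => wick A w (a *: s + t)) h =
    a * ip mu (fun w => wick A w s) h + ip mu (fun w => wick A w t) h.
Proof.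
move=> ss st Lh; have Ls := L2_wick ss; have Lt := L2_wick st.
rewrite (_ : (fun w => _) = fun w => a * wick A w s + wick A w t); last first.
  by apply/funext => w; rewrite (wick_linear A w).
by rewrite ipDl ?ipZl//; exact: L2Z.
Qed.

Lemma ip_wick n (Tn : hilbert_tensor_power K n) (s t : tpow (sN N) n) :
  symmetric_tensor s -> symmetric_tensor t ->
  ip mu (fun w => wick A w s) (fun w => wick A w t) =
  n`!%:R * inner (tpow_to_htpow Tn s) (tpow_to_htpow Tn t).
Proof.
have GF := gaussian_family_muA.
(* [step] reduces the first argument to a diagonal tensor. It is applied twice, the second time
   after swapping arguments, which leaves two Hermite polynomials. *)
have step (u : tpow (sN N) n) : symmetric_tensor u -> (forall p,
    ip mu (hermite coordX covA n p) (fun w => wick A w u) =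
    n`!%:R * inner (htens Tn (fun=> to_completion K p)) (tpow_to_htpow Tn u)) ->
    forall s, symmetric_tensor s -> ip mu (fun w => wick A w s) (fun w => wick A w u) =
    n`!%:R * inner (tpow_to_htpow Tn s) (tpow_to_htpow Tn u).
  move=> su hu s' ss'; suff [] : symmetric_tensor s' /\
    ip mu (fun w => wick A w s') (fun w => wick A w u) =
    n`!%:R * inner (tpow_to_htpow Tn s') (tpow_to_htpow Tn u) by [].
  move: s' ss'; apply: symmetric_tensor_ind => [a x y [sx hx] [sy hy]|p].
    split; first exact: symmetric_tensor_linear.
    rewrite ip_wickl ?hx ?hy//; last exact: L2_wick.
    by rewrite tpow_to_htpow_linear innerPl; ring.
  split; first exact: tens_cst_symmetric.
  rewrite tpow_to_htpow_cst -hu; congr (ip mu _ _).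
  by apply/funext => w; rewrite wick_hermite.
move=> ss st; apply: (step) => // p.
have hE k q : hermite coordX covA k q = fun w => wick A w (tens (fun=> q) : tpow (sN N) k).
  by apply/funext => w; rewrite -wick_hermite.
rewrite -(tpow_to_htpow_cst Tn) hE ipC innerC; apply: step => // [|q]; first exact: tens_cst_symmetric.
rewrite -hE (ip_hermite GF) eqxx mul1r tpow_to_htpow_cst inner_htens_cst.
by rewrite inner_to_completion.
Qed.

Lemma ip_wick_neq n m (s : tpow (sN N) n) (t : tpow (sN N) m) :
  symmetric_tensor s -> symmetric_tensor t -> n != m ->
  ip mu (fun w => wick A w s) (fun w => wick A w t) = 0.
Proof.
have GF := gaussian_family_muA.
have step k l (u : tpow (sN N) l) : symmetric_tensor u -> (forall p,
    ip mu (hermite coordX covA k p) (fun w => wick A w u) = 0) ->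
    forall s : tpow (sN N) k, symmetric_tensor s ->
    ip mu (fun w => wick A w s) (fun w => wick A w u) = 0.
  move=> su hu s' ss'; suff [] : symmetric_tensor s' /\
    ip mu (fun w => wick A w s') (fun w => wick A w u) = 0 by [].
  move: s' ss'; apply: symmetric_tensor_ind => [a x y [sx hx] [sy hy]|p].
    split; first exact: symmetric_tensor_linear.
    by rewrite ip_wickl ?hx ?hy ?mulr0 ?addr0//; exact: L2_wick.
  split; first exact: tens_cst_symmetric.
  by rewrite -(hu p); congr (ip mu _ _); apply/funext => w; rewrite wick_hermite.
move=> ss st nm; apply: (step) => // p.
have hE k q : hermite coordX covA k q = fun w => wick A w (tens (fun=> q) : tpow (sN N) k).
  by apply/funext => w; rewrite -wick_hermite.
rewrite hE ipC; apply: step => // [|q]; first exact: tens_cst_symmetric.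
by rewrite -hE (ip_hermite GF) eq_sym (negbTE nm) !mul0r.
Qed.

End wick_hermite.

(** * Density of s(N) and of its symmetric tensors *)

Section approximation.
Context (R : realType).

Lemma cvg_of_approx (V : normedModType R) (W : Type) (P : W -> Prop) (j : W -> V) (x : V) :
  (forall e : R, 0 < e -> exists2 w, P w & `|x - j w| < e) ->
  exists2 u : nat -> W, (forall k, P (u k)) & j (u k) @[k --> \oo] --> x.
Proof.
move=> h; have /choice[u uP] k : exists w, P w /\ `|x - j w| < k.+1%:R^-1.
  by have [|w Pw xw] := h k.+1%:R^-1; [rewrite invr_gt0|exists w].
exists u => [k|]; first by case: (uP k).
apply/cvgrPdist_lt => e e0; near=> k.
have [_ /lt_trans] := uP k; apply; near: k; exact: near_infty_natSinv_lt (PosNum e0).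
Unshelve. all: by end_near. Qed.

Lemma closure_approx (V : normedModType R) (B : set V) (x : V) :
  closure B x -> forall e : R, 0 < e -> exists2 y, B y & `|x - y| < e.
Proof.
move=> cl e e0; have [y [By]] := cl _ (nbhsx_ballx x e e0).
by rewrite -ball_normE /= => xy; exists y.
Qed.

Lemma dense_approx (V : normedModType R) (B : set V) : dense B ->
  forall (x : V) (e : R), 0 < e -> exists2 y, B y & `|x - y| < e.
Proof.
move=> dB x e e0; have [||y [xy By]] := dB (ball x e).
- by exists x; exact: ballxx.
- exact: ball_open.
by exists y => //; move: xy; rewrite -ball_normE.
Qed.

Lemma closure_cvg (V : normedModType R) (B : set V) (u : nat -> V) (x : V) :
  (forall k, closure B (u k)) -> u k @[k --> \oo] --> x -> closure B x.
Proof.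
move=> uB ux; apply: (@closed_cvg _ _ \oo _ u (closure B)) ux; last exact: nearW.
exact: closed_closure.
Qed.

Lemma cvg_bigsum (V : normedModType R) (I : Type) (s : seq I) (F : I -> nat -> V) (l : I -> V) :
  (forall i, F i k @[k --> \oo] --> l i) ->
  \sum_(i <- s) F i k @[k --> \oo] --> \sum_(i <- s) l i.
Proof.
move=> Fl; elim: s => [|i s IH].
  by rewrite big_nil; under eq_cvg do rewrite big_nil; exact: cvg_cst.
by rewrite big_cons; under eq_cvg do rewrite big_cons; apply: cvgD.
Qed.

Lemma lspan_mem (V : lmodType R) (B : set V) x : B x -> lspan B x.
Proof.
by move=> Bx; exists 1%N, (fun=> 1), (fun=> x); split => //; rewrite big_ord1 scale1r.
Qed.

Lemma lspan_linear (V : lmodType R) (B : set V) (a : R) x y :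
  lspan B x -> lspan B y -> lspan B (a *: x + y).
Proof.
move=> [n [c [b [Bb ->]]]] [m [c' [b' [Bb' ->]]]].
exists (n + m)%N, (fun i => match fintype.split i with inl j => a * c j | inr k => c' k end),
  (fun i => match fintype.split i with inl j => b j | inr k => b' k end); split.
  by move=> i; case: (fintype.split i).
rewrite big_split_ord scaler_sumr /=; congr (_ + _); apply: eq_bigr => i _.
  by rewrite (unsplitK (inl i)) scalerA.
by rewrite (unsplitK (inr i)).
Qed.

Lemma series_finite_cvg (u : nat -> R) m : (forall k, (m <= k)%N -> u k = 0) ->
  cvgn (series u).
Proof.
move=> u0; apply/cvg_ex; exists (series u m); apply: cvg_near_cst.
exists m => // n /= mn; rewrite /series /= (big_cat_nat (n := m))//=.
rewrite [X in _ + X]big1_seq ?addr0// => k; rewrite mem_index_iota => /andP[_ /andP[mk _]].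
exact: u0.
Qed.

Lemma sqsummable_finite (H : prehilbertType R) (f : nat -> H) m :
  (forall k, (m <= k)%N -> f k = 0) -> sqsummable f.
Proof. by move=> f0; apply: (@series_finite_cvg _ m) => k /f0 ->; rewrite normr0 expr0n. Qed.

Lemma ell2_norm_sqr (H : prehilbertType R) (f : ell2 H) :
  `|f| ^+ 2 = limn (series (fun k => `|f k| ^+ 2)).
Proof.
rewrite -inner_norm [LHS]/(ell2_inner f f) /ell2_inner; congr (limn (series _)).
by apply/funext => k; rewrite inner_norm.
Qed.

Lemma ell2_norm_sqr_le (H : prehilbertType R) (f : ell2 H) (C : R) :
  (\forall n \near \oo, \sum_(0 <= k < n) `|f k| ^+ 2 <= C) -> `|f| ^+ 2 <= C.
Proof. by move=> h; rewrite ell2_norm_sqr; apply: limr_le => //; exact: ell2P. Qed.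

Variable N : gelfand_triple R.

Lemma sN_dense (f : ell2 (H0 N)) (e : R) : 0 < e ->
  exists phi : sN N, `|f - (phi : ell2 (H0 N))| < e.
Proof.
(* The squared error has two parts of size at most D: a tail of f, and the errors D 2^-(k+1) allowed
   in the remaining coordinates. *)
move=> e0; pose D := e ^+ 2 / 4.
have D0 : 0 < D by rewrite divr_gt0// exprn_gt0.
pose r k : R := Num.sqrt (D * 2^-1 ^+ k.+1).
have r0 k : 0 < r k by rewrite sqrtr_gt0 mulr_gt0// exprn_gt0// invr_gt0.
have /choice[x xP] k : exists x, `|f k - to_completion (hilb N 0) x| < r k.
  have [_ [x _ <-] fx] := dense_approx (@dense_completion _ _ _ (hilb N 0)) (f k) (r0 k).
  by exists x.
have [m tail] : exists m, forall n, (m <= n)%N -> \sum_(m <= k < n) `|f k| ^+ 2 < D.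
  have /cvg_ex[l /cvgrPdist_lt/(_ (D / 2))] := @ell2P _ _ f.
  rewrite divr_gt0// => /(_ isT)[m _ h]; exists m => n mn.
  have := h _ mn; have := h _ (leqnn m); rewrite /= /series /=.
  rewrite (big_cat_nat (n := m) (m := 0%N) (p := n))//=.
  move: (\sum_(0 <= k < m) _) (\sum_(m <= k < n) _) => a b.
  by rewrite !ltr_norml => /andP[? ?] /andP[? ?]; lra.
(* The same finite sequence of vectors of the nuclear space, read in each N_p; being finite it
   satisfies every summability condition of s(N). *)
pose g p k := if (k < m)%N then to_completion (hilb N p) (x k) else 0.
have g0 p k : (m <= k)%N -> g p k = 0 by rewrite /g ltnNge => ->.
have sg0 : g 0%N \in @sqsummable_pred R (H0 N).
  by apply/asboolP; apply: sqsummable_finite (@g0 0%N).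
pose G : ell2 (H0 N) := Ell2 sg0.
have sG : G \in @sN_pred R N.
  apply/asboolP => p; exists (g p).
    apply: (@series_finite_cvg _ m) => k /(g0 p) ->.
    by rewrite normr0 expr0n mulr0.
  by move=> k; rewrite /G /= /g; case: ifP => _; rewrite ?linear0// inclH_nucl.
exists (SN sG) => /=.
suff : `|f - G| ^+ 2 < e ^+ 2 by rewrite ltr_pXn2r ?nnegrE// ltW.
apply: (@le_lt_trans _ _ (2 * D)); last first.
  have : 0 < e ^+ 2 by rewrite exprn_gt0.
  by rewrite /D; move: (e ^+ 2) => z z0; lra.
apply: ell2_norm_sqr_le; exists m => // n /= mn.
rewrite (big_cat_nat (n := m))//= mulr_natl mulr2n; apply: lerD.
  apply: (@le_trans _ _ (\sum_(0 <= k < m) D * 2^-1 ^+ k.+1)).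
    rewrite [leLHS]big_nat_cond [leRHS]big_nat_cond; apply: ler_sum => k /andP[/andP[_ km] _].
    rewrite -[X in `|X|]/(f k - g 0%N k) /g km; have := xP k.
    have h : 0 <= D * 2^-1 ^+ k.+1 by rewrite mulr_ge0 ?exprn_ge0 ?invr_ge0// ltW.
    by rewrite -[leRHS](sqr_sqrtr h) => fx; rewrite lerXn2r ?nnegrE ?sqrtr_ge0// ltW.
  rewrite -mulr_sumr ler_piMr ?(ltW D0)//.
  have E k : \sum_(0 <= i < k) (2^-1 : R) ^+ i.+1 = 1 - 2^-1 ^+ k.
    elim: k => [|k IH]; first by rewrite big_geq// expr0 subrr.
    by rewrite big_nat_recr//= IH [in RHS]exprS exprS; field.
  by rewrite E gerBl exprn_ge0// invr_ge0.
apply: (le_trans _ (ltW (tail _ mn))).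
rewrite [leLHS]big_nat_cond [leRHS]big_nat_cond; apply: ler_sum => k /andP[/andP[mk _] _].
by rewrite -[X in `|X| ^+ 2 <= _]/(f k - g 0%N k) g0// subr0.
Qed.

End approximation.

Section completion_density.
Context (R : realType) (N : gelfand_triple R) (A : {linear ell2 (H0 N) -> ell2 (H0 N)}).
Hypothesis A_continuous : continuous A.
Context (K : completion (formA A)).

(** Continuity of A enters here: the squared A-norm of v is (v, A v), and both entries tend to 0. *)
Lemma to_completion_cvg (u : nat -> ell2 (H0 N)) f : u k @[k --> \oo] --> f ->
  to_completion K (u k) @[k --> \oo] --> to_completion K f.
Proof.
move=> uf; pose v k := f - u k.
have v0 : v k @[k --> \oo] --> (0 : ell2 (H0 N)).
  by rewrite -(subrr f); apply: cvgB => //; exact: cvg_cst.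
have Av : A (v k) @[k --> \oo] --> (0 : ell2 (H0 N)).
  by rewrite -(linear0 A); apply: continuous_cvg v0; exact: A_continuous.
have n0 : `|to_completion K (v k)| ^+ 2 @[k --> \oo] --> (0 : R).
  have := cvg_inner_seq v0 Av; rewrite inner0l.
  by under eq_cvg do rewrite -[inner _ _]/(formA A _ _) -(inner_to_completion K) inner_norm.
apply/cvgrPdist_lt => e e0; have e2 : 0 < e ^+ 2 by rewrite exprn_gt0.
have /cvgrPdist_lt/(_ _ e2)[m _ h] := n0; exists m => // k /h /=.
rewrite sub0r normrN ger0_norm ?exprn_ge0// /v linearB => h2.
by rewrite -(@ltr_pXn2r _ 2)// ?nnegrE// ltW.
Qed.

Lemma dense_sN_completion (x : K) (e : R) : 0 < e ->
  exists phi : sN N, `|x - to_completion K phi| < e.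
Proof.
move=> e0; have e2 : 0 < e / 2 by rewrite divr_gt0.
have [_ [f _ <-] xf] := dense_approx (@dense_completion _ _ _ K) x e2.
have [u _ uf] := @cvg_of_approx _ _ _ (fun=> True) (@sN_val R N) f
  (fun e e0 => let: ex_intro phi h := sN_dense f e0 in ex_intro2 _ _ phi Logic.I h).
have /cvgrPdist_lt/(_ _ e2)[m _ /(_ m (leqnn m))] := to_completion_cvg uf.
move=> /= fu; exists (u m).
rewrite -(subrKA (to_completion K f)) (le_lt_trans (ler_normD _ _))//.
by rewrite [ltRHS]splitr ltrD.
Qed.

Context (n : nat) (Tn : hilbert_tensor_power K n).

(** The squared distance of two n-th powers is a polynomial in inner products of K, hence
    continuous. *)
Lemma htens_cst_cvg (u : nat -> K) x : u k @[k --> \oo] --> x ->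
  htens Tn (fun=> u k) @[k --> \oo] --> htens Tn (fun=> x).
Proof.
move=> ux; pose h (y : K) := htens Tn (fun=> y).
have n0 : `|h x - h (u k)| ^+ 2 @[k --> \oo] --> (0 : R).
  have E k : `|h x - h (u k)| ^+ 2 =
      inner x x ^+ n - 2 * inner x (u k) ^+ n + inner (u k) (u k) ^+ n.
    by rewrite -inner_norm innerBl !innerBr (innerC (h (u k)) (h x)) !inner_htens_cst; ring.
  have lim : inner x x ^+ n - 2 * inner x (u k) ^+ n + inner (u k) (u k) ^+ n
      @[k --> \oo] --> inner x x ^+ n - 2 * inner x x ^+ n + inner x x ^+ n.
    apply: cvgD; last by apply: cvg_exprn; exact: cvg_inner_seq.
    apply: cvgB; first exact: cvg_cst.
    apply: cvgM; first exact: cvg_cst.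
    by apply: cvg_exprn; apply: cvg_inner_seq => //; exact: cvg_cst.
  rewrite (_ : _ + _ = 0) in lim; last by ring.
  by under eq_cvg do rewrite E; exact: lim.
apply/cvgrPdist_lt => e e0; have e2 : 0 < e ^+ 2 by rewrite exprn_gt0.
have /cvgrPdist_lt/(_ _ e2)[m _ hm] := n0; exists m => // k /hm /=.
rewrite sub0r normrN ger0_norm ?exprn_ge0// => h2.
by rewrite -(@ltr_pXn2r _ 2)// ?nnegrE// ltW.
Qed.

(** A finite combination of powers of vectors of K is first chosen near f, then each vector is
    approximated from s(N). *)
Lemma sym_htpow_approx (f : Tn) : sym_htpow Tn f ->
  exists2 phi : nat -> tpow (sN N) n, forall k, symmetric_tensor (phi k) &
    tpow_to_htpow Tn (phi k) @[k --> \oo] --> f.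
Proof.
move=> symf; apply: cvg_of_approx => e e0.
have e2 : 0 < e / 2 by rewrite divr_gt0.
have [y [m [a [b [hb ->]]]] fy] := closure_approx symf e2.
suff [t st ht] : exists2 t, symmetric_tensor t &
    `|\sum_(i < m) a i *: b i - tpow_to_htpow Tn t| < e / 2.
  exists t => //; rewrite -(subrKA (\sum_(i < m) a i *: b i)).
  by rewrite (le_lt_trans (ler_normD _ _))// [ltRHS]splitr ltrD.
have /choice[u uP] i : exists u : nat -> sN N,
    htens Tn (fun=> to_completion K (u k)) @[k --> \oo] --> b i.
  have [x _ <-] := hb i.
  have [u _ ux] := @cvg_of_approx _ _ _ (fun=> True) (fun phi : sN N => to_completion K phi) x
    (fun e e0 => let: ex_intro phi h := dense_sN_completion x e0 in ex_intro2 _ _ phi Logic.I h).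
  by exists u; exact: htens_cst_cvg.
pose t k : tpow (sN N) n := \sum_(i < m) a i *: tens (fun=> u i k).
have st k : symmetric_tensor (t k).
  move=> s; rewrite /t linear_sum; apply: eq_bigr => i _.
  by rewrite linearZ /= tens_cst_symmetric.
have lim : tpow_to_htpow Tn (t k) @[k --> \oo] --> \sum_(i < m) a i *: b i.
  have E k : tpow_to_htpow Tn (t k) =
      \sum_(i < m) a i *: htens Tn (fun=> to_completion K (u i k)).
    by rewrite /t linear_sum; apply: eq_bigr => i _; rewrite linearZ /= tpow_to_htpow_cst.
  under eq_cvg do rewrite E.
  by apply: cvg_bigsum => i; apply: cvgZl_tmp; exact: uP.
have /cvgrPdist_lt/(_ _ e2)[k _ /(_ k (leqnn k)) h] := lim.
by exists (t k).
Qed.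

Lemma sym_htpow_tpow (t : tpow (sN N) n) : symmetric_tensor t -> sym_htpow Tn (tpow_to_htpow Tn t).
Proof.
move=> st; apply: subset_closure.
apply: (symmetric_tensor_ind (P := fun t => lspan _ (tpow_to_htpow Tn t))) st => [a x y|p].
  by rewrite tpow_to_htpow_linear; exact: lspan_linear.
by rewrite tpow_to_htpow_cst; apply: lspan_mem; exists (to_completion K p).
Qed.

Lemma sym_htpow_cvg (t : nat -> tpow (sN N) n) (f : Tn) :
  (forall k, symmetric_tensor (t k)) -> tpow_to_htpow Tn (t k) @[k --> \oo] --> f ->
  sym_htpow Tn f.
Proof. by move=> st; apply: closure_cvg => k; exact: sym_htpow_tpow. Qed.

End completion_density.

(** * Wick powers of Hilbert space tensors *)

Section L2_limits.
Context d (X : measurableType d) (R : realType) (mu : probability X R).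
Local Notation L2 := (L2 mu).
Local Notation ip := (ip mu).

Lemma ip_sqrD_le f g h : L2 f -> L2 g -> L2 h ->
  ip (fun x => f x - h x) (fun x => f x - h x) <=
  2 * ip (fun x => f x - g x) (fun x => f x - g x) +
  2 * ip (fun x => g x - h x) (fun x => g x - h x).
Proof.
move=> Lf Lg Lh.
have L u v : L2 u -> L2 v -> L2 (fun x => u x - v x) by exact: L2B.
have LL u v : L2 u -> L2 v -> intg mu (fun x => (u x - v x) * (u x - v x)).
  by move=> Lu Lv; apply: L2_mul; exact: L.
rewrite /ip -!EZ -?ED; [|exact: intgZ (LL _ _ _ _)..|exact: LL|exact: LL].
apply: le_E => [||x]; [exact: LL|by apply: intgD; apply: intgZ; exact: LL|].
have := sqr_ge0 ((f x - g x) - (g x - h x)); rewrite -!expr2.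
by move: (f x) (g x) (h x) => a b c; rewrite !expr2; nra.
Qed.

Lemma ip_cvgl (F : nat -> X -> R) f h : (forall n, L2 (F n)) -> L2 f -> L2 h ->
  ip (fun x => F n x - f x) (fun x => F n x - f x) @[n --> \oo] --> (0 : R) ->
  ip (F n) h @[n --> \oo] --> ip f h.
Proof.
move=> LF Lf Lh Ff.
have z : ip (fun x => F n x - f x) (fun x => F n x - f x) * ip h h @[n --> \oo] --> (0 : R).
  by rewrite -(mul0r (ip h h)); apply: cvgM => //; exact: cvg_cst.
apply/cvgrPdist_lt => e e0; have e2 : 0 < e ^+ 2 by rewrite exprn_gt0.
have /cvgrPdist_lt/(_ _ e2)[m _ hm] := z; exists m => // n /hm /=.
rewrite sub0r normrN => /(le_lt_trans (ler_norm _)) h2.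
rewrite distrC -ipBl// -(@ltr_pXn2r _ 2)// ?nnegrE ?(ltW e0)//.
rewrite real_normK ?num_real//; apply: le_lt_trans h2.
by apply: ip_CS => //; exact: L2B.
Qed.

Lemma ip_cvg (F : nat -> X -> R) f : (forall n, L2 (F n)) -> L2 f ->
  ip (fun x => F n x - f x) (fun x => F n x - f x) @[n --> \oo] --> (0 : R) ->
  ip (F n) (F n) @[n --> \oo] --> ip f f.
Proof.
move=> LF Lf Ff.
have E n : ip (F n) (F n) =
    ip (fun x => F n x - f x) (fun x => F n x - f x) + (2 * ip (F n) f - ip f f).
  have LB : L2 (fun x => F n x - f x) by exact: L2B.
  by rewrite ipBl// !ipBr// (ipC mu f (F n)); ring.
rewrite (_ : ip f f = 0 + (2 * ip f f - ip f f)); last by ring.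
under eq_cvg do rewrite E.
apply: cvgD => //; apply: cvgB; last exact: cvg_cst.
by apply: cvgM; [exact: cvg_cst|exact: ip_cvgl].
Qed.

End L2_limits.

Section wick_square_integrable.
Context (R : realType) (N : gelfand_triple R) (A : {linear ell2 (H0 N) -> ell2 (H0 N)}).
Hypotheses (A_continuous : continuous A) (A_self_adjoint : self_adjoint A).
Context (mu : probability (msdual N) R) (mu_A : is_muA A mu) (K : completion (formA A)).
Local Notation L2 := (L2 mu).
Local Notation ip := (ip mu).
Let Lw := L2_wick A_self_adjoint mu_A.

Section one_degree.
Context (n : nat) (Tn : hilbert_tensor_power K n).
Local Notation iota := (tpow_to_htpow Tn).

Lemma ip_wickB (s t : tpow (sN N) n) : symmetric_tensor s -> symmetric_tensor t ->
  ip (fun w => wick A w s - wick A w t) (fun w => wick A w s - wick A w t) =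
  n`!%:R * `|iota s - iota t| ^+ 2.
Proof.
move=> ss st; have Ls := Lw ss; have Lt := Lw st.
rewrite ipBl ?ipBr//; last exact: L2B.
rewrite !(ip_wick A_self_adjoint mu_A Tn)// -inner_norm innerBl !innerBr; ring.
Qed.

Lemma ip_wickB_le (f : Tn) (s t : tpow (sN N) n) : symmetric_tensor s -> symmetric_tensor t ->
  ip (fun w => wick A w s - wick A w t) (fun w => wick A w s - wick A w t) <=
  2 * (n`!%:R * `|iota s - f| ^+ 2) + 2 * (n`!%:R * `|iota t - f| ^+ 2).
Proof.
move=> ss st; rewrite ip_wickB// (_ : _ - iota t = (iota s - f) - (iota t - f)); last first.
  by rewrite opprB addrA subrK.
rewrite parallelogram mulrBr mulrDr !(mulrCA n`!%:R 2) gerBl mulr_ge0//.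
Qed.

Lemma wick_dist_cvg0 (f : Tn) (phi : nat -> tpow (sN N) n) :
  iota (phi k) @[k --> \oo] --> f -> n`!%:R * `|iota (phi k) - f| ^+ 2 @[k --> \oo] --> (0 : R).
Proof.
move=> hf; rewrite -(mulr0 (n`!%:R)); apply: cvgM; first exact: cvg_cst.
by have := cvg_exprn (k := 2) (cvg_dist0 hf); rewrite expr0n.
Qed.

(** The isometry turns one approximating sequence into a Cauchy sequence of L^2. Any other sequence
    with the same limit stays close to it, which gives independence of the choice. *)
Lemma is_wick_L2_exists (f : Tn) : sym_htpow Tn f -> exists G, is_wick_L2 mu f G.
Proof.
move=> /(sym_htpow_approx A_continuous)[phi sphi phif].
have v0 := wick_dist_cvg0 phif.
have [e e0|G LG phiG] := @L2_complete _ _ _ mu (fun k w => wick A w (phi k)) (fun k => Lw (sphi k)).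
  have e4 : 0 < e / 4 by rewrite divr_gt0.
  have /cvgrPdist_lt/(_ _ e4)[m _ hm] := v0; exists m => i j /hm /= hi /hm /= hj.
  apply: le_trans (ip_wickB_le f (sphi i) (sphi j)) _.
  move: hi hj; rewrite !sub0r !normrN => /(le_lt_trans (ler_norm _)) + /(le_lt_trans (ler_norm _)).
  by move: (n`!%:R * _) (n`!%:R * _) => a b; lra.
exists G; split; first exact/L2P.
move=> psi spsi psif; apply/L2_cvgP => [k||]; [exact: Lw|by []|].
have w0 := wick_dist_cvg0 psif.
have b k : 0 <= ip (fun w => wick A w (psi k) - G w) (fun w => wick A w (psi k) - G w) <=
  2 * (2 * (n`!%:R * `|iota (psi k) - f| ^+ 2) + 2 * (n`!%:R * `|iota (phi k) - f| ^+ 2)) +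
  2 * ip (fun w => wick A w (phi k) - G w) (fun w => wick A w (phi k) - G w).
  rewrite ip_ge0 /=; apply: le_trans (ip_sqrD_le (Lw (spsi k)) (Lw (sphi k)) LG) _.
  by rewrite lerD2r ler_pM2l// ip_wickB_le.
apply: (squeeze_cvgr (nearW _ b)); first exact: cvg_cst.
rewrite (_ : 0 = 2 * (2 * 0 + 2 * 0) + 2 * 0 :> R); last by ring.
apply: cvgD; (apply: cvgM; first exact: cvg_cst) => //.
by apply: cvgD; (apply: cvgM; first exact: cvg_cst).
Qed.

(** Hence the default value of [xget] never occurs for symmetric f. *)
Lemma wick_L2P (f : Tn) : sym_htpow Tn f -> is_wick_L2 mu f (wick_L2 mu f).
Proof.
by move=> /is_wick_L2_exists[G hG]; rewrite /wick_L2; case: xgetP => [_ -> //|/(_ G)].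
Qed.

Lemma L2_wick_L2 (f : Tn) : sym_htpow Tn f -> L2 (wick_L2 mu f).
Proof. by move=> /wick_L2P[] /L2P. Qed.

Lemma wick_L2_approx (f : Tn) : sym_htpow Tn f -> exists phi : nat -> tpow (sN N) n,
  [/\ forall k, symmetric_tensor (phi k), iota (phi k) @[k --> \oo] --> f &
    forall h, L2 h -> ip (fun w => wick A w (phi k)) h @[k --> \oo] --> ip (wick_L2 mu f) h].
Proof.
move=> sf; have [phi sphi phif] := sym_htpow_approx A_continuous sf.
exists phi; split => // h Lh; have LG := L2_wick_L2 sf.
apply: ip_cvgl => //; first by move=> k; exact: Lw.
apply/(L2_cvgP (fun k => Lw (sphi k)) LG).
by have [_] := wick_L2P sf; exact.
Qed.

Lemma ip_wick_L2_wick (f : Tn) (t : tpow (sN N) n) : sym_htpow Tn f -> symmetric_tensor t ->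
  ip (wick_L2 mu f) (fun w => wick A w t) = n`!%:R * inner f (iota t).
Proof.
move=> sf st; have [phi [sphi phif /(_ _ (Lw st)) lim]] := wick_L2_approx sf.
apply: (cvgnR_unique lim).
under eq_cvg do rewrite (ip_wick A_self_adjoint mu_A Tn)//.
apply: cvgM; first exact: cvg_cst.
by apply: cvg_inner_seq => //; exact: cvg_cst.
Qed.

(** Lifts pairings from algebraic tensors to their limits. With g = 0 it gives orthogonality between
    degrees, with g = f the norm and the Bessel identity. *)
Lemma ip_wick_L2_of_wick (f : Tn) F (g : Tn) : sym_htpow Tn f -> L2 F ->
  (forall t, symmetric_tensor t -> ip F (fun w => wick A w t) = n`!%:R * inner g (iota t)) ->
  ip F (wick_L2 mu f) = n`!%:R * inner g f.
Proof.
move=> sf LF Fg; have [phi [sphi phif /(_ _ LF) lim]] := wick_L2_approx sf.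
rewrite ipC; apply: (cvgnR_unique lim).
under eq_cvg do rewrite ipC Fg//.
apply: cvgM; first exact: cvg_cst.
by apply: cvg_inner_seq => //; exact: cvg_cst.
Qed.

(** f - g is orthogonal to limits of symmetric algebraic tensors, thus to f and to g themselves.
    Uniqueness of the kernels rests on this. *)
Lemma sym_htpow_eq (f g : Tn) : sym_htpow Tn f -> sym_htpow Tn g ->
  (forall t, symmetric_tensor t -> inner f (iota t) = inner g (iota t)) -> f = g.
Proof.
move=> sf sg fg.
have lim (h : Tn) : sym_htpow Tn h -> inner (f - g) h = 0.
  move=> /(sym_htpow_approx A_continuous)[phi sphi phih].
  apply: (@cvgnR_unique _ (fun k => inner (f - g) (iota (phi k)))).
    by apply: cvg_inner_seq => //; exact: cvg_cst.
  by under eq_cvg do rewrite innerBl fg// subrr; exact: cvg_cst.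
have : `|f - g| ^+ 2 = 0.
  by rewrite -inner_norm innerBr !lim// subrr.
by move=> /eqP; rewrite sqrf_eq0 normr_eq0 subr_eq0 => /eqP.
Qed.

(* Riesz representation applied to t |-> E[F <t, :.^{(x)n}:>] / n!. *)
Lemma chaos_coefficient F : L2 F -> exists f : Tn, sym_htpow Tn f /\
  forall t, symmetric_tensor t -> ip F (fun w => wick A w t) = n`!%:R * inner f (iota t).
Proof.
move=> LF; have n0 : 0 < n`!%:R :> R by rewrite ltr0n fact_gt0.
(* Symmetric tensors are only a predicate, while [riesz_representation] needs a linear map on a
   module: j and l are therefore precomposed with [symmetrize]. *)
pose j : tpow (sN N) n -> Tn := iota \o @symmetrize R (sN N) n.
pose l (t : tpow (sN N) n) : R := (n`!%:R)^-1 * ip F (fun w => wick A w (symmetrize t)).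
have jl : linear j by move=> a x y; rewrite /j /= linearP linearP.
have sy (t : tpow (sN N) n) : symmetric_tensor (symmetrize t) by exact: symmetrize_symmetric.
have ll : linear (l : _ -> R^o).
  move=> a x y; rewrite /l symmetrize_linear ipC ip_wickl//; try exact: A_self_adjoint.
  by rewrite mulrDr !(ipC mu _ F) mulrCA.
pose J : {linear tpow (sN N) n -> Tn} := HB.pack j (GRing.isLinear.Build _ _ _ _ _ jl).
pose L : {scalar tpow (sN N) n} := HB.pack (l : _ -> R^o) (GRing.isLinear.Build _ _ _ _ _ ll).
(* Cauchy-Schwarz gives |n! l t|^2 <= |F|^2 n! |j t|^2, hence this constant. The approximating
   sequence u places f in the closed symmetric subspace. *)
have [t|f [[u uf] hf]] := @riesz_representation _ _ _ J L (Num.sqrt (ip F F / n`!%:R)).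
  rewrite -(@ler_pXn2r _ 2)// ?nnegrE ?mulr_ge0 ?sqrtr_ge0//.
  rewrite exprMn sqr_sqrtr ?divr_ge0 ?ip_ge0 ?(ltW n0)// real_normK ?num_real//.
  have := ip_CS LF (Lw (sy t)).
  rewrite (ip_wick A_self_adjoint mu_A Tn)// inner_norm -[iota _]/(J t) => h.
  rewrite -[L t]/(l t) /l exprMn exprVn -ler_pdivlMl ?invr_gt0 ?exprn_gt0//.
  apply: (le_trans h); rewrite invrK le_eqVlt; apply/orP; left; apply/eqP.
  by field; rewrite gt_eqF.
exists f; split.
  by apply: (sym_htpow_cvg (t := fun k => symmetrize (u k))) => // k; exact: sy.
move=> t st; have := hf t; rewrite -[L t]/(l t) -[J t]/(j t) /l /j /=.
by rewrite symmetric_tensor_symmetrize// => <-; rewrite mulrA mulfV ?mul1r// gt_eqF.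
Qed.

End one_degree.

Lemma ip_wick_L2_wick_neq n m (Tn : hilbert_tensor_power K n) (f : Tn) (t : tpow (sN N) m) :
  sym_htpow Tn f -> symmetric_tensor t -> n != m ->
  ip (wick_L2 mu f) (fun w => wick A w t) = 0.
Proof.
move=> sf st nm; have [phi [sphi phif /(_ _ (Lw st)) lim]] := wick_L2_approx sf.
apply: (cvgnR_unique lim).
by under eq_cvg do rewrite (ip_wick_neq A_self_adjoint mu_A)//; exact: cvg_cst.
Qed.

Lemma ip_wick_L2_neq n m (Tn : hilbert_tensor_power K n) (Tm : hilbert_tensor_power K m)
    (f : Tn) (g : Tm) : sym_htpow Tn f -> sym_htpow Tm g -> n != m ->
  ip (wick_L2 mu f) (wick_L2 mu g) = 0.
Proof.
move=> sf sg nm; rewrite (ip_wick_L2_of_wick (g := 0) sg (L2_wick_L2 sf)) ?inner0l ?mulr0// => t st.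
by rewrite ip_wick_L2_wick_neq// inner0l mulr0.
Qed.

Lemma ip_wick_L2 n (Tn : hilbert_tensor_power K n) (f : Tn) : sym_htpow Tn f ->
  ip (wick_L2 mu f) (wick_L2 mu f) = n`!%:R * `|f| ^+ 2.
Proof.
move=> sf; rewrite (ip_wick_L2_of_wick (g := f) sf (L2_wick_L2 sf)) ?inner_norm// => t st.
exact: ip_wick_L2_wick.
Qed.

End wick_square_integrable.

(** * Convergence and coefficients of the chaos series *)

Section chaos_series.
Context (R : realType) (N : gelfand_triple R) (A : {linear ell2 (H0 N) -> ell2 (H0 N)}).
Hypotheses (A_continuous : continuous A) (A_self_adjoint : self_adjoint A).
Context (mu : probability (msdual N) R) (mu_A : is_muA A mu) (K : completion (formA A)).
Context (T : forall n, hilbert_tensor_power K n).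
Local Notation L2 := (L2 mu).
Local Notation ip := (ip mu).
Let Lw := L2_wick A_self_adjoint mu_A.
Let LW := L2_wick_L2 A_continuous A_self_adjoint mu_A.

Section partial_sums.
Variable f : forall n, T n.
Hypothesis symf : forall n, sym_htpow (T n) (f n).

Let S m (w : msdual N) : R := \sum_(n < m) wick_L2 mu (f n) w.
Let a n : R := n`!%:R * `|f n| ^+ 2.

Let LS m : L2 (S m).
Proof. by apply: L2_sum => i; exact: LW. Qed.

Lemma ip_partial_sum_wick m n (t : tpow (sN N) n) : symmetric_tensor t -> (n < m)%N ->
  ip (S m) (fun w => wick A w t) = n`!%:R * inner (f n) (tpow_to_htpow (T n) t).
Proof.
move=> st nm; rewrite ip_suml; [|by move=> i; exact: LW|exact: Lw].
rewrite (bigD1 (Ordinal nm))//= (ip_wick_L2_wick A_continuous A_self_adjoint mu_A)//.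
rewrite big1 ?addr0// => i ni; apply: (ip_wick_L2_wick_neq A_continuous A_self_adjoint mu_A) => //.
Qed.

Lemma ip_partial_sum m k : (k <= m)%N -> ip (S m) (S k) = series a k.
Proof.
move=> km; rewrite ipC ip_suml; [|by move=> i; exact: LW|exact: LS].
rewrite /series /= big_mkord; apply: eq_bigr => i _; have im := leq_trans (ltn_ord i) km.
rewrite ipC ip_suml; [|by move=> j; exact: LW|exact: LW].
rewrite (bigD1 (Ordinal im))//= (ip_wick_L2 A_continuous A_self_adjoint mu_A)//.
rewrite big1 ?addr0// => j ij; apply: (ip_wick_L2_neq A_continuous A_self_adjoint mu_A) => //.
Qed.

(** By orthogonality, the partial sums are Cauchy in L^2 as soon as the real series of squared norms
    converges. *)
Lemma ip_partial_sumB m k : ip (fun w => S m w - S k w) (fun w => S m w - S k w) =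
  `|series a m - series a k|.
Proof.
wlog km : m k / (k <= m)%N => [h|].
  have /orP[km|mk] := leq_total k m; first exact: h.
  by rewrite distrC -h//; apply: eq_Rintegral => w _; ring.
rewrite ipBl ?ipBr//; last exact: L2B.
rewrite (ipC mu (S k) (S m)) !ip_partial_sum// ger0_norm; first by ring.
rewrite subr_ge0; apply: nondecreasing_series km => n _ _.
by rewrite mulr_ge0// exprn_ge0.
Qed.

(** The pairing of S m with a Wick power of degree n is constant once m > n. An expansion thus
    determines all pairings of its sum. *)
Lemma ip_of_chaos_series F n (t : tpow (sN N) n) : L2 F -> L2_cvg mu S F ->
  symmetric_tensor t ->
  ip F (fun w => wick A w t) = n`!%:R * inner (f n) (tpow_to_htpow (T n) t).
Proof.
move=> LF /(L2_cvgP LS LF) SF st.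
apply: (cvgnR_unique (ip_cvgl LS LF (Lw st) SF)).
apply: cvg_near_cst; exists n.+1 => // m /= nm; exact: ip_partial_sum_wick.
Qed.

Lemma norm_of_chaos_series F : L2 F -> L2_cvg mu S F -> series a m @[m --> \oo] --> ip F F.
Proof.
move=> LF /(L2_cvgP LS LF) SF.
by under eq_cvg do rewrite -(ip_partial_sum (leqnn _)); exact: ip_cvg.
Qed.

(** Bessel's inequality: |F - S m|^2 = |F|^2 - [series] a m is nonnegative. The sum G is not yet
    identified with F; that takes totality. *)
Lemma chaos_series_cvg F : L2 F ->
  (forall n t, symmetric_tensor t -> ip F (fun w => wick A w t) =
    n`!%:R * inner (f n) (tpow_to_htpow (T n) t)) ->
  exists2 G, L2 G & L2_cvg mu S G.
Proof.
move=> LF Ff.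
have FS m : ip F (S m) = series a m.
  rewrite ipC ip_suml; [|by move=> i; exact: LW|exact: LF].
  rewrite /series /= big_mkord; apply: eq_bigr => i _; rewrite ipC.
  rewrite (ip_wick_L2_of_wick A_continuous A_self_adjoint mu_A (@symf i) LF (g := f i)) ?inner_norm//.
  exact: Ff.
have bessel m : series a m <= ip F F.
  have := ip_ge0 mu (fun w => F w - S m w).
  rewrite ipBl ?ipBr//; last exact: L2B.
  by rewrite (ipC mu (S m) F) FS ip_partial_sum// subrr subr0 subr_ge0.
have ca : cvgn (series a).
  apply: nondecreasing_is_cvgn.
    by apply: nondecreasing_series => n _ _; rewrite mulr_ge0// exprn_ge0.
  by exists (ip F F) => _ [m _ <-].
have [e e0|G LG SG] := L2_complete LS; last by exists G => //; exact/L2_cvgP.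
have e2 : 0 < e / 2 by rewrite divr_gt0.
have /cvgrPdist_lt/(_ _ e2)[m hm0 hm] := ca; exists m => i j /hm /= hi /hm /= hj.
rewrite ip_partial_sumB -(subrKA (limn (series a))) (le_trans (ler_normD _ _))//.
by rewrite distrC [leRHS]splitr ltW// ltrD.
Qed.

End partial_sums.

End chaos_series.

Theorem theorem2p45 (R : realType) (N : gelfand_triple R)
    (H_separable : separable (H0 N)) (H_infinite : infinite_dim (H0 N))
    (A : {linear ell2 (H0 N) -> ell2 (H0 N)}) (A_continuous : continuous A)
    (A_self_adjoint : self_adjoint A) (A_positive : positive_definite A)
    (mu : probability (msdual N) R) (mu_A : is_muA A mu)
    (K : completion (formA A)) (T : forall n, hilbert_tensor_power K n)
    (F : msdual N -> R) (F_L2 : F \in Lfun mu 2%:E) :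
  exists f : forall n, T n,
    [/\ chaos_decomposition mu F f,
        forall g : forall n, T n,
          chaos_decomposition mu F g -> forall n, g n = f n
      & ('N[mu]_2%:E[EFin \o F] ^+ 2 =
         \sum_(0 <= n <oo) (n`!%:R * `|f n| ^+ 2)%:E)%E ].
Proof.
have LF : L2 mu F by exact/L2P.
pose f n := projT1 (cid (chaos_coefficient A_self_adjoint mu_A (T n) LF)).
have fP n : sym_htpow (T n) (f n) /\ forall t, symmetric_tensor t ->
    ip mu F (fun w => wick A w t) = n`!%:R * inner (f n) (tpow_to_htpow (T n) t).
  by rewrite /f; case: cid.
have symf n : sym_htpow (T n) (f n) by case: (fP n).
have Ff n t : symmetric_tensor t -> ip mu F (fun w => wick A w t) =
    n`!%:R * inner (f n) (tpow_to_htpow (T n) t).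
  by case: (fP n) => _; exact.
have LS m : L2 mu (fun w => \sum_(n < m) wick_L2 mu (f n) w).
  by apply: L2_sum => n; exact: L2_wick_L2.
have [G LG SG] := chaos_series_cvg A_continuous A_self_adjoint mu_A symf LF Ff.
have LGF : L2 mu (fun w => G w - F w) by exact: L2B.
(* F and G pair equally with all Hermite polynomials. The generation hypothesis of [hermite_total]
   holds by the definition of the sigma-algebra on [msdual]. *)
have GF0 : ip mu (fun w => G w - F w) (fun w => G w - F w) = 0.
  apply: (hermite_total (gaussian_family_muA A_self_adjoint mu_A)) => // phi n.
  rewrite (_ : hermite _ _ n phi = fun w : msdual N => wick A w (tens (fun=> phi) : tpow (sN N) n)); last first.
    by apply/funext => w; rewrite wick_hermite.
  have st : symmetric_tensor (tens (fun=> phi) : tpow (sN N) n) by exact: tens_cst_symmetric.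
  rewrite ipBl ?Ff//; last exact: L2_wick.
  by rewrite (ip_of_chaos_series A_continuous A_self_adjoint mu_A symf LG SG st) subrr.
have SF : L2_cvg mu (fun m w => \sum_(n < m) wick_L2 mu (f n) w) F.
  apply/(L2_cvgP LS LF); move/(L2_cvgP LS LG): SG => SG.
  have b m : 0 <= ip mu (fun w => \sum_(n < m) wick_L2 mu (f n) w - F w)
      (fun w => \sum_(n < m) wick_L2 mu (f n) w - F w) <=
      2 * ip mu (fun w => \sum_(n < m) wick_L2 mu (f n) w - G w)
      (fun w => \sum_(n < m) wick_L2 mu (f n) w - G w).
    rewrite ip_ge0 /=; apply: le_trans (ip_sqrD_le (LS m) LG LF) _.
    by rewrite GF0 mulr0 addr0.
  apply: (squeeze_cvgr (nearW _ b)); first exact: cvg_cst.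
  by rewrite -[X in _ --> X](mulr0 2); apply: cvgM => //; exact: cvg_cst.
exists f; split => [//|g [symg Sg] n|].
  (* The pairings of F with Wick powers are n! times those of g n as well as of f n, and n! is
     nonzero. *)
  apply: (sym_htpow_eq A_continuous) => // t st.
  have := ip_of_chaos_series A_continuous A_self_adjoint mu_A symg LF Sg st.
  rewrite Ff// => /mulfI <- //; by rewrite pnatr_eq0 -lt0n fact_gt0.
rewrite Lnorm_sqr//; apply/esym/cvg_lim => //.
rewrite (_ : (fun m => _) = EFin \o series (fun n => n`!%:R * `|f n| ^+ 2)); last first.
  by apply/funext => m; rewrite /series /= sumEFin.
apply: cvg_EFin; first by near=> m.
exact: (norm_of_chaos_series A_continuous A_self_adjoint mu_A symf LF SF).
Unshelve. all: by end_near. Qed.
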